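(* Let $\mathcal{D}$ be a diagram (a finite multiset of subsets of $[n]$) that has an ascent at $i$, where $1\le i\le n-1$, and suppose the Schubitope $\mathcal{S}_{\mathcal{D}}$ is an MV polytope. Let $\ell$ be the number of subsets $C$ of $\mathcal{D}$ (counted with multiplicity) such that $i\in C$ and $i+1\notin C$. Then $$\mathbf{e}_i^{\ell}\cdot\mathcal{S}_{\mathcal{D}}=\mathcal{S}_{s_i\mathcal{D}}=\operatorname{Newton}(\Lambda_i\chi_{\mathcal{D}}).$$
   Context: Ascents: $\mathcal{D}$ has an ascent at $i$ if every $C\in\mathcal{D}$ satisfies $C\cap\{i,i+1\}\neq\{i+1\}$. $s_i\mathcal{D}$ is the diagram obtained by exchanging the elements $i$ and $i+1$ in every set of $\mathcal{D}$ (i.e. swapping rows $i$ and $i+1$). Demazure operator: $\Lambda_if=\frac{x_if-x_{i+1}\,s_if}{x_i-x_{i+1}}$ on $\mathbb{C}[x_1,\dots,x_n]$, where $s_i$ swaps $x_i$ and $x_{i+1}$. For $f=\sum_{\alpha\in\mathbb{N}^n}c_\alpha x^\alpha$, $\operatorname{Newton}(f)=\operatorname{conv}(\alpha:c_\alpha\neq0)\subseteq\mathbb{R}^n$. Schubitope: let $S_1,\dots,S_m$ be the distinct sets occurring in $\mathcal{D}$, with multiplicities $a_1,\dots,a_m$. Let $\operatorname{Gr}(\mathcal{D})=\operatorname{Gr}(|S_1|,n)\times\cdots\times\operatorname{Gr}(|S_m|,n)$ (Grassmannians of subspaces of $\mathbb{C}^n$), and let $z_{S_i}\in\operatorname{Gr}(|S_i|,n)$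 be the coordinate subspace spanned by the standard basis vectors indexed by $S_i$ (the torus-fixed point whose only non-vanishing Plücker coordinate is $p_{S_i}$). Let $B\subseteq \mathrm{GL}_n(\mathbb{C})$ be the Borel subgroup of upper triangular matrices, acting on subspaces of $\mathbb{C}^n$ in the natural way, and let $\mathcal{F}_{\mathcal{D}}^B$ be the closure of the $B$-orbit of $z_{\mathcal{D}}=(z_{S_1},\dots,z_{S_m})$ in $\operatorname{Gr}(\mathcal{D})$. Let $\mathcal{L}_{\mathcal{D}}$ be the pullback to $\mathcal{F}_{\mathcal{D}}^B$ of the line bundle $\mathcal{O}(a_1,\dots,a_m)$ on $\operatorname{Gr}(\mathcal{D})$, where $\mathcal{O}(1)$ on each Grassmannian is the (equivariant) dual of the top exterior power of the tautological subbundle. The dual flagged Weyl module is the $B$-module $H^0(\mathcal{F}_{\mathcal{D}}^B,\mathcal{L}_{\mathcal{D}})^*$, and $\chi_{\mathcal{D}}\in\mathbb{Z}[x_1,\dots,x_n]$ denotes its character, i.e. the trace of $\operatorname{diag}(x_1,\dots,x_n)$. The Schubitope is $\mathcal{S}_{\mathcal{D}}=\operatorname{Newton}(\chi_{\mathcal{D}})$. MV polytopes: a generalized permutahedron on $[n]$ is a polytope $P\subseteq\mathbb{R}^n$ such that every edge of $P$ is parallel to a vector $e_i-e_j$ with $i\neq j$ (points are allowed), where $e_1,\dots,e_n$ is the standard basis. It is a lattice generalized permutahedron if all its vertices lie in $\mathbb{Z}^n$. Its submodular function is $\mu_P(S)=\max_{x\in P}\sum_{i\in S}x_i$ for $S\subseteq[n]$;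 $P$ is determined by $\mu_P$. A lattice generalized permutahedron $P$ is a Mirković–Vilonen (MV) polytope on $[n]$ if for all $S\subseteq[n]$ and all $a<b<c$ in $[n]\setminus S$, $$\mu_P(S\cup\{a,c\})+\mu_P(S\cup\{b\})=\max\bigl(\mu_P(S\cup\{b,c\})+\mu_P(S\cup\{a\}),\ \mu_P(S\cup\{a,b\})+\mu_P(S\cup\{c\})\bigr).$$ Raising operators: for an MV polytope $P$ on $[n]$ with submodular function $\mu$ and $1\le i\le n-1$, $\mathbf{e}_i\cdot P$ is the MV polytope whose submodular function is $$\mu'(S)=\begin{cases}\max\bigl(\mu(S),\ \mu((S\setminus\{i+1\})\cup\{i\})-c\bigr)&\text{if } i\notin S,\ i+1\in S,\\ \mu(S)&\text{otherwise,}\end{cases}$$ where $c=\mu([n]\setminus s_i[i])-\mu([n]\setminus[i])-1$ and $s_i[i]=\{1,\dots,i-1,i+1\}$ (a theorem of Kamnitzer guarantees this is an MV polytope). $\mathbf{e}_i^{\ell}$ is the $\ell$-fold iterate of $\mathbf{e}_i$. *)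

(* Defs.v *)
From mathcomp Require Import all_boot all_order all_fingroup all_algebra.
From mathcomp Require Import boolp classical_sets reals.
From mathcomp Require Import complex.
From mathcomp Require Import mpoly.

Set Implicit Arguments.
Unset Strict Implicit.
Unset Printing Implicit Defensive.

Import Order.TTheory GRing.Theory Num.Theory.

Local Open Scope ring_scope.

(* The set [n] = {1, ..., n} is 'I_n, shifted by one.  A pair of adjacent     *)
(* elements i, i+1 of [n] is given by i j : 'I_n with j = i.+1 :> nat.        *)

(* A multiset of subsets of [n] is given by its multiplicity function.        *)
Definition diagram (n : nat) := {ffun {set 'I_n} -> nat}.

Definition dsupp n (D : diagram n) := {S : {set 'I_n} | D S != 0%N}.

Definition has_ascent n (D : diagram n) (i j : 'I_n) : Prop :=
  forall C : {set 'I_n}, D C != 0%N -> C :&: [set i; j] <> [set j].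

Definition swap_set n (i j : 'I_n) (S : {set 'I_n}) : {set 'I_n} :=
  tperm i j @: S.

(* swap_set i j is an involution, so C occurs in s_i D exactly as many times  *)
(* as swap_set i j C occurs in D.                                             *)
Definition swap_diagram n (i j : 'I_n) (D : diagram n) : diagram n :=
  [ffun C => D (swap_set i j C)].

Definition num_raises n (D : diagram n) (i j : 'I_n) : nat :=
  (\sum_(C : {set 'I_n} | (i \in C) && (j \notin C)) D C)%N.

Section FlaggedWeyl.
Variables (R : realType) (n : nat) (D : diagram n).
Let C : numClosedFieldType := complex R.

(* A point of Gr(k, n) is given by a frame, i.e. an n x k matrix of rank k,   *)
(* whose columns are a basis of the subspace; M and M *m g with g in GL_k     *)
(* give the same point.  Thus Gr(D) is the quotient of the set of M with      *)
(* [is_frame M] by the product of the groups GL_#|S|, S in the support of D.  *)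
(* The quotient map is a Zariski-locally trivial principal bundle: subsets of *)
(* Gr(D) are represented by their preimages, and this is compatible with      *)
(* Zariski closure.                                                           *)
Definition mxfamily := forall S : dsupp D, 'M[C]_(n, #|val S|).

Definition is_frame (M : mxfamily) : Prop := forall S, row_full (M S).

Definition coord_frame : mxfamily :=
  fun S => \matrix_(r, c) (r == enum_val c)%:R.

Definition translate (b : 'M[C]_n) (M : mxfamily) : mxfamily :=
  fun S => b *m M S.

Definition reframe (M : mxfamily) (g : forall S : dsupp D, 'M[C]_#|val S|) :
    mxfamily :=
  fun S => M S *m g S.

(* mathcomp's [is_trig_mx] means lower triangular.                            *)
Definition borel (b : 'M[C]_n) : Prop := is_trig_mx b^T /\ b \in unitmx.

Definition borel_orbit (M : mxfamily) : Prop :=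
  exists b g, [/\ borel b, forall S, g S \in unitmx
                & M = reframe (translate b coord_frame) g].

(* The polynomial functions of all the entries of a family of matrices.       *)
Definition entry := {S : dsupp D & ('I_n * 'I_#|val S|)%type}.

Definition entry_val (M : mxfamily) (k : 'I_#|{: entry}|) : C :=
  let e := enum_val k in M (tag e) (tagged e).1 (tagged e).2.

Definition entry_poly := {mpoly C[#|{: entry}|]}.

Definition evalp (p : entry_poly) (M : mxfamily) : C := p.@[entry_val M].

Definition FDB (M : mxfamily) : Prop :=
  is_frame M /\
  forall p : entry_poly,
    (forall M', borel_orbit M' -> evalp p M' = 0) -> evalp p M = 0.

Definition is_regular (s : mxfamily -> C) : Prop :=
  forall M, FDB M ->
    exists p q : entry_poly, evalp q M != 0 /\
      forall M', FDB M' -> evalp q M' != 0 -> s M' = evalp p M' / evalp q M'.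

(* The fibre of O(1) at V is the dual of the top exterior power of V; one of  *)
(* its elements is given by its value at v_1 /\ ... /\ v_k for each frame     *)
(* (v_1, ..., v_k) of V, and the values at M and M *m g differ by \det g.     *)
(* Hence a section of O(a_1, ..., a_m) is a regular function of the frame     *)
(* with the equivariance below.  Only the values of s on FDB matter.          *)
Definition is_section (s : mxfamily -> C) : Prop :=
  is_regular s /\
  forall M g, FDB M -> (forall S, g S \in unitmx) ->
    s (reframe M g) = (\prod_(S : dsupp D) \det (g S) ^+ D (val S)) * s M.

Definition is_basis d (e : 'I_d -> mxfamily -> C) : Prop :=
  [/\ forall k, is_section (e k),
      forall c : 'I_d -> C,
        (forall M, FDB M -> \sum_k c k * e k M = 0) -> forall k, c k = 0
    & forall s, is_section s ->
        exists c : 'I_d -> C, forall M, FDB M -> s M = \sum_k c k * e k M].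

Definition act_section (b : 'M[C]_n) (s : mxfamily -> C) : mxfamily -> C :=
  fun M => s (translate (invmx b) M).

Definition section_mx d (e : 'I_d -> mxfamily -> C) (b : 'M[C]_n)
    (A : 'M[C]_d) : Prop :=
  forall k M, FDB M -> act_section b (e k) M = \sum_l A l k * e l M.

(* The matrix of b on H^0(F_D^B, L_D)^*, in the basis dual to e: the          *)
(* transpose of the matrix of b^-1 on H^0(F_D^B, L_D).                        *)
Definition dual_section_mx d (e : 'I_d -> mxfamily -> C) (b : 'M[C]_n)
    (A : 'M[C]_d) : Prop :=
  section_mx e (invmx b) A^T.

(* chi is the character of the dual flagged Weyl module of D.  It is unique,  *)
(* since a polynomial is determined by its values on the torus.               *)
Definition is_character (chi : {mpoly C[n]}) : Prop :=
  exists d (e : 'I_d -> mxfamily -> C), is_basis e /\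
    forall x : 'rV[C]_n, (forall k, x 0 k != 0) ->
      exists2 A : 'M[C]_d, dual_section_mx e (diag_mx x) A
                         & chi.@[fun k => x 0 k] = \tr A.

End FlaggedWeyl.

Section Demazure.
Variables (K : fieldType) (n : nat) (i j : 'I_n).

Lemma demazure_dvd (f : {mpoly K[n]}) :
  exists g, ('X_i - 'X_j) * g == 'X_i * f - 'X_j * msym (tperm i j) f.
Proof.
pose s := tperm i j.
suff [h hE] : exists h : {mpoly K[n]}, f - msym s f = ('X_i - 'X_j) * h.
  exists (f + 'X_j * h); apply/eqP; rewrite mulrDr mulrCA -hE -/s.
  by rewrite mulrBl mulrBr addrA subrK.
have dvdM (g1 g2 : {mpoly K[n]}) :
    (exists h, g1 - msym s g1 = ('X_i - 'X_j) * h) ->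
    (exists h, g2 - msym s g2 = ('X_i - 'X_j) * h) ->
    exists h, g1 * g2 - msym s (g1 * g2) = ('X_i - 'X_j) * h.
  move=> [h1 e1] [h2 e2]; exists (g1 * h2 + h1 * msym s g2).
  rewrite msymM mulrDr mulrCA -e2 mulrA -e1.
  by rewrite mulrBr mulrBl addrA subrK.
have hone : exists h, 1 - msym s 1 = ('X_i - 'X_j) * h :> {mpoly K[n]}.
  by exists 0; rewrite rmorph1 subrr mulr0.
elim/mpolyind: f => [|c m p _ _ [h hE]].
  by exists 0; rewrite raddf0 subrr mulr0.
pose P (p : {mpoly K[n]}) := exists h, p - msym s p = ('X_i - 'X_j) * h.
suff [h' hE'] : P 'X_[m].
  exists (c *: h' + h); rewrite msymD msymZ mulrDr -scalerAr -hE -hE'.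
  by rewrite opprD addrACA scalerBr.
rewrite mpolyXE_id -/(P _); apply: (@big_ind _ P) => // k _; rewrite /P.
elim: (m k) => [|e IH]; first by rewrite expr0.
rewrite exprS; apply: dvdM => //.
have -> : msym s ('X_k : {mpoly K[n]}) = 'X_(s k).
  rewrite msymX; congr 'X_[_]; apply/mnmP => l.
  by rewrite mnmE !mnm1E -(inj_eq (@perm_inj _ s)) permKV.
rewrite /s; case: tpermP => [->|->|_ _].
- by exists 1; rewrite mulr1.
- by exists (-1); rewrite mulrN1 opprB.
- by exists 0; rewrite subrr mulr0.
Qed.

(* For i != j, the unique g with (x_i - x_j) g = x_i f - x_j (s_i f).         *)
Definition demazure (f : {mpoly K[n]}) : {mpoly K[n]} :=
  xchoose (demazure_dvd f).

Lemma demazureE (f : {mpoly K[n]}) :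
  ('X_i - 'X_j) * demazure f = 'X_i * f - 'X_j * msym (tperm i j) f.
Proof. exact/eqP/(xchooseP (demazure_dvd f)). Qed.

End Demazure.

Section Polytopes.
Variables (R : realType) (n : nat).
Local Open Scope classical_set_scope.

Definition hull (s : seq 'rV[R]_n) : set 'rV[R]_n :=
  [set x | exists c : 'I_(size s) -> R,
     [/\ forall k, 0 <= c k, \sum_k c k = 1 & x = \sum_k c k *: s`_k]].

Definition Newton (f : {mpoly (complex R)[n]}) : set 'rV[R]_n :=
  hull [seq \row_k (m k)%:R | m : 'X_{1..n} <- msupp f].

Definition is_polytope (P : set 'rV[R]_n) : Prop :=
  exists2 s, s != [::] & P = hull s.

Definition dot (w x : 'rV[R]_n) : R := \sum_k w 0 k * x 0 k.

(* Every nonempty face of a polytope is the set of maximizers of some linear  *)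
(* functional.                                                                *)
Definition face (P : set 'rV[R]_n) (w : 'rV[R]_n) : set 'rV[R]_n :=
  [set x | P x /\ forall y, P y -> dot w y <= dot w x].

Definition is_vertex (P : set 'rV[R]_n) (v : 'rV[R]_n) : Prop :=
  exists w, face P w = [set v].

Definition is_edge (P : set 'rV[R]_n) (u v : 'rV[R]_n) : Prop :=
  u <> v /\ exists w, face P w = hull [:: u; v].

Definition is_gen_permutahedron (P : set 'rV[R]_n) : Prop :=
  is_polytope P /\
  forall u v, is_edge P u v ->
    exists a b : 'I_n, exists t : R,
      a != b /\ v - u = t *: (delta_mx 0 a - delta_mx 0 b).

Definition is_lattice (P : set 'rV[R]_n) : Prop :=
  forall v, is_vertex P v -> forall k, exists z : int, v 0 k = z%:~R.

Definition submod (P : set 'rV[R]_n) (S : {set 'I_n}) : R :=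
  sup [set \sum_(k in S) x 0 k | x in P].

Definition is_MV (P : set 'rV[R]_n) : Prop :=
  [/\ is_gen_permutahedron P, is_lattice P
    & forall (S : {set 'I_n}) (a b c : 'I_n), (a < b < c)%N ->
        a \notin S -> b \notin S -> c \notin S ->
        submod P (S :|: [set a; c])%SET + submod P (S :|: [set b])%SET =
        Num.max
          (submod P (S :|: [set b; c])%SET + submod P (S :|: [set a])%SET)
          (submod P (S :|: [set a; b])%SET + submod P (S :|: [set c])%SET)].

Definition initial (i : 'I_n) : {set 'I_n} := [set k : 'I_n | (k <= i)%N]%SET.

Definition raise_const (i j : 'I_n) (mu : {set 'I_n} -> R) : R :=
  mu (~: swap_set i j (initial i))%SET - mu (~: initial i)%SET - 1.

Definition raise_submod (i j : 'I_n) (mu : {set 'I_n} -> R) (S : {set 'I_n}) : R :=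
  if (i \notin S) && (j \in S)
  then Num.max (mu S) (mu (i |: (S :\ j))%SET - raise_const i j mu)
  else mu S.

(* e_i . P: the MV polytope with submodular function raise_submod; the value  *)
(* set0 is a default for the (void, if P is MV) case that there is none.      *)
Definition raise (i j : 'I_n) (P : set 'rV[R]_n) : set 'rV[R]_n :=
  xget set0
    [set Q | is_MV Q /\ forall S, submod Q S = raise_submod i j (submod P) S].

End Polytopes.

(* Main.v *)
(* Write h_S(w) for the maximum of the w-weight over the sets below S in Gale  *)
(* order, and h_D for the sum of the h_S with multiplicities.  A normalised    *)
(* one-parameter degeneration of a point of the flagged variety towards a      *)
(* torus-fixed point bounds the weights of all sections, and products of       *)
(* Pluecker coordinates attain the bound, so h_D is the support function of    *)
(* Newton(chi_D); cancellations are excluded because the coefficients of chi   *)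
(* are traces of idempotents.                                                  *)
(* Under an ascent h_{s_i D}(w) is h_D(w) if w_i >= w_{i+1} and h_D(s_i w)     *)
(* otherwise.  The constant in the raising operator is l - 1 for S_D and drops *)
(* by one at each step, so for S containing i+1 but not i, e_i^k replaces      *)
(* mu(S) by                                                                    *)
(* max(mu(S), mu(s_i S) - l + k), which is h_{s_i D} when k = l.  That every   *)
(* step stays MV is a tropical computation: all three-term relations carry     *)
(* over term by term, except one that follows from the other seven on four     *)
(* elements.  The edge condition makes a generalized permutahedron the hull of *)
(* its greedy points, so that it is determined by its submodular function.     *)
(* Finally (x_i - x_{i+1}) Lambda_i f = x_i f - x_{i+1} s_i f has for          *)
(* w_i > w_{i+1} the w-leading part of x_i f, which gives the support function *)
(* of Newton(Lambda_i f).                                                      *)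

Require Import Defs.
From mathcomp Require Import all_boot all_order all_fingroup all_algebra.
From mathcomp Require Import boolp classical_sets reals.
From mathcomp Require Import complex.
From mathcomp Require Import mpoly.
From mathcomp Require Import separable cyclotomic.
From mathcomp Require Import ring lra zify.
(* Imported last: its set0, setT, ... must shadow those of classical_sets.    *)
From mathcomp Require Import finset.

Set Implicit Arguments.
Unset Strict Implicit.
Unset Printing Implicit Defensive.

Import Order.TTheory GRing.Theory Num.Theory.

Local Open Scope ring_scope.

(** * Hulls and separation *)

(** Polytopes are compared through their support functions. The common yardstick is the hull of
    [lowered_points], whose support function [schubitope] is the largest weight obtained by moving
    the elements of each set of the diagram injectively downwards.

    Character: [Newton_character] identifies the Schubitope with this hull. Every family of
    lowerings gives a product of minors [plucker], a nonzero weight section, so its weight occurs in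
    the character ([lowered_weight_msupp]). Conversely, along a one-parameter subgroup acting on a
    point of the variety, a section has a pole of order at most the maximal lowered weight
    ([section_degree_le]); expressing the trace by values of sections bounds the character, whose
    coefficients are nonnegative, so its top weight cannot cancel ([character_degree_le]).

    Raising: a generalized permutahedron is the hull of the greedy points of its submodular function
    ([gen_perm_greedy_hull]), so [raise] can be computed on functions as soon as raising keeps a
    function MV ([raise_MV_function]). The iterates have the closed form [iter_raise_submod]. Under
    the ascent, the support function of the swapped diagram is symmetric in the coordinates [i] and
    [j] ([schubitope_swapv]) and agrees with that of [D] where [w_i >= w_j] ([schubitope_swap]).
    There an order with [i] before [j] only meets prefixes on which raising changes nothing, so the
    greedy point of [D] serves for both; symmetry gives the other half-space
    ([raise_lowered_points]).

    Demazure operator: where [w_i > w_j] the leading part of [(x_i - x_j) * Lambda f] comes from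
    [x_i f] alone ([demazure_weight_le], [demazure_weight_attained]), and [Lambda f] is symmetric
    ([msym_demazure]). The wall [w_i = w_j] is reached by density ([hull_dense]). *)

Section Convex.
Variables (R : realType).
Implicit Types n : nat.

Lemma dotC n (v w : 'rV[R]_n) : dot v w = dot w v.
Proof. by apply: eq_bigr => k _; rewrite mulrC. Qed.

Lemma dotDr n (w u v : 'rV[R]_n) : dot w (u + v) = dot w u + dot w v.
Proof.
by rewrite -big_split; apply: eq_bigr => k _; rewrite mxE mulrDr.
Qed.

Lemma dotZr n a (w u : 'rV[R]_n) : dot w (a *: u) = a * dot w u.
Proof. by rewrite mulr_sumr; apply: eq_bigr => k _; rewrite mxE mulrCA. Qed.

Lemma dotNr n (w u : 'rV[R]_n) : dot w (- u) = - dot w u.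
Proof. by rewrite -scaleN1r dotZr mulN1r. Qed.

Lemma dotBr n (w u v : 'rV[R]_n) : dot w (u - v) = dot w u - dot w v.
Proof. by rewrite dotDr dotNr. Qed.

Lemma dotDl n (w u v : 'rV[R]_n) : dot (u + v) w = dot u w + dot v w.
Proof. by rewrite dotC dotDr !(dotC w). Qed.

Lemma dotZl n a (w u : 'rV[R]_n) : dot (a *: u) w = a * dot u w.
Proof. by rewrite dotC dotZr (dotC w). Qed.

Lemma dotBl n (w u v : 'rV[R]_n) : dot (u - v) w = dot u w - dot v w.
Proof. by rewrite dotC dotBr !(dotC w). Qed.

Lemma dot0r n (w : 'rV[R]_n) : dot w 0 = 0.
Proof. by rewrite -(scale0r 0) dotZr mul0r. Qed.

Lemma dot_sumr n I (r : seq I) (P : pred I) (F : I -> 'rV[R]_n) w :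
  dot w (\sum_(k <- r | P k) F k) = \sum_(k <- r | P k) dot w (F k).
Proof. by apply: (big_morph (dot w)); [apply: dotDr|apply: dot0r]. Qed.

Lemma dot_delta n (x : 'rV[R]_n) k : dot (delta_mx 0 k) x = x 0 k.
Proof.
rewrite /dot (bigD1 k) //= big1 ?addr0 => [|l lk]; first by rewrite mxE !eqxx mul1r.
by rewrite mxE (negPf lk) andbF mul0r.
Qed.

Lemma dot_self_eq0 n (x : 'rV[R]_n) : dot x x = 0 -> x = 0.
Proof.
move=> /eqP; rewrite psumr_eq0 => [/allP x0|k _]; last by rewrite -expr2 sqr_ge0.
apply/rowP => k; rewrite mxE; apply/eqP.
by have := x0 k (mem_index_enum _); rewrite /= mulf_eq0 orbb.
Qed.

Lemma dot_row_mx n m (a b : 'rV[R]_n) (c d : 'rV[R]_m) :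
  dot (row_mx a c) (row_mx b d) = dot a b + dot c d.
Proof.
rewrite /dot big_split_ord; congr (_ + _); apply: eq_bigr => k _.
  by rewrite !row_mxEl.
by rewrite !row_mxEr.
Qed.

(** The conic hull, by recursion on the generators so that the induction of [farkas] can peel them
    off one at a time. *)
Fixpoint cone n (s : seq 'rV[R]_n) (b : 'rV[R]_n) : Prop :=
  if s is a :: s' then exists2 c, 0 <= c & cone s' (b - c *: a) else b = 0.

(* Bartl's induction: if xb witnesses that the last constraint is needed,     *)
(* normalise a(xb) = 1 and replace every functional f by f - f(xb) a.         *)
Lemma farkas n (s : seq 'rV[R]_n) b :
  (forall x, (forall a, a \in s -> dot a x <= 0) -> dot b x <= 0) -> cone s b.
Proof.
have [m] := ubnP (size s); elim: m s b => // m IHm [|a s] b /= sz hb.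
  have := hb b (fun a => ltac:(by [])); rewrite le_eqVlt => /orP[/eqP|].
    exact: dot_self_eq0.
  by rewrite ltNge sumr_ge0 // => k _; rewrite -expr2 sqr_ge0.
have [hs|/existsNP[xb /not_implyP[hxb /negP]]] := pselect (forall x,
    (forall c, c \in s -> dot c x <= 0) -> dot b x <= 0).
  by exists 0 => //; rewrite scale0r subr0; apply: IHm.
rewrite -ltNge => bxb.
have axb : 0 < dot a xb.
  rewrite ltNge; apply/negP => axb; move: bxb; rewrite ltNge => /negP; apply.
  by apply: hb => c; rewrite inE => /predU1P[->//|]; apply: hxb.
pose y := (dot a xb)^-1 *: xb.
have ay : dot a y = 1 by rewrite dotZr mulVf // gt_eqF.
have by0 : 0 < dot b y by rewrite dotZr mulr_gt0 // invr_gt0.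
have hy c : c \in s -> dot c y <= 0.
  by move=> cs; rewrite dotZr pmulr_rle0 ?invr_gt0 //; apply: hxb.
pose pr (c : 'rV[R]_n) := c - dot c y *: a.
have /IHm : forall x, (forall c, c \in map pr s -> dot c x <= 0) ->
    dot (pr b) x <= 0.
  move=> x hx; pose x' := x - dot a x *: y.
  have prE c : dot (pr c) x = dot c x'.
    by rewrite /pr /x' dotBl dotZl dotBr (dotZr (dot a x)) mulrC.
  rewrite prE; apply: hb => c; rewrite inE => /predU1P[->|cs].
    by rewrite /x' dotBr (dotZr (dot a x)) ay mulr1 subrr.
  by rewrite -prE; apply: hx; apply: map_f.
rewrite size_map => /(_ sz).
have cone_pr (r : seq 'rV[R]_n) (v : 'rV[R]_n) :
    (forall c, c \in r -> dot c y <= 0) -> cone (map pr r) v ->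
    exists2 t, t <= 0 & cone r (v + t *: a).
  elim: r v => [|c r IH] v hr /=.
    by move=> ->; exists 0 => //; rewrite scale0r addr0.
  move=> [k k0] /IH[d dr|t t0 ct].
    by apply: hr; rewrite inE dr orbT.
  exists (t + k * dot c y).
    by rewrite -(addr0 0) lerD // mulr_ge0_le0 // hr // mem_head.
  exists k => //; suff -> : v + (t + k * dot c y) *: a - k *: c =
      v - k *: pr c + t *: a by [].
  by apply/rowP => l; rewrite !mxE; ring.
move=> /(cone_pr _ _ hy)[t t0 ct]; exists (dot b y - t).
  by rewrite subr_ge0 (le_trans t0) // ltW.
suff -> : b - (dot b y - t) *: a = pr b + t *: a by [].
by apply/rowP => l; rewrite !mxE; ring.
Qed.

Lemma cone_sum n (s : seq 'rV[R]_n) b : cone s b ->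
  exists2 c : 'I_(size s) -> R, (forall k, 0 <= c k) & b = \sum_k c k *: s`_k.
Proof.
elim: s b => [|a s IH] b /=.
  by move=> ->; exists (fun=> 0) => //; rewrite big_ord0.
move=> [c c0] /IH[d d0 bE].
exists (fun k => if unlift ord0 k is Some l then d l else c) => [k|].
  by case: unliftP => [l|] _.
rewrite big_ord_recl unlift_none /=.
transitivity (c *: a + (b - c *: a)); first by rewrite addrC subrK.
by rewrite bE; congr (_ + _); apply: eq_bigr => k _; rewrite liftK.
Qed.

(** From functionals to membership this is Farkas' lemma for the points lifted to height 1: the
    extra coordinate makes the cone coefficients sum to 1. Inclusions of hulls thereby become
    comparisons of support functions. *)
Lemma hullP n (s : seq 'rV[R]_n) x :
  hull s x <-> forall w, exists2 a, a \in s & dot w x <= dot w a.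
Proof.
split=> [[c [c0 c1 xE]] w|hx].
  have [//|hw] := pselect (exists2 a, a \in s & dot w x <= dot w a).
  have lt k : dot w s`_(k : 'I_(size s)) < dot w x.
    by rewrite ltNge; apply/negP => wk; apply: hw; exists s`_k; rewrite ?mem_nth.
  have : \sum_k c k * (dot w x - dot w s`_k) = 0.
    under eq_bigr do rewrite mulrBr.
    rewrite sumrB -mulr_suml c1 mul1r {1}xE dot_sumr.
    by under eq_bigr do rewrite dotZr; rewrite subrr.
  move/eqP; rewrite psumr_eq0 => [/allP h|k _]; last first.
    by rewrite mulr_ge0 // subr_ge0 ltW.
  have ck k : c k = 0.
    have := h k (mem_index_enum _).
    by rewrite /= mulf_eq0 subr_eq0 (gt_eqF (lt k)) orbF => /eqP.
  by move/eqP: c1; rewrite big1 // eq_sym oner_eq0.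
pose lift1 (a : 'rV[R]_n) : 'rV[R]_(n + 1) := row_mx a (const_mx 1).
have : cone (map lift1 s) (lift1 x).
  apply: farkas => z; rewrite -(hsubmxK z); set w := lsubmx z; set u := rsubmx z.
  move=> hz; have [a sa wa] := hx w.
  apply: le_trans (hz _ (map_f _ sa)); rewrite !dot_row_mx lerD2r.
  by rewrite !(dotC _ w).
case/cone_sum => c c0 E.
have sE : size (map lift1 s) = size s by rewrite size_map.
exists (fun k => c (cast_ord (esym sE) k)); split=> // .
- have := congr1 (fun v => rsubmx v 0 0) E; rewrite row_mxKr mxE => ->.
  rewrite mxE summxE (reindex (cast_ord (esym sE))) /=; last first.
    by exists (cast_ord sE) => k _; rewrite ?cast_ordK ?cast_ordKV.
  apply: eq_bigr => k _; rewrite mxE (nth_map 0) ?ltn_ord // row_mxEr.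
  by rewrite mxE mulr1.
- have := congr1 lsubmx E; rewrite row_mxKl => ->; apply/rowP => l.
  rewrite mxE !summxE (reindex (cast_ord (esym sE))) /=; last first.
    by exists (cast_ord sE) => k _; rewrite ?cast_ordK ?cast_ordKV.
  apply: eq_bigr => k _; rewrite !mxE (nth_map 0) ?ltn_ord //.
  by rewrite row_mxEl.
Qed.

Lemma mem_hull n (s : seq 'rV[R]_n) a : a \in s -> hull s a.
Proof. by move=> sa; apply/hullP => w; exists a. Qed.

Lemma sub_hull n (s t : seq 'rV[R]_n) :
  (forall a, a \in s -> hull t a) -> (hull s `<=` hull t)%classic.
Proof.
move=> st x /hullP hx; apply/hullP => w; have [a sa wa] := hx w.
have /hullP/(_ w)[b tb wb] := st a sa.
by exists b => //; apply: le_trans wa wb.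
Qed.

End Convex.

(** * Generic functionals, faces and edges of a hull *)

Section Generic.
Variables (R : realType) (n : nat).
Implicit Types (w v u : 'rV[R]_n) (p q : {poly R}).

Lemma horner_bound p : exists2 B, 0 <= B &
  forall e, 0 <= e <= 1 -> `|p.[e]| <= B.
Proof.
elim/poly_ind: p => [|p c [B B0 hB]].
  by exists 0 => // e _; rewrite horner0 normr0.
exists (B + `|c|) => [|e /andP[e0 e1]]; first by rewrite addr_ge0.
rewrite hornerMXaddC (le_trans (ler_normD _ _)) // lerD2r normrM.
rewrite (ger0_norm e0) (le_trans _ (hB e _)) ?e0 //.
by rewrite ler_piMr.
Qed.

Lemma horner_gt0_near p : 0 < p.[0] ->
  exists2 e0, 0 < e0 & forall e, 0 < e <= e0 -> 0 < p.[e].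
Proof.
elim/poly_ind: p => [|p c _]; first by rewrite horner0 ltxx.
rewrite hornerMXaddC mulr0 add0r => c0; have [B B0 hB] := horner_bound p.
have B1 : 0 < B + 1 by rewrite ltr_wpDl.
exists (Num.min 1 (c / (B + 1) / 2)).
  by rewrite lt_min ltr01 !divr_gt0.
move=> e /andP[e0]; rewrite le_min => /andP[e1 e2].
rewrite hornerMXaddC; have /ler_normlP[h _] := hB e ltac:(by rewrite ltW).
suff : (B + 1) * e <= c / 2 by nra.
by rewrite mulrC -ler_pdivlMr // mulrAC.
Qed.

Lemma horner_neq0_near p : p != 0 ->
  exists2 e0, 0 < e0 & forall e, 0 < e <= e0 -> p.[e] != 0.
Proof.
move=> p0; have [m [q]] := multiplicity_XsubC p 0; rewrite p0 /= => rq pE.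
have {rq} : 0 < q.[0] \/ 0 < (- q).[0].
  by move: rq; rewrite rootE hornerN oppr_gt0 neq_lt => /orP[]; [right|left].
have pe e : 0 < e -> q.[e] != 0 -> p.[e] != 0.
  move=> e0 qe; rewrite pE hornerM mulf_neq0 // horner_exp expf_neq0 //.
  by rewrite hornerXsubC subr0 gt_eqF.
case=> /horner_gt0_near[e0 e00 he]; exists e0 => // e /[dup] /andP[? _] /he qe;
  apply: pe => //; first by rewrite gt_eqF.
by rewrite -oppr_eq0 -hornerN gt_eqF.
Qed.

(** The perturbation follows the moment curve [(e, e^2, ...)] from [w0]. Its pairing with a fixed
    nonzero vector is a nonzero polynomial in [e], so small [e > 0] avoids finitely many
    hyperplanes, and strict inequalities at [e = 0] survive. *)
Lemma generic_near (w0 : 'rV[R]_n) (Z Y : seq 'rV[R]_n) :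
  exists w, (forall z, z \in Z -> z != 0 -> dot w z != 0) /\
            (forall y, y \in Y -> 0 < dot w0 y -> 0 < dot w y).
Proof.
pose wt e : 'rV[R]_n := w0 + \row_k e ^+ k.+1.
pose P (z : 'rV[R]_n) : {poly R} := (dot w0 z)%:P + \sum_k z 0 k *: 'X^(k.+1).
have PE z e : (P z).[e] = dot (wt e) z.
  rewrite hornerD hornerC dotDl; congr (_ + _); rewrite horner_sum.
  by apply: eq_bigr => k _; rewrite hornerZ hornerXn mxE mulrC.
have P0 z : (P z).[0] = dot w0 z.
  rewrite hornerD hornerC horner_sum big1 ?addr0 // => k _.
  by rewrite hornerZ hornerXn expr0n mulr0.
have Pz z : z != 0 -> P z != 0.
  apply: contraNneq => Pz0; apply/eqP/rowP => k; rewrite mxE.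
  have := congr1 (fun q : {poly R} => q`_k.+1) Pz0.
  rewrite coef0 coefD coefC add0r coef_sum (bigD1 k) //= big1 => [|l lk].
    by rewrite coefZ coefXn eqxx mulr1 addr0.
  by rewrite coefZ coefXn eqSS eq_sym (negPf lk : (l == k :> nat) = false) mulr0.
suff [e0 e00 he] : exists2 e0, 0 < e0 & forall e, 0 < e <= e0 ->
    (forall z, z \in Z -> z != 0 -> dot (wt e) z != 0) /\
    (forall y, y \in Y -> 0 < dot w0 y -> 0 < dot (wt e) y).
  by exists (wt e0); apply: he; rewrite e00 lexx.
have [e1 e10 h1] : exists2 e0, 0 < e0 & forall e, 0 < e <= e0 ->
    (forall z, z \in Z -> z != 0 -> dot (wt e) z != 0).
  elim: Z => [|z Z [e1 e10 h1]]; first by exists 1.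
  have [->|z0] := eqVneq z 0.
    by exists e1 => // e /h1 h u; rewrite inE => /predU1P[->|/h//]; rewrite eqxx.
  have [e2 e20 h2] := horner_neq0_near (Pz z z0).
  exists (Num.min e1 e2); first by rewrite lt_min e10.
  move=> e /andP[e0]; rewrite le_min => /andP[ee1 ee2] u.
  rewrite inE => /predU1P[-> _|]; first by rewrite -PE h2 // e0.
  by apply: h1; rewrite e0.
have [e2 e20 h2] : exists2 e0, 0 < e0 & forall e, 0 < e <= e0 ->
    (forall y, y \in Y -> 0 < dot w0 y -> 0 < dot (wt e) y).
  elim: Y => [|y Y [e2 e20 h2]]; first by exists 1.
  have [y0|y0] := ltP 0 (dot w0 y); last first.
    exists e2 => // e /h2 h u; rewrite inE => /predU1P[->|/h//].
    by rewrite ltNge y0.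
  have /horner_gt0_near[e3 e30 h3] : 0 < (P y).[0] by rewrite P0.
  exists (Num.min e2 e3); first by rewrite lt_min e20.
  move=> e /andP[e0]; rewrite le_min => /andP[ee1 ee2] u.
  rewrite inE => /predU1P[-> _|]; first by rewrite -PE h3 // e0.
  by apply: h2; rewrite e0.
exists (Num.min e1 e2); first by rewrite lt_min e10.
move=> e /andP[e0]; rewrite le_min => /andP[ee1 ee2].
by split; [apply: h1|apply: h2]; rewrite e0.
Qed.

Lemma seq_argmax (T : eqType) (f : T -> R) (s : seq T) : s != [::] ->
  exists2 a, a \in s & forall b, b \in s -> f b <= f a.
Proof.
elim: s => // a [_ _|b s /(_ isT)[c cs hc] _].
  by exists a; rewrite ?mem_head // => b; rewrite inE => /eqP->.
have [ac|/ltW ca] := leP (f a) (f c).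
  exists c; first by rewrite inE cs orbT.
  by move=> d; rewrite inE => /predU1P[->|/hc].
exists a; first exact: mem_head.
move=> d; rewrite inE => /predU1P[->//|/hc dc]; exact: le_trans dc ca.
Qed.

Lemma hull_dot_le (s : seq 'rV[R]_n) w c : (forall a, a \in s -> dot w a <= c) ->
  forall x, hull s x -> dot w x <= c.
Proof. by move=> h x /hullP/(_ w)[a /h]; move=> h1 h2; apply: le_trans h2 h1. Qed.

(** In a convex combination attaining the maximum, only generators that attain it can have a nonzero
    coefficient. *)
Lemma face_hull (s : seq 'rV[R]_n) w v : v \in s ->
  (forall u, u \in s -> dot w u <= dot w v) ->
  face (hull s) w = hull [seq u <- s | dot w u == dot w v].
Proof.
move=> vs hv; apply/seteqP; split=> x.
  case=> -[c [c0 c1 xE]] /(_ v (mem_hull vs)) wx.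
  have ck k : c k != 0 -> dot w s`_k = dot w v.
    have : \sum_k c k * (dot w v - dot w s`_k) = dot w v - dot w x.
      under eq_bigr do rewrite mulrBr.
      rewrite sumrB -mulr_suml c1 mul1r xE dot_sumr.
      by congr (_ - _); apply: eq_bigr => l _; rewrite dotZr.
    have ge0 l : 0 <= c l * (dot w v - dot w s`_l).
      by rewrite mulr_ge0 // subr_ge0 hv // mem_nth.
    move=> E; have : \sum_k c k * (dot w v - dot w s`_k) == 0.
      by rewrite eq_le sumr_ge0 // E andbT subr_le0.
    rewrite psumr_eq0 // => /allP/(_ k (mem_index_enum _)) /=.
    by rewrite mulf_eq0 subr_eq0 => /orP[-> //|/eqP ->].
  apply/hullP => w2.
  have [//|hw] := pselect (exists2 a, a \in [seq u <- s | dot w u == dot w v] &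
    dot w2 x <= dot w2 a).
  have lt k : c k != 0 -> dot w2 s`_k < dot w2 x.
    move=> ck0; rewrite ltNge; apply/negP => wk; apply: hw; exists s`_k => //.
    by rewrite mem_filter mem_nth // ck ?eqxx.
  have : \sum_k c k * (dot w2 x - dot w2 s`_k) = 0.
    under eq_bigr do rewrite mulrBr.
    rewrite sumrB -mulr_suml c1 mul1r {1}xE dot_sumr.
    by under eq_bigr do rewrite dotZr; rewrite subrr.
  move/eqP; rewrite psumr_eq0 => [/allP h|k _]; last first.
    have [->|ck0] := eqVneq (c k) 0; first by rewrite mul0r.
    by rewrite mulr_ge0 // subr_ge0 ltW // lt.
  have c_0 k : c k = 0.
    have [//|ck0] := eqVneq (c k) 0; have := h k (mem_index_enum _).
    by rewrite /= mulf_eq0 subr_eq0 (gt_eqF (lt k ck0)) orbF => /eqP.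
  by move/eqP: c1; rewrite big1 // eq_sym oner_eq0.
move=> hx; split.
  by apply: sub_hull hx => a; rewrite mem_filter => /andP[_ /mem_hull].
move=> y /(hull_dot_le hv) hy; apply: (le_trans hy).
have /hullP/(_ (- 1 *: w))[a] := hx.
rewrite mem_filter => /andP[/eqP wa _]; rewrite !dotZl !mulN1r lerN2.
by rewrite wa.
Qed.

Lemma hull_segment u v a t : 0 <= t <= 1 -> a = v + t *: (u - v) ->
  hull [:: v; u] a.
Proof.
move=> /andP[t0 t1] ->; apply/hullP => w; rewrite dotDr dotZr dotBr.
have [wuv|wvu] := leP (dot w u) (dot w v).
  by exists v; rewrite ?mem_head //; nra.
by exists u; rewrite ?inE ?eqxx ?orbT //; nra.
Qed.

(* Among the points u that improve w', one maximising w'(u-v) / w(v-u) spans  *)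
(* with v an edge, exposed by the corresponding combination of w' and w.      *)
Lemma improving_edge (pts : seq 'rV[R]_n) w w' v :
  v \in pts -> (forall u, u \in pts -> u != v -> dot w u < dot w v) ->
  (exists2 u, u \in pts & dot w' v < dot w' u) ->
  (forall u u', u \in pts -> u' \in pts ->
    let z := dot w (v - u') *: (u - v) - dot w (v - u) *: (u' - v) in
    z != 0 -> dot w' z != 0) ->
  exists u, [/\ is_edge (hull pts) v u, dot w u < dot w v
              & dot w' v < dot w' u].
Proof.
move=> vp wv [u0 u0p wu0] gen.
have u0v : u0 != v by apply: contraTneq wu0 => ->; rewrite ltxx.
pose rho u := dot w' (u - v) / dot w (v - u).
have [u1] := @seq_argmax _ rho [seq u <- pts | u != v]
  ltac:(by apply/eqP => E; have := mem_filter (fun u => u != v) u0 pts;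
        rewrite E u0v u0p).
rewrite mem_filter => /andP[u1v u1p] hu1.
have dw u : u \in pts -> u != v -> 0 < dot w (v - u).
  by move=> up uv; rewrite dotBr subr_gt0 wv.
have rho0 : 0 < rho u1.
  apply: (lt_le_trans _ (hu1 u0 _)); last by rewrite mem_filter u0v.
  by rewrite divr_gt0 ?dw // dotBr subr_gt0.
pose W := w' + rho u1 *: w.
have WE u : dot W u - dot W v = dot w' (u - v) - rho u1 * dot w (v - u).
  by rewrite -dotBr /W dotDl dotZl !dotBr; ring.
have hW u : u \in pts -> dot W u <= dot W v.
  move=> up; have [->//|uv] := eqVneq u v.
  rewrite -subr_le0 WE subr_le0 -ler_pdivrMr ?dw //.
  by apply: hu1; rewrite mem_filter uv.
have WP u : u \in pts -> dot W u = dot W v ->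
    dot w' (u - v) = rho u1 * dot w (v - u).
  by move=> up Wu; apply/eqP; rewrite -subr_eq0 -WE Wu subrr.
pose att := [seq u <- pts | dot W u == dot W v].
have u1a : u1 \in att.
  rewrite mem_filter u1p andbT -subr_eq0 WE divfK ?subrr //.
  by rewrite gt_eqF // dw.
have [u] := @seq_argmax _ (fun u => dot w (v - u)) [seq u <- att | u != v]
  ltac:(by apply/eqP => E; have := mem_filter (fun u => u != v) u1 att;
        rewrite E u1v u1a).
rewrite !mem_filter => /andP[uv /andP[/eqP Wu up]] hu.
exists u; split; [|exact: wv|].
  split; first by move/esym/eqP; apply/negP.
  exists W; rewrite (face_hull vp hW); apply/seteqP; split.
    apply: sub_hull => a; rewrite mem_filter => /andP[/eqP Wa ap].
    have [->|av] := eqVneq a v; first by apply: mem_hull; rewrite mem_head.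
    apply: (@hull_segment _ _ _ (dot w (v - a) / dot w (v - u))).
      apply/andP; split; first by rewrite divr_ge0 // ltW // dw.
      rewrite ler_pdivrMr ?dw // mul1r hu //.
      by rewrite !mem_filter av Wa eqxx.
    have z0 : dot w (v - u) *: (a - v) - dot w (v - a) *: (u - v) = 0.
      apply/eqP/negPn/negP => /(gen _ _ ap up)/negP; apply.
      by rewrite (dotBr w') !(dotZr _ w') !WP //; apply/eqP; ring.
    apply: (scalerI (_ : dot w (v - u) != 0)); first by rewrite gt_eqF ?dw.
    rewrite scalerDr scalerA mulrCA mulfV ?mulr1 ?gt_eqF ?dw //.
    move/eqP: z0; rewrite subr_eq0 => /eqP <-; rewrite -scalerDr.
    by congr (_ *: _); rewrite addrC subrK.
  apply: sub_hull => a; rewrite !inE => /orP[]/eqP->; apply: mem_hull;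
    by rewrite mem_filter ?Wu ?eqxx.
by rewrite -subr_gt0 -dotBr WP // mulr_gt0 ?dw.
Qed.

End Generic.

(** * Generalized permutahedra and greedy points *)

Section Greedy.
Variables (R : realType) (n : nat).
Implicit Types (w v u x y : 'rV[R]_n) (S A B : {set 'I_n}) (s : seq 'I_n).
Implicit Types (mu : {set 'I_n} -> R) (P : set 'rV[R]_n).

Definition ind S : 'rV[R]_n := \row_k (k \in S)%:R.

Lemma dot_ind S x : dot (ind S) x = \sum_(k in S) x 0 k.
Proof.
rewrite /dot [RHS]big_mkcond; apply: eq_bigr => k _; rewrite mxE.
by case: ifP; rewrite ?mul1r ?mul0r.
Qed.

Definition enumerates s := perm_eq s (enum 'I_n).

Lemma enumerates_uniq s : enumerates s -> uniq s.
Proof. by move=> /perm_uniq->; apply: enum_uniq. Qed.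

Lemma mem_enumerates s a : enumerates s -> a \in s.
Proof. by move=> /perm_mem->; rewrite mem_enum. Qed.

Definition prefix_set s k : {set 'I_n} := [set a in take k s].

Lemma dot_ind_prefix s k x : uniq s ->
  dot (ind (prefix_set s k)) x = \sum_(a <- take k s) x 0 a.
Proof.
move=> us; rewrite dot_ind big_uniq ?take_uniq //=.
by apply: eq_bigl => a; rewrite inE.
Qed.

Lemma submodE P S c : (forall x, P x -> dot (ind S) x <= c) ->
  (exists2 x, P x & dot (ind S) x = c) -> submod P S = c.
Proof.
move=> ub [x Px xc]; apply/eqP; rewrite eq_le; apply/andP; split.
  apply: ge_sup; first by exists c, x => //; rewrite -dot_ind.
  by move=> _ [y /ub yc <-]; rewrite -dot_ind.
apply: ub_le_sup; last by exists x => //; rewrite -dot_ind.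
by exists c => _ [y /ub yc <-]; rewrite -dot_ind.
Qed.

Definition desc w := [rel a b : 'I_n | w 0 b <= w 0 a].

Lemma desc_total w : total (desc w).
Proof. by move=> a b; apply: le_total. Qed.

Lemma desc_trans w : transitive (desc w).
Proof. by move=> b a c /= ab bc; apply: le_trans bc ab. Qed.

(** Summation by parts in inductive form: [D] is the partial sum already passed and [a] the last
    index met; since [w] descends and [D >= 0], the weight of [a] on [D] may be lowered to that of
    the next index. *)
Lemma abel_summation w (z : 'I_n -> R) a s D : path (desc w) a s -> 0 <= D ->
  (forall k, 0 <= D + \sum_(b <- take k s) z b) ->
  D + \sum_(b <- s) z b = 0 -> 0 <= w 0 a * D + \sum_(b <- s) w 0 b * z b.
Proof.
elim: s a D => [|b s IH] a D /=.
  by move=> _ _ _; rewrite !big_nil !addr0 => ->; rewrite mulr0.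
case/andP=> wba bs D0 h; rewrite !big_cons addrA => tot.
have h1 : 0 <= D + z b by have := h 1; rewrite /= take0 big_seq1.
apply: (le_trans (IH b (D + z b) bs h1 _ tot)) => [k|].
  by have := h k.+1; rewrite /= big_cons addrA.
by rewrite mulrDr addrA lerD2r lerD2r ler_wpM2r.
Qed.

(** A functional descending along [s] is a nonnegative combination of indicators of prefixes, up to
    a multiple of the indicator of the whole set. *)
Lemma dot_le_desc s w x y : enumerates s -> sorted (desc w) s ->
  (forall k, dot (ind (prefix_set s k)) y <= dot (ind (prefix_set s k)) x) ->
  dot (ind setT) y = dot (ind setT) x -> dot w y <= dot w x.
Proof.
move=> es ss h hT; rewrite -subr_ge0 -dotBr.
have us := enumerates_uniq es.
have sumT (F : 'I_n -> R) : \sum_k F k = \sum_(k <- s) F k.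
  by rewrite (perm_big _ es) big_enum.
have hz k : 0 <= \sum_(b <- take k s) (x - y) 0 b.
  by rewrite -dot_ind_prefix // dotBr subr_ge0.
have hzT : \sum_(b <- s) (x - y) 0 b = 0.
  rewrite -sumT; transitivity (dot (ind setT) (x - y)).
    by rewrite dot_ind; apply: eq_bigl => k; rewrite inE.
  by rewrite dotBr hT subrr.
rewrite /dot sumT; case: s {es us sumT} ss h hz hzT => [|a s] /= ss _ hz.
  by rewrite !big_nil.
rewrite !big_cons => hzT; apply: abel_summation => //.
  by have := hz 1; rewrite /= take0 big_seq1.
by move=> k; have := hz k.+1; rewrite /= big_cons.
Qed.

(** Edmonds' greedy vertex for the order [s]. *)
Definition greedy mu s : 'rV[R]_n :=
  \row_a (mu (prefix_set s (index a s).+1) - mu (prefix_set s (index a s))).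

Lemma prefix_setS s k a : uniq s -> (k < size s)%N ->
  prefix_set s k.+1 = nth a s k |: prefix_set s k.
Proof.
move=> us ks; apply/setP=> b; rewrite !inE (take_nth a) //.
by rewrite mem_rcons inE.
Qed.

Lemma prefix_set0 s : prefix_set s 0 = set0.
Proof. by apply/setP => a; rewrite !inE take0. Qed.

Lemma prefix_set_size s k : enumerates s -> (size s <= k)%N ->
  prefix_set s k = setT.
Proof.
by move=> es sk; apply/setP => a; rewrite !inE take_oversize // mem_enumerates.
Qed.

Lemma prefix_set_minn s k : prefix_set s k = prefix_set s (minn k (size s)).
Proof.
apply/setP => a; rewrite !inE; have [ks|sk] := leqP k (size s).
  by [].
by rewrite take_size take_oversize // ltnW.
Qed.

Lemma nth_prefix_set s k a : uniq s -> (k < size s)%N ->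
  nth a s k \notin prefix_set s k.
Proof.
move=> us ks; rewrite inE; apply/negP => h; have := us.
by rewrite -(cat_take_drop k s) cat_uniq (drop_nth a) //= h !andbF.
Qed.

Lemma dot_greedy mu s k : mu set0 = 0 -> uniq s ->
  dot (ind (prefix_set s k)) (greedy mu s) = mu (prefix_set s k).
Proof.
move=> mu0 us; rewrite prefix_set_minn; have := geq_minr k (size s).
elim: (minn k _) => [|m IH] ms.
  by rewrite prefix_set0 mu0 dot_ind big_set0.
have /IH := ltnW ms; case: s us ms {IH} => // a s us ms IH.
rewrite dot_ind_prefix // (take_nth a) // -cats1 big_cat big_seq1 /=.
by rewrite -dot_ind_prefix // IH mxE index_uniq // addrC subrK.
Qed.

Lemma greedy_unique mu s v : enumerates s ->
  (forall k, dot (ind (prefix_set s k)) v = mu (prefix_set s k)) ->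
  v = greedy mu s.
Proof.
move=> es h; have us := enumerates_uniq es; apply/rowP => a; rewrite mxE -!h.
have ai : (index a s < size s)%N by rewrite index_mem mem_enumerates.
rewrite !dot_ind_prefix // (take_nth a) // -cats1 big_cat big_seq1 /=.
by rewrite addrAC subrr add0r nth_index // mem_enumerates.
Qed.

Definition submodular mu := forall S (a b : 'I_n),
  a \notin S -> b \notin S -> a != b ->
  mu (a |: (b |: S)) + mu S <= mu (a |: S) + mu (b |: S).

Lemma submodular_diminishing mu A B a : submodular mu ->
  A \subset B -> a \notin B -> mu (a |: B) + mu A <= mu (a |: A) + mu B.
Proof.
move=> sm; have [m] := ubnP #|B :\: A|; elim: m B => // m IH B hm AB aB.
have [BA|] := boolP (B \subset A).
  by have -> : A = B by apply/eqP; rewrite eqEsubset AB.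
case/subsetPn => b bB bA; pose B' := B :\ b.
have aB' : a \notin B' by rewrite !inE (negPf aB) andbF.
have bB' : b \notin B' by rewrite !inE eqxx.
have ab : a != b by apply: contraNneq aB => ->.
have BE : B = b |: B' by rewrite setD1K.
have AB' : A \subset B' by rewrite subsetD1 AB.
have lt : (#|B' :\: A| < m)%N.
  apply: leq_trans (_ : #|B :\: A| <= m)%N; last by [].
  apply: proper_card; apply/properP; split; first by apply/setSD/subD1set.
  by exists b; rewrite !inE ?bB ?bA ?eqxx ?andbF.
have := IH B' lt AB' aB'; have := sm B' a b aB' bB' ab; rewrite -BE; lra.
Qed.

(** Induction along the prefixes: a new element of [S] raises [mu] on the smaller set
    [S :&: prefix_set s k] at least as much as on the prefix itself, and the latter increment is its
    greedy coordinate. *)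
Lemma greedy_le mu s S : mu set0 = 0 -> submodular mu -> enumerates s ->
  dot (ind S) (greedy mu s) <= mu S.
Proof.
move=> mu0 sm es; have us := enumerates_uniq es.
suff h k : (k <= size s)%N ->
    dot (ind (S :&: prefix_set s k)) (greedy mu s) <= mu (S :&: prefix_set s k).
  by have := h _ (leqnn _); rewrite prefix_set_size // setIT.
elim: k => [|k IH] ks.
  by rewrite prefix_set0 setI0 mu0 dot_ind big_set0.
have {IH} := IH (ltnW ks); case: s ks es us => // a0 s0; set s := a0 :: s0.
move=> ks es us IH; set a := nth a0 s k.
have aN : a \notin prefix_set s k by apply: nth_prefix_set.
rewrite (prefix_setS a0) // -/a; have [aS|aS] := boolP (a \in S); last first.
  suff -> : S :&: (a |: prefix_set s k) = S :&: prefix_set s k by [].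
  by apply/setP => b; rewrite !inE; have [->|//] := eqVneq b a; rewrite (negPf aS).
have -> : S :&: (a |: prefix_set s k) = a |: (S :&: prefix_set s k).
  by rewrite setIUr; congr (_ :|: _); apply/setIidPr; rewrite sub1set.
rewrite dot_ind big_setU1 /=; last by rewrite !inE in aN *; rewrite (negPf aN) andbF.
rewrite -dot_ind mxE index_uniq // (prefix_setS a0) // -/a.
have := submodular_diminishing sm (subsetIr S (prefix_set s k)) aN; lra.
Qed.

Definition greedy_hull mu : set 'rV[R]_n :=
  hull [seq greedy mu s | s <- permutations (enum 'I_n)].

Lemma greedy_in_hull mu s : enumerates s -> greedy_hull mu (greedy mu s).
Proof. by move=> es; apply/mem_hull/map_f; rewrite mem_permutations. Qed.

Lemma greedy_hull_le mu w c :
  (forall s, enumerates s -> dot w (greedy mu s) <= c) ->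
  forall x, greedy_hull mu x -> dot w x <= c.
Proof.
by move=> h; apply: hull_dot_le => a /mapP[s]; rewrite mem_permutations => /h hs ->.
Qed.

Lemma dot_greedy_max mu s w x : mu set0 = 0 -> submodular mu -> enumerates s ->
  sorted (desc w) s -> greedy_hull mu x -> dot w x <= dot w (greedy mu s).
Proof.
move=> mu0 sm es ss; apply: greedy_hull_le => t et.
have us := enumerates_uniq es; have ut := enumerates_uniq et.
apply: (dot_le_desc es ss) => [k|]; first by rewrite dot_greedy // greedy_le.
by rewrite -[in LHS](prefix_set_size et (leqnn _))
  -[in RHS](prefix_set_size es (leqnn _)) !dot_greedy // !prefix_set_size.
Qed.

Lemma enumeratesP s : uniq s -> (forall a, a \in s) -> enumerates s.
Proof.
by move=> us hs; apply: uniq_perm; rewrite ?enum_uniq // => a; rewrite hs mem_enum.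
Qed.

Lemma enumerates_prefix S (t : seq 'I_n) :
  uniq t -> (forall a, a \in t -> a \notin S) ->
  exists s, [/\ enumerates s, prefix_set s #|S| = S
    & forall k, (k <= size t)%N ->
        prefix_set s (#|S| + k) = S :|: [set a in take k t]].
Proof.
move=> ut tS; pose s := enum S ++ t ++ enum (~: (S :|: [set a in t])).
have ps k : (k <= size t)%N ->
    prefix_set s (#|S| + k) = S :|: [set a in take k t].
  move=> kt; apply/setP => a; rewrite !inE /s take_cat -cardE ltnNge leq_addr /=.
  by rewrite addKn mem_cat mem_enum takel_cat.
exists s; split=> //; last first.
  have := ps 0 isT; rewrite addn0 take0 => ->; rewrite (_ : [set a in [::]] = set0).
    by rewrite setU0.
  by apply/setP => a; rewrite !inE.
apply: enumeratesP => [|a].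
  rewrite !cat_uniq ut !enum_uniq /= andbT.
  rewrite has_cat negb_or -!andbA; apply/and3P; split.
  - by apply/hasPn => a /tS aS; rewrite /= mem_enum.
  - by apply/hasPn => a; rewrite mem_enum !inE negb_or /= => /andP[aS _]; rewrite mem_enum.
  - by apply/hasPn => a; rewrite mem_enum !inE negb_or /= => /andP[].
by rewrite !mem_cat !mem_enum !inE; case: (a \in S); case: (a \in t).
Qed.

Lemma submod_greedy_hull mu S : mu set0 = 0 -> submodular mu ->
  submod (greedy_hull mu) S = mu S.
Proof.
move=> mu0 sm; apply: submodE.
  by apply: greedy_hull_le => s es; apply: greedy_le.
have [s [es sS _]] := @enumerates_prefix S [::] isT (fun a => ltac:(by [])).
exists (greedy mu s); first exact: greedy_in_hull.
by rewrite -sS dot_greedy // enumerates_uniq.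
Qed.

Lemma exists_desc w : exists2 s, enumerates s & sorted (desc w) s.
Proof.
exists (sort (desc w) (enum 'I_n)); last exact/sort_sorted/desc_total.
by rewrite /enumerates perm_sort.
Qed.

Lemma desc_swap w p a b q : w 0 a = w 0 b ->
  sorted (desc w) (p ++ a :: b :: q) = sorted (desc w) (p ++ b :: a :: q).
Proof.
move=> wab; pose r := [rel c d : R | d <= c].
have E t : sorted (desc w) t = sorted r (map (fun a => w 0 a) t).
  by rewrite sorted_map.
by rewrite !E !map_cat /= wab.
Qed.

Section Connected.
Variables (w : 'rV[R]_n) (Q : seq 'I_n -> Prop).
Hypothesis Qswap : forall p a b q, enumerates (p ++ a :: b :: q) ->
  sorted (desc w) (p ++ a :: b :: q) -> w 0 a = w 0 b ->
  Q (p ++ a :: b :: q) -> Q (p ++ b :: a :: q).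

Lemma desc_bubble p q (y : 'I_n) r : (forall z, z \in q -> w 0 z = w 0 y) ->
  enumerates (p ++ q ++ y :: r) -> sorted (desc w) (p ++ q ++ y :: r) ->
  Q (p ++ q ++ y :: r) ->
  [/\ enumerates (p ++ y :: q ++ r), sorted (desc w) (p ++ y :: q ++ r)
    & Q (p ++ y :: q ++ r)].
Proof.
elim/last_ind: q r => [|q z IH] r //= hw; rewrite -cats1 -!catA /= catA.
move=> es ss Qs; have wz : w 0 z = w 0 y by apply: hw; rewrite mem_rcons mem_head.
have := IH (z :: r); rewrite !(catA p q); apply.
- by move=> u uq; apply: hw; rewrite mem_rcons inE uq orbT.
- apply: perm_trans es; rewrite perm_cat2l.
  by apply/seq.permP => f; rewrite /= addnCA.
- by rewrite -desc_swap.
- exact: Qswap.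
Qed.

Lemma desc_connected_cat (t p s : seq 'I_n) : perm_eq s t -> enumerates (p ++ s) ->
  sorted (desc w) (p ++ s) -> sorted (desc w) (p ++ t) ->
  Q (p ++ s) -> Q (p ++ t).
Proof.
elim: t p s => [|y t IH] p s; first by move=> /perm_nilP->.
move=> st; have : y \in s by rewrite (perm_mem st) mem_head.
move=> ys; case/splitPr: s / ys st => q r st es ss tt Qs.
have [] := @desc_bubble p q y r _ es ss Qs.
  move=> z zq; apply/eqP; rewrite eq_le; apply/andP; split.
    have := cat_sorted2 tt => -[_] /= /(order_path_min (@desc_trans w))/allP h.
    have : z \in y :: t by rewrite -(perm_mem st) mem_cat zq.
    by rewrite inE => /predU1P[->//|/h].
  have := cat_sorted2 ss => -[_]; rewrite sorted_pairwise; last exact: desc_trans.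
  rewrite pairwise_cat => /and3P[/allrelP h _ _]; apply: (h z y zq).
  exact: mem_head.
rewrite -!cat_rcons => es' ss' Qs'; apply: IH Qs' => //.
  by rewrite -(perm_cons y) -(permPr st) -cat1s perm_catCA.
by rewrite cat_rcons.
Qed.

(** Two orders sorted for the same [w] differ only within blocks of equal weight, so adjacent
    transpositions of ties connect them. *)
Lemma desc_connected s t : enumerates s -> enumerates t ->
  sorted (desc w) s -> sorted (desc w) t -> Q s -> Q t.
Proof.
move=> es et; apply: (@desc_connected_cat t [::] s) => //.
by rewrite (permPl es) perm_sym.
Qed.

End Connected.

End Greedy.

(** * Generalized permutahedra and their submodular functions *)

Section GenPerm.
Variables (R : realType) (n : nat).
Implicit Types (w v u x y : 'rV[R]_n) (S A B : {set 'I_n}) (s : seq 'I_n).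
Implicit Types (mu : {set 'I_n} -> R) (P : set 'rV[R]_n).

Lemma small_eps (T : eqType) (l : seq T) (f g : T -> R) :
  (forall z, z \in l -> 0 < f z) ->
  exists2 e, 0 < e & forall z, z \in l -> e * g z <= f z.
Proof.
elim: l => [|x l IH] hf; first by exists 1.
have [z zl|e e0 he] := IH; first by apply: hf; rewrite inE zl orbT.
have fx : 0 < f x by apply: hf; rewrite mem_head.
have g0 : 0 < `|g x| + 1 by rewrite ltr_wpDl.
exists (Num.min e (f x / (`|g x| + 1))) => [|z]; first by rewrite lt_min e0 divr_gt0.
rewrite inE => /predU1P[->|zl].
  apply: (@le_trans _ _ (Num.min e (f x / (`|g x| + 1)) * (`|g x| + 1))).
    rewrite ler_wpM2l ?le_min ?(ltW e0) ?divr_ge0 ?ltW //.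
    by rewrite (le_lt_trans (ler_norm _)) // ltrDl.
  by rewrite -ler_pdivlMr // ge_min lexx orbT.
have [gz|gz] := leP (g z) 0.
  rewrite (le_trans _ (ltW (hf z _))) ?inE ?zl ?orbT //.
  by rewrite mulr_ge0_le0 // le_min ltW // divr_ge0 // ltW.
by rewrite (le_trans _ (he z zl)) // ler_pM2r // ge_min lexx.
Qed.

Lemma hull2P u v x : hull [:: u; v] x ->
  exists2 t, 0 <= t <= 1 & x = u + t *: (v - u).
Proof.
case=> c [c0]; rewrite !big_ord_recl !big_ord0 /= !addr0 => c1 ->.
set a := c _ in c1 *; set b := c _ in c1 *.
exists b; first by rewrite c0 -c1 lerDr c0.
have -> : a = 1 - b by rewrite -c1 addrK.
by apply/rowP => k; rewrite !mxE; ring.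
Qed.

Section BasePolytope.
Variable mu : {set 'I_n} -> R.
Hypotheses (mu0 : mu set0 = 0) (sm : submodular mu).
Let P := greedy_hull mu.

Lemma face_greedy s w : enumerates s -> sorted (desc w) s ->
  face P w (greedy mu s).
Proof.
move=> es ss; split; first exact: greedy_in_hull.
by move=> x; apply: dot_greedy_max.
Qed.

(* Sorting by w + eps (u - v) gives a greedy point of the edge that is        *)
(* extremal in the direction u - v.                                           *)
Lemma edge_end_greedy w u v : face P w = hull [:: u; v] ->
  exists s, [/\ enumerates s, sorted (desc w) s & greedy mu s = u].
Proof.
move=> fE; pose g := u - v.
have [e e0 he] := @small_eps _
  [seq p <- enum {: 'I_n * 'I_n} | w 0 p.2 < w 0 p.1]
  (fun p => w 0 p.1 - w 0 p.2) (fun p => g 0 p.2 - g 0 p.1)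
  ltac:(by move=> p; rewrite mem_filter subr_gt0 => /andP[]).
have [t et tsort] := exists_desc (w + e *: g).
(* Sort by [w] and break ties by [g]. By the choice of [e] this order is sorted for [w + e *: g] as
   well. *)
pose r := [rel a b | (w 0 b < w 0 a) || (w 0 b == w 0 a) && (g 0 b <= g 0 a)].
have rtot : total r.
  move=> a b /=; case: ltgtP => //= _; exact: le_total.
pose s := sort r (enum 'I_n).
have es : enumerates s by rewrite /enumerates perm_sort.
have ss := sort_sorted rtot (enum 'I_n) : sorted r s.
have rw a b : r a b -> desc w a b.
  by move=> /= /orP[/ltW//|/andP[/eqP-> _]].
have rwe a b : r a b -> desc (w + e *: g) a b.
  rewrite /= !mxE => /orP[wba|/andP[/eqP-> gba]]; last by rewrite lerD2l ler_pM2l.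
  have := he (a, b); rewrite mem_filter wba mem_enum => /(_ isT) /=.
  by rewrite !mxE; lra.
have sw : sorted (desc w) s by apply: sub_sorted ss.
have swe : sorted (desc (w + e *: g)) s by apply: sub_sorted ss.
exists s; split=> //.
have := face_greedy es sw; rewrite fE => /hull2P[th /andP[th0 th1] sE].
have fu : face P w u by rewrite fE; apply: mem_hull; rewrite mem_head.
have wu : dot w u = dot w (greedy mu s).
  apply/eqP; rewrite eq_le (dot_greedy_max mu0 sm es sw fu.1).
  by rewrite fu.2 //; apply: greedy_in_hull.
have := dot_greedy_max mu0 sm es swe fu.1.
rewrite !dotDl !dotZl wu lerD2l ler_pM2l // sE dotDr dotZr -opprB dotNr.
rewrite -/g lerDl mulrN oppr_ge0 => h.
have gg : 0 <= dot g g by apply: sumr_ge0 => k _; rewrite -expr2 sqr_ge0.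
have /eqP : th * dot g g = 0 by apply/eqP; rewrite eq_le h mulr_ge0.
rewrite mulf_eq0 => /orP[/eqP->|/eqP/dot_self_eq0 ->].
  by rewrite scale0r addr0.
by rewrite oppr0 scaler0 addr0.
Qed.

Lemma prefix_set_swap p (a b : 'I_n) q k : k != (size p).+1 ->
  prefix_set (p ++ a :: b :: q) k = prefix_set (p ++ b :: a :: q) k.
Proof.
move=> kp; apply/setP => c; rewrite !inE !take_cat.
have [//|pk] := ltnP k (size p); rewrite !mem_cat; congr (_ || _).
move: kp; rewrite -(subnKC pk) addKn -addn1 eqn_add2l.
by case: (k - size p)%N => [|[|m]] //= _; rewrite !inE orbCA.
Qed.

(** The two orders share all prefixes except the one of size [(size p).+1], so only the coordinates
    of [a] and [b] change, by opposite amounts. *)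
Lemma greedy_swap p (a b : 'I_n) q : enumerates (p ++ a :: b :: q) ->
  exists t, greedy mu (p ++ b :: a :: q) - greedy mu (p ++ a :: b :: q) =
    t *: (delta_mx 0 a - delta_mx 0 b).
Proof.
move=> es; have us := enumerates_uniq es.
have es' : enumerates (p ++ b :: a :: q).
  apply: perm_trans es; rewrite perm_cat2l.
  by apply/seq.permP => f; rewrite /= addnCA.
have us' := enumerates_uniq es'.
have /and5P[ap bp ab _ _] : [&& a \notin p, b \notin p, a != b, true & true].
  move: us; rewrite cat_uniq /= !inE !negb_or.
  by case/and3P => _ /and3P[-> -> _] /and3P[/andP[-> _] _ _].
set s := p ++ a :: b :: q; set s' := p ++ b :: a :: q.
have ia : index a s = size p by rewrite index_cat (negPf ap) /= eqxx addn0.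
have ib : index b s = (size p).+1.
  by rewrite index_cat (negPf bp) /= (negPf ab) eqxx addn1.
have ia' : index a s' = (size p).+1.
  by rewrite index_cat (negPf ap) /= eq_sym (negPf ab) eqxx addn1.
have ib' : index b s' = size p by rewrite index_cat (negPf bp) /= eqxx addn0.
have sw k : k != (size p).+1 -> prefix_set s' k = prefix_set s k.
  by move=> kp; rewrite (prefix_set_swap _ _ _ kp).
have neq1 : size p != (size p).+1 by rewrite neq_ltn leqnn.
have neq2 : (size p).+2 != (size p).+1 by rewrite neq_ltn leqnn orbT.
exists (mu (prefix_set s (size p).+1) - mu (prefix_set s' (size p).+1)
        + mu (prefix_set s (size p).+2) + mu (prefix_set s (size p))
        - mu (prefix_set s (size p).+1) *+ 2).
apply/rowP => c; rewrite !mxE eqxx /=.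
have [->|ca] := eqVneq c a.
  by rewrite ia ia' (negPf ab) (sw _ neq2) /= mulr1n mulr0n; ring.
have [->|cb] := eqVneq c b.
  by rewrite ib ib' (sw _ neq1) /= mulr1n mulr0n; ring.
have ic : index c s' = index c s.
  rewrite !index_cat; case: ifP => //= _.
  by rewrite eq_sym (negPf cb) (eq_sym a) (negPf ca).
have [cs1 cs2] : (index c s != size p) /\ (index c s != (size p).+1).
  split.
    rewrite -ia; apply: contra_neq ca => /(congr1 (nth a s)).
    by rewrite !nth_index // mem_enumerates.
  rewrite -ib; apply: contra_neq cb => /(congr1 (nth a s)).
  by rewrite !nth_index // mem_enumerates.
by rewrite ic (sw _ cs2) (sw (index c s).+1) ?eqSS //=; ring.
Qed.

(** Both ends are greedy points of orders sorted for the functional exposing the edge, and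
    transpositions of ties lead from one order to the other. Some transposition must leave [u]; it
    stays in the edge and moves along [e_a - e_b], which is therefore the direction of the edge. *)
Lemma greedy_hull_edge u v : is_edge P u v ->
  exists a b : 'I_n, exists t : R,
    a != b /\ v - u = t *: (delta_mx 0 a - delta_mx 0 b).
Proof.
case=> uv [w fE].
have [s [es ss su]] := edge_end_greedy fE.
have [s' [es' ss' sv]] : exists s, [/\ enumerates s, sorted (desc w) s
    & greedy mu s = v].
  apply: (@edge_end_greedy w v u); rewrite fE; apply/seteqP; split;
    by apply: sub_hull => a; rewrite !inE orbC => aP; apply: mem_hull; rewrite !inE.
have [h|/existsNP[p /existsNP[a /existsNP[b /existsNP[q]]]]] := pselect
  (forall p a b q, enumerates (p ++ a :: b :: q) ->
   sorted (desc w) (p ++ a :: b :: q) -> w 0 a = w 0 b ->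
   greedy mu (p ++ a :: b :: q) = u -> greedy mu (p ++ b :: a :: q) = u).
  case: uv; rewrite -sv; symmetry.
  exact: (desc_connected (Q := fun s => greedy mu s = u) h es es').
move=> /not_implyP[esw /not_implyP[ssw /not_implyP[wab /not_implyP[gu gu']]]].
have [t tE] := greedy_swap esw.
have es2 : enumerates (p ++ b :: a :: q).
  apply: perm_trans esw; rewrite perm_cat2l.
  by apply/seq.permP => f; rewrite /= addnCA.
have ss2 : sorted (desc w) (p ++ b :: a :: q) by rewrite -desc_swap.
have := face_greedy es2 ss2; rewrite fE => /hull2P[th _ thE].
(* The transposition leads to [u + th (v - u)] with [th] nonzero, and moves by [t] times the
   root. *)
exists a, b, (t / th); split.
  apply/eqP => ab; move/enumerates_uniq: esw.
  by rewrite ab cat_uniq /= inE eqxx !andbF.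
have th0 : th != 0.
  by apply: contra_notN gu' => /eqP th0; rewrite thE th0 scale0r addr0.
move: tE; rewrite gu thE addrC addKr => tE.
by rewrite mulrC -scalerA -tE scalerA mulVf // scale1r.
Qed.

End BasePolytope.

Definition three_term mu := forall S (a b c : 'I_n), (a < b < c)%N ->
  a \notin S -> b \notin S -> c \notin S ->
  mu (S :|: [set a; c]) + mu (S :|: [set b]) =
  Num.max (mu (S :|: [set b; c]) + mu (S :|: [set a]))
          (mu (S :|: [set a; b]) + mu (S :|: [set c])).

Definition MV_function mu :=
  [/\ mu set0 = 0, submodular mu, forall S, mu S \is a Num.int & three_term mu].

Lemma submod_MV_function mu S : MV_function mu ->
  submod (greedy_hull mu) S = mu S.
Proof. by case=> mu0 sm _ _; apply: submod_greedy_hull. Qed.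

Lemma is_MV_greedy_hull mu : MV_function mu -> is_MV (greedy_hull mu).
Proof.
move=> hmu; have [mu0 sm mui mu3] := hmu; split.
- split; last exact: greedy_hull_edge.
  exists [seq greedy mu s | s <- permutations (enum 'I_n)] => //.
  rewrite -size_eq0 size_map size_eq0; apply/eqP => E.
  by have := mem_permutations (enum 'I_n) (enum 'I_n); rewrite E perm_refl.
- move=> v [w fE] k; have [s es ss] := exists_desc w.
  have := face_greedy mu0 sm es ss; rewrite fE => <-; rewrite mxE.
  by have /intrP[z ->] := rpredB (mui (prefix_set s (index k s).+1))
    (mui (prefix_set s (index k s))); exists z.
- by move=> S a b c abc aS bS cS; rewrite !(submod_MV_function _ hmu); apply: mu3.
Qed.

(* A maximizer of a generic functional of the chamber of s that failed to      *)
(* maximize some w of the closed chamber would have an improving edge, but its *)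
(* direction e_a - e_b has constant sign on the chamber.                       *)
Lemma gen_perm_vertex P s : is_gen_permutahedron P -> enumerates s ->
  exists v, [/\ is_vertex P v, P v
    & forall w, (forall a b, (index a s < index b s)%N -> w 0 b <= w 0 a) ->
        forall x, P x -> dot w x <= dot w v].
Proof.
case=> -[pts pts0 ->] hedge es; have us := enumerates_uniq es.
pose ls := [seq u - u' | u <- pts, u' <- pts].
pose E : seq 'rV[R]_n :=
  [seq delta_mx 0 p.1 - delta_mx 0 p.2 | p <- enum {: 'I_n * 'I_n}].
have dE (w : 'rV[R]_n) (a b : 'I_n) :
    dot w (delta_mx 0 a - delta_mx 0 b) = w 0 a - w 0 b.
  by rewrite dotBr !(dotC w) !dot_delta.
have inE' (a b : 'I_n) : delta_mx 0 a - delta_mx 0 b \in E.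
  by apply/mapP; exists (a, b); rewrite ?mem_enum.
pose w0 : 'rV[R]_n := \row_a - (index a s)%:R.
have [w [wZ wY]] := generic_near w0 ls E.
have wlt a b : (index a s < index b s)%N -> w 0 b < w 0 a.
  move=> ab; rewrite -subr_gt0 -dE wY // dE !mxE.
  by rewrite opprK addrC subr_gt0 ltr_nat.
have [v vp hv] := seq_argmax (dot w) pts0.
have wv u : u \in pts -> u != v -> dot w u < dot w v.
  move=> up uv; rewrite lt_neqAle hv // andbT -subr_eq0 -dotBr wZ ?subr_eq0 //.
  by apply: allpairs_f.
exists v; split; last first.
- move=> w1 hw1; apply: hull_dot_le => u up.
  rewrite leNgt; apply/negP => w1u.
  have uv : u != v by apply: contraTneq w1u => ->; rewrite ltxx.
  have wuv : 0 < dot w (v - u) by rewrite dotBr subr_gt0 wv.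
  (* With this [d], [w2] still takes half of the positive value of [w1] on [u - v], while the share
     of [w] makes it strictly decreasing along [s]. *)
  pose d := dot w1 (u - v) / 2 / dot w (v - u).
  have d0 : 0 < d by rewrite !divr_gt0 // dotBr subr_gt0.
  pose w2 := w1 + d *: w.
  have w2u : 0 < dot w2 (u - v).
    rewrite /w2 dotDl dotZl -[in dot w _]opprB (dotNr w) mulrN /d divfK ?gt_eqF //.
    have : 0 < dot w1 (u - v) by rewrite dotBr subr_gt0.
    lra.
  have w2lt a b : (index a s < index b s)%N -> w2 0 b < w2 0 a.
    by move=> ab; rewrite ![w2 _ _]mxE ![(d *: w) _ _]mxE ler_ltD ?ltr_pM2l ?wlt ?hw1.
  pose zs := [seq dot w (v - p.2) *: (p.1 - v) - dot w (v - p.1) *: (p.2 - v)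
    | p <- [seq (u, u') | u <- pts, u' <- pts]].
  have [w' [wZ' wY']] := generic_near w2 zs ((u - v) :: E).
  have [u' [ed wu' wu'']] := @improving_edge _ _ pts w w' v vp wv
    ltac:(by exists u => //; rewrite -subr_gt0 -dotBr wY' ?mem_head)
    ltac:(by move=> u1 u2 u1p u2p z /wZ' ->//; apply/mapP; exists (u1, u2) => //;
          apply: allpairs_f).
  have [a [b [t [ab tE]]]] := hedge _ _ ed.
  have lt1 : t * (w 0 a - w 0 b) < 0.
    by rewrite -dE -dotZr -tE dotBr subr_lt0.
  have lt2 : 0 < t * (w' 0 a - w' 0 b).
    by rewrite -dE -dotZr -tE dotBr subr_gt0.
  have w'lt c e : (index c s < index e s)%N -> w' 0 e < w' 0 c.
    by move=> ce; rewrite -subr_gt0 -dE wY' ?inE ?inE' ?orbT // dE subr_gt0 w2lt.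
  case: (ltngtP (index a s) (index b s)) => [iab|iab|iab].
  - by have := wlt _ _ iab; have := w'lt _ _ iab; nra.
  - by have := wlt _ _ iab; have := w'lt _ _ iab; nra.
  - move/(congr1 (nth a s)): iab; rewrite !nth_index ?mem_enumerates //.
    by move=> eab; rewrite eab eqxx in ab.
- exact: mem_hull.
- exists w; rewrite (face_hull vp hv); apply/seteqP; split.
    have -> : [set v]%classic = hull [:: v].
      apply/seteqP; split=> [x ->|x /hullP hx]; first by apply: mem_hull; rewrite mem_head.
      apply/eqP; rewrite -subr_eq0; apply/eqP/dot_self_eq0/eqP.
      rewrite eq_le; apply/andP; split.
        have [a] := hx (x - v); rewrite inE => /eqP ->.
        by rewrite [in X in _ -> X]dotBr subr_le0.
      by apply: sumr_ge0 => k _; rewrite -expr2 sqr_ge0.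
    apply: sub_hull => a; rewrite mem_filter => /andP[/eqP wa ap].
    apply: mem_hull; rewrite inE; apply: contraTT (isT) => av.
    by have := wv a ap av; rewrite wa ltxx.
  by move=> x ->; apply: mem_hull; rewrite mem_filter eqxx.
Qed.

Lemma ind_prefix_desc s k a b : enumerates s -> (index a s < index b s)%N ->
  ind R (prefix_set s k) 0 b <= ind R (prefix_set s k) 0 a.
Proof.
move=> es ab; rewrite !mxE ler_nat !inE !in_take ?mem_enumerates //.
by case: (ltnP (index b s) k) => // bk; rewrite (ltn_trans ab bk).
Qed.

(** The indicators of prefixes of [s] lie in the closed chamber of [s], so the vertex given by
    [gen_perm_vertex] has the prefix sums that characterise the greedy point. *)
Lemma gen_perm_greedyP P s : is_gen_permutahedron P -> enumerates s ->
  [/\ is_vertex P (greedy (submod P) s), P (greedy (submod P) s)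
    & forall w, (forall a b, (index a s < index b s)%N -> w 0 b <= w 0 a) ->
        forall x, P x -> dot w x <= dot w (greedy (submod P) s)].
Proof.
move=> hP es; have [v [vv vP vmax]] := gen_perm_vertex hP es.
have <- // : v = greedy (submod P) s.
apply: greedy_unique => // k; symmetry; apply: submodE; last by exists v.
by apply: vmax => a b; apply: ind_prefix_desc.
Qed.

(** Every functional lies in the closed chamber of some order and is maximised at the greedy point
    of that order. Hence [submod] determines the polytope, which makes the polytope chosen in
    [raise] unique. *)
Lemma gen_perm_greedy_hull P : is_gen_permutahedron P ->
  P = greedy_hull (submod P).
Proof.
move=> hP; have [[pts pts0 PE] _] := hP; apply/seteqP; split; last first.
  rewrite [X in (_ `<=` X)%classic]PE; apply: sub_hull => a /mapP[s].
  by rewrite mem_permutations => es ->; rewrite -PE; have [] := gen_perm_greedyP hP es.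
move=> x Px; apply/hullP => w; have [s es ss] := exists_desc w.
have [_ _ vmax] := gen_perm_greedyP hP es.
exists (greedy (submod P) s); first by apply: map_f; rewrite mem_permutations.
apply: vmax => // a b.
by apply: (sorted_ltn_index (@desc_trans _ _ w) ss); rewrite mem_enumerates.
Qed.

Lemma submod_set0 P : (exists x, P x) -> submod P set0 = 0.
Proof.
case=> x Px; apply: submodE => [y _|]; first by rewrite dot_ind big_set0.
by exists x; rewrite // dot_ind big_set0.
Qed.

Lemma submod_ge pts S x : hull pts x -> dot (ind R S) x <= submod (hull pts) S.
Proof.
move=> hx; have p0 : pts != [::].
  by apply: contraPneq hx => -> /hullP/(_ 0)[].
have [v vp hv] := seq_argmax (dot (ind R S)) p0.
rewrite (@submodE _ _ _ S (dot (ind R S) v)); first exact: hull_dot_le hv _ hx.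
  exact: hull_dot_le hv.
by exists v => //; apply: mem_hull.
Qed.

(** For submodularity, the greedy vertex of an order beginning with [S], [a], [b] is tight on [S]
    and on [S] with both elements added, and satisfies the inequalities of the two sets in between.
    For integrality, a value of [submod] is a partial sum of a lattice vertex. *)
Lemma is_MV_submod P : is_MV P -> MV_function (submod P).
Proof.
case=> hP hlat h3; have [[pts pts0 PE] _] := hP.
have P0 : submod P set0 = 0.
  apply: submod_set0; exists (greedy (submod P) (enum 'I_n)).
  by have [] := gen_perm_greedyP hP (perm_refl _).
split=> // [S a b aS bS ab|S].
  have [s [es sS sk]] := @enumerates_prefix n S [:: a; b]
    ltac:(by rewrite /= inE ab) ltac:(by move=> c; rewrite !inE => /orP[]/eqP->).
  have us := enumerates_uniq es; have [_ vP _] := gen_perm_greedyP hP es.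
  set v := greedy _ _ in vP.
  have vS : dot (ind R S) v = submod P S by rewrite -sS dot_greedy.
  have sab : prefix_set s (#|S| + 2) = a |: (b |: S).
    by rewrite sk //; apply/setP => c; rewrite !inE orbC orbA.
  have vSab : dot (ind R (a |: (b |: S))) v = submod P (a |: (b |: S)).
    by rewrite -sab dot_greedy.
  have ha : dot (ind R (a |: S)) v <= submod P (a |: S).
    by rewrite PE; apply: submod_ge; rewrite -PE.
  have hb : dot (ind R (b |: S)) v <= submod P (b |: S).
    by rewrite PE; apply: submod_ge; rewrite -PE.
  apply: le_trans (lerD ha hb); rewrite -vSab -vS !dot_ind.
  by rewrite !big_setU1 ?inE ?negb_or ?ab //=; lra.
have [s [es sS _]] := @enumerates_prefix n S [::] isT (fun a => ltac:(by [])).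
have us := enumerates_uniq es; have [vv _ _] := gen_perm_greedyP hP es.
rewrite -sS -dot_greedy // dot_ind rpred_sum // => k _.
by have [z ->] := hlat _ vv k; apply/intrP; exists z.
Qed.

End GenPerm.

(** * Raising operators preserve the three-term relations *)

Section Tropical.
Variable R : realType.

Lemma maxE (x y z : R) :
  x = Num.max y z <-> [/\ y <= x, z <= x & x = y \/ x = z].
Proof.
split=> [->|[yx zx]].
  by rewrite !le_max !lexx orbT; split=> //; case: leP; [right|left].
by move=> xyz; apply/eqP; rewrite eq_le ge_max yx zx le_max; case: xyz => <-;
  rewrite lexx ?orbT.
Qed.

Ltac max_hyps := repeat match goal with
  H : _ = Num.max _ _ |- _ => case/maxE: H => ? ? [?|?] end.
Ltac max_goal := apply/maxE; max_hyps; split; first [lra | (left; lra) | (right; lra)].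

Section FourElements.
Variables (s1 s2 s3 s4 d12 d13 d14 d23 d24 d34 t123 t124 t134 t234 : R).
Let R123 := d13 + s2 = Num.max (d23 + s1) (d12 + s3).
Let R124 := d14 + s2 = Num.max (d24 + s1) (d12 + s4).
Let R134 := d14 + s3 = Num.max (d34 + s1) (d13 + s4).
Let R234 := d24 + s3 = Num.max (d34 + s2) (d23 + s4).
Let P := d13 + d24 = Num.max (d12 + d34) (d14 + d23).
Let B1 := t124 + d13 = Num.max (t134 + d12) (t123 + d14).
Let B2 := t124 + d23 = Num.max (t234 + d12) (t123 + d24).
Let B3 := t134 + d23 = Num.max (t234 + d13) (t123 + d34).
Let B4 := t134 + d24 = Num.max (t234 + d14) (t124 + d34).

(** [s], [d], [t] are the values on a base set with one, two or three of four elements adjoined; the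
    [R] relations are three-term relations over the base set, and [Bk] is the one over the base set
    with element [k]. Once the Pluecker relation [P] is known, suitable pairs of the [B] relations
    imply a third. *)
Lemma tropical_plucker : R123 -> R124 -> R134 -> R234 -> P.
Proof. rewrite /R123 /R124 /R134 /R234 /P => h1 h2 h3 h4; max_goal. Qed.

Lemma four_term1 : P -> B2 -> B3 -> B1.
Proof. rewrite /P /B1 /B2 /B3 => h1 h2 h3; max_goal. Qed.

Lemma four_term2 : P -> B1 -> B3 -> B2.
Proof. rewrite /P /B1 /B2 /B3 => h1 h2 h3; max_goal. Qed.

Lemma four_term3 : P -> B2 -> B4 -> B3.
Proof. rewrite /P /B2 /B3 /B4 => h1 h2 h3; max_goal. Qed.

Lemma four_term4 : P -> B2 -> B3 -> B4.
Proof. rewrite /P /B2 /B3 /B4 => h1 h2 h3; max_goal. Qed.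

End FourElements.

(** One of [p], [q] stands for [mu] with [i] adjoined, the other with [j]; [d] adjoins both and [s]
    neither. This covers the positions in which no single three-term relation gives the mixed
    inequality: both further elements above [j], or both below [i]. *)
Lemma polarized_submodular (p0 pa pb pab q0 qa qb qab sa sb sab d0 da db : R) :
  qa + p0 = Num.max (pa + q0) (d0 + sa) ->
  qb + p0 = Num.max (pb + q0) (d0 + sb) ->
  qab + pb = Num.max (pab + qb) (db + sab) ->
  qab + pa = Num.max (pab + qa) (da + sab) ->
  pab + p0 <= pa + pb -> qab + q0 <= qa + qb ->
  da + p0 <= d0 + pa -> db + p0 <= d0 + pb ->
  sab + p0 <= pb + sa \/ sab + p0 <= pa + sb ->
  qab + p0 <= Num.max (pa + qb) (qa + pb).
Proof.
move=> h1 h2 h3 h4 h5 h6 h7 h8 h9; rewrite leNgt gt_max; apply/negP=> /andP[x y].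
by case: h9 => h9; max_hyps; lra.
Qed.

End Tropical.

(** * Stability of MV functions under raising *)

Section Raising.
Variables (R : realType) (n : nat).
Implicit Types (S U A : {set 'I_n}) (f mu : {set 'I_n} -> R).

Definition three_term_at f U (a b c : 'I_n) :=
  f (a |: (c |: U)) + f (b |: U) =
  Num.max (f (b |: (c |: U)) + f (a |: U)) (f (a |: (b |: U)) + f (c |: U)).

Lemma setU_pair S (a b : 'I_n) : S :|: [set a; b] = a |: (b |: S).
Proof. by rewrite setUC -setUA. Qed.

Lemma three_termP f : three_term f <->
  forall U (a b c : 'I_n), (a < b < c)%N ->
    a \notin U -> b \notin U -> c \notin U -> three_term_at f U a b c.
Proof.
by split=> h S a b c abc aS bS cS; have := h S a b c abc aS bS cS;
  rewrite /three_term_at !setU_pair !(setUC S).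
Qed.

Section FourElementSets.
Variables (f : {set 'I_n} -> R) (U : {set 'I_n}) (a b c d : 'I_n).
Hypotheses (h1 : three_term_at f U a b c) (h2 : three_term_at f U a b d)
  (h3 : three_term_at f U a c d) (h4 : three_term_at f U b c d).

Let P := tropical_plucker h1 h2 h3 h4.

Let sortU A := (setUCA [set d] [set c] A, setUCA [set d] [set b] A,
  setUCA [set d] [set a] A, setUCA [set c] [set b] A,
  setUCA [set c] [set a] A, setUCA [set b] [set a] A).

Lemma three_term_at1 :
  three_term_at f (b |: U) a c d -> three_term_at f (c |: U) a b d ->
  three_term_at f (a |: U) b c d.
Proof. by rewrite /three_term_at !sortU; apply: four_term1 P. Qed.

Lemma three_term_at2 :
  three_term_at f (a |: U) b c d -> three_term_at f (c |: U) a b d ->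
  three_term_at f (b |: U) a c d.
Proof. by rewrite /three_term_at !sortU; apply: four_term2 P. Qed.

Lemma three_term_at3 :
  three_term_at f (b |: U) a c d -> three_term_at f (d |: U) a b c ->
  three_term_at f (c |: U) a b d.
Proof. by rewrite /three_term_at !sortU; apply: four_term3 P. Qed.

Lemma three_term_at4 :
  three_term_at f (b |: U) a c d -> three_term_at f (c |: U) a b d ->
  three_term_at f (d |: U) a b c.
Proof. by rewrite /three_term_at !sortU; apply: four_term4 P. Qed.

End FourElementSets.

Section Raise.
Variables (i j : 'I_n) (hij : nat_of_ord j = (nat_of_ord i).+1).
Variables (mu : {set 'I_n} -> R) (c : R).
Hypotheses (sm : submodular mu) (t3 : three_term mu).

(** Raising with an arbitrary constant [c]: submodularity and the three-term relations survive for
    every real [c], and the value [raise_const] enters only through integrality. *)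
Let nu S : R := if (i \notin S) && (j \in S)
  then Num.max (mu S) (mu (i |: (S :\ j)) - c) else mu S.

Let nui S : i \in S -> nu S = mu S.
Proof. by rewrite /nu => ->. Qed.

Let nuNj S : j \notin S -> nu S = mu S.
Proof. by rewrite /nu => /negPf->; rewrite andbF. Qed.

Let ij : i != j.
Proof. by rewrite -val_eqE /= hij neq_ltn leqnn. Qed.

Let nuj S : i \notin S -> j \notin S ->
  nu (j |: S) = Num.max (mu (j |: S)) (mu (i |: S) - c).
Proof.
by move=> iS jS; rewrite /nu setU1K // !inE eqxx (negPf iS) (negPf ij).
Qed.

Let nu_ge S : mu S <= nu S.
Proof. by rewrite /nu; case: ifP => // _; rewrite le_max lexx. Qed.

Let cases a : a != i -> a != j -> (a < i)%N \/ (j < a)%N.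
Proof. by rewrite -!val_eqE /=; lia. Qed.

Let t3' U (a b d : 'I_n) : (a < b < d)%N -> a \notin U -> b \notin U ->
  d \notin U -> three_term_at mu U a b d.
Proof. exact: (three_termP mu).1. Qed.

Section Cross.
Variables (U : {set 'I_n}) (a b : 'I_n).
Hypotheses (iU : i \notin U) (jU : j \notin U) (aU : a \notin U) (bU : b \notin U)
  (ai : a != i) (aj : a != j) (bi : b != i) (bj : b != j) (ab : a != b).

Let sortU A := (setUCA [set b] [set a] A, setUCA [set b] [set j] A,
  setUCA [set b] [set i] A, setUCA [set a] [set j] A,
  setUCA [set a] [set i] A, setUCA [set j] [set i] A).

Let ba : b != a. Proof. by rewrite eq_sym. Qed.
Let ji : j != i. Proof. by rewrite eq_sym. Qed.
Let ia : i != a. Proof. by rewrite eq_sym. Qed.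
Let ib : i != b. Proof. by rewrite eq_sym. Qed.
Let ja : j != a. Proof. by rewrite eq_sym. Qed.
Let jb : j != b. Proof. by rewrite eq_sym. Qed.

Let notin := (in_setU1, negb_or, iU, jU, aU, bU, ai, aj, bi, bj, ab, ba, ji,
  ia, ib, (ja, jb, ij)).

Let p A := mu (j |: A).
Let q A := mu (i |: A).

Let p_sub : p (a |: (b |: U)) + p U <= p (a |: U) + p (b |: U).
Proof. by have := @sm (j |: U) a b; rewrite !notin ?sortU; apply. Qed.

Let q_sub : q (a |: (b |: U)) + q U <= q (a |: U) + q (b |: U).
Proof. by have := @sm (i |: U) a b; rewrite !notin ?sortU; apply. Qed.

(** On sets with [j] and without [i], [nu] is the maximum of [p] and [q - c]. Its submodularity
    splits into that of [p], that of [q], and the mixed inequalities [cross_q] and [cross_p], which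
    come from three-term relations involving [i] and [j]. *)
Let cross_q : q (a |: (b |: U)) + p U <=
  Num.max (p (a |: U) + q (b |: U)) (q (a |: U) + p (b |: U)).
Proof.
have [ai'|ja'] := cases ai aj.
  have := @t3' (b |: U) a i j; rewrite !notin hij ai' leqnn /three_term_at ?sortU.
  move=> /(_ isT isT isT isT)/maxE[_ h _]; rewrite le_max; apply/orP; left.
  by move: h p_sub; rewrite /p /q; lra.
have [bi'|jb'] := cases bi bj.
  have := @t3' (a |: U) b i j; rewrite !notin hij bi' leqnn /three_term_at ?sortU.
  move=> /(_ isT isT isT isT)/maxE[_ h _]; rewrite le_max; apply/orP; right.
  by move: h p_sub; rewrite /p /q; lra.
have ija : (i < j < a)%N by rewrite hij leqnn -hij.
have ijb : (i < j < b)%N by rewrite hij leqnn -hij.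
have h1 := t3' ija iU jU aU; have h2 := t3' ijb iU jU bU.
have := @t3' (b |: U) i j a ija; have := @t3' (a |: U) i j b ijb.
rewrite !notin /three_term_at ?sortU => /(_ isT isT isT) h4 /(_ isT isT isT) h3.
have h7 := @sm (j |: U) i a; have h8 := @sm (j |: U) i b.
move: h7 h8; rewrite !notin ?sortU => /(_ isT isT isT) h7 /(_ isT isT isT) h8.
apply: (polarized_submodular h1 h2 h3 h4 p_sub q_sub h7 h8).
have [lab|lba|/val_inj eab] := ltngtP a b; last by have := ab; rewrite eab eqxx.
  have := @t3' U j a b; rewrite !notin ja' lab /three_term_at ?sortU.
  by case/(_ isT isT isT isT)/maxE => h _ _; left.
have := @t3' U j b a; rewrite !notin jb' lba /three_term_at ?sortU.
by case/(_ isT isT isT isT)/maxE => h _ _; right.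
Qed.

Let cross_p : p (a |: (b |: U)) + q U <=
  Num.max (q (a |: U) + p (b |: U)) (p (a |: U) + q (b |: U)).
Proof.
have [ai'|ja'] := cases ai aj; last first.
  have := @t3' U i j a; rewrite !notin hij leqnn -hij ja' /three_term_at ?sortU.
  move=> /(_ isT isT isT isT)/maxE[h _ _]; rewrite le_max; apply/orP; left.
  by move: h p_sub; rewrite /p /q; lra.
have [bi'|jb'] := cases bi bj; last first.
  have := @t3' U i j b; rewrite !notin hij leqnn -hij jb' /three_term_at ?sortU.
  move=> /(_ isT isT isT isT)/maxE[h _ _]; rewrite le_max; apply/orP; right.
  by move: h p_sub; rewrite /p /q; lra.
have aij : (a < i < j)%N by rewrite hij ai' leqnn.
have bij : (b < i < j)%N by rewrite hij bi' leqnn.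
have := @t3' U a i j aij; have := @t3' U b i j bij.
have := @t3' (b |: U) a i j aij; have := @t3' (a |: U) b i j bij.
rewrite !notin /three_term_at ?sortU => /(_ isT isT isT) h4 /(_ isT isT isT) h3.
move=> /(_ isT isT isT) h2 /(_ isT isT isT) h1.
rewrite maxC in h1; rewrite maxC in h2; rewrite maxC in h3; rewrite maxC in h4.
have h7 := @sm (i |: U) j a; have h8 := @sm (i |: U) j b.
move: h7 h8; rewrite !notin ?sortU => /(_ isT isT isT) h7 /(_ isT isT isT) h8.
apply: (polarized_submodular h1 h2 h3 h4 q_sub p_sub h7 h8).
have [lab|lba|/val_inj eab] := ltngtP a b; last by have := ab; rewrite eab eqxx.
  have := @t3' U a b i; rewrite !notin lab bi' /three_term_at ?sortU.
  by case/(_ isT isT isT isT)/maxE => _ h _; right.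
have := @t3' U b a i; rewrite !notin lba ai' /three_term_at ?sortU.
by case/(_ isT isT isT isT)/maxE => _ h _; left; move: h; lra.
Qed.

Lemma raise_submodular_at :
  nu (j |: (a |: (b |: U))) + nu (j |: U) <= nu (j |: (a |: U)) + nu (j |: (b |: U)).
Proof.
rewrite !nuj ?notin //.
move: cross_p cross_q p_sub q_sub; rewrite /p /q.
move: (mu (j |: U)) (mu (i |: U)) (mu (j |: (a |: U))) (mu (i |: (a |: U)))
  (mu (j |: (b |: U))) (mu (i |: (b |: U))) (mu (j |: (a |: (b |: U))))
  (mu (i |: (a |: (b |: U)))) => p0 q0 pa qa pb qb pab qab.
rewrite !le_max => cp cq ps qs; set ma := Num.max pa _; set mb := Num.max pb _.
have [ma1 ma2] : pa <= ma /\ qa - c <= ma by rewrite !le_max !lexx orbT.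
have [mb1 mb2] : pb <= mb /\ qb - c <= mb by rewrite !le_max !lexx orbT.
by case: (leP pab) => _; case: (leP p0) => _; case/orP: cp => cp; case/orP: cq => cq;
  clearbody ma mb; lra.
Qed.

End Cross.

Let nuiU A : nu (i |: A) = mu (i |: A).
Proof. by rewrite nui // setU11. Qed.

Lemma raise_submodular : submodular nu.
Proof.
pose goal S a b := nu (a |: (b |: S)) + nu S <= nu (a |: S) + nu (b |: S).
have sym S a b : goal S a b -> goal S b a.
  by rewrite /goal setUCA [in leRHS]addrC.
move=> S a b aS bS ab; rewrite -/(goal S a b).
have [iS|iS] := boolP (i \in S).
  by rewrite /goal !nui ?in_setU1 ?iS ?orbT //; apply: sm.
have [jS|jS] := boolP (j \in S); last first.
  have gj d : d \notin S -> d != j -> goal S j d.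
    move=> dS dj; rewrite /goal (nuNj jS); have [->|di] := eqVneq d i.
      rewrite setUCA !nuiU (le_trans (sm iS jS ij)) // addrC lerD2r nu_ge //.
    have h1 := @sm S j d jS dS; have h2 := @sm S i d iS dS.
    rewrite !nuj ?(nuNj (S := d |: S)) ?in_setU1 ?negb_or ?(eq_sym i) ?(eq_sym j) ?dj ?di //.
    move: h1 h2; rewrite !(eq_sym _ d) dj di => /(_ isT) h1 /(_ isT) h2.
    set m := Num.max (mu (j |: S)) _.
    have [m1 m2] : mu (j |: S) <= m /\ mu (i |: S) - c <= m by rewrite !le_max !lexx orbT.
    by case: (leP (mu (j |: (d |: S)))) => _; clearbody m; lra.
  have [aj|aj] := eqVneq a j; first by rewrite aj; apply: gj; rewrite // -aj eq_sym.
  have [bj|bj] := eqVneq b j; first by apply: sym; rewrite bj; apply: gj; rewrite // -bj.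
  rewrite /goal !nuNj ?in_setU1 ?negb_or ?(eq_sym j) ?aj ?bj //; exact: sm.
rewrite -(setD1K jS) in iS aS bS *; set U := S :\ j in iS aS bS *.
have jU : j \notin U by rewrite !inE eqxx.
rewrite in_setU1 negb_or in iS; case/andP: iS => _ iU.
rewrite in_setU1 negb_or in aS; case/andP: aS => aj aU.
rewrite in_setU1 negb_or in bS; case/andP: bS => bj bU.
have gi d : d \notin U -> d != i -> d != j -> goal (j |: U) i d.
  move=> dU di dj; have := @sm (j |: U) i d; have := @sm (i |: U) j d.
  rewrite /goal !nuiU (setUCA [set d] [set j]) !nuj;
    rewrite ?in_setU1 ?negb_or ?iU ?jU ?dU ?(eq_sym _ d) ?di ?dj ?ij ?(eq_sym j i) ?ij //.
  pose srt A := (setUCA [set d] [set j] A, setUCA [set d] [set i] A,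
    setUCA [set j] [set i] A).
  rewrite ?srt => /(_ isT isT isT) h1 /(_ isT isT isT) h2.
  set m := Num.max (mu (j |: (d |: U))) _.
  have [m1 m2] : mu (j |: (d |: U)) <= m /\ mu (i |: (d |: U)) - c <= m.
    by rewrite !le_max !lexx orbT.
  by case: (leP (mu (j |: U))) => _; clearbody m; lra.
have [ai|ai] := eqVneq a i; first by rewrite ai; apply: gi; rewrite // -ai eq_sym.
have [bi|bi] := eqVneq b i; first by apply: sym; rewrite bi; apply: gi; rewrite // -bi.
have := raise_submodular_at iU jU aU bU ai aj bi bj ab.
by rewrite /goal !(setUCA _ [set j]).
Qed.

(** If each sum in a three-term relation has exactly one term affected by raising, the relation for
    [nu] is the maximum of a relation for [mu] and of its image under replacing that [j] by [i],
    shifted by [c]. *)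
Lemma max_lin (x y z x' y' z' t : R) : x = Num.max y z -> x' = Num.max y' z' ->
  Num.max x (x' - t) = Num.max (Num.max y (y' - t)) (Num.max z (z' - t)).
Proof. by move=> -> ->; rewrite addr_maxl maxACA. Qed.

Let maxDl (x y z : R) : Num.max x (y - c) + z = Num.max (x + z) (y + z - c).
Proof. by rewrite addr_maxl addrAC. Qed.

Let maxDr (x y z : R) : z + Num.max x (y - c) = Num.max (z + x) (z + y - c).
Proof. by rewrite addr_maxr addrA. Qed.

Section ThreeTermCases.
Variables (U : {set 'I_n}) (a b : 'I_n).
Hypotheses (iU : i \notin U) (jU : j \notin U) (aU : a \notin U) (bU : b \notin U)
  (ai : a != i) (aj : a != j) (bi : b != i) (bj : b != j) (lab : (a < b)%N).

Let ab : a != b. Proof. by rewrite -val_eqE ltn_eqF. Qed.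
Let ba : b != a. Proof. by rewrite eq_sym. Qed.
Let ji : j != i. Proof. by rewrite eq_sym. Qed.
Let ia : i != a. Proof. by rewrite eq_sym. Qed.
Let ib : i != b. Proof. by rewrite eq_sym. Qed.
Let ja : j != a. Proof. by rewrite eq_sym. Qed.
Let jb : j != b. Proof. by rewrite eq_sym. Qed.

Let notin := (in_setU1, negb_or, iU, jU, aU, bU, ai, aj, bi, bj, ab, ba, ji,
  ia, ib, (ja, jb, ij)).

Let sortU A := (setUCA [set b] [set a] A, setUCA [set b] [set j] A,
  setUCA [set b] [set i] A, setUCA [set a] [set j] A,
  setUCA [set a] [set i] A, setUCA [set j] [set i] A).

Lemma three_term_jab : (j < a)%N -> three_term_at nu U j a b.
Proof.
move=> lja; have := @t3' U j a b; have := @t3' U i a b.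
rewrite !notin lja lab (ltn_trans _ lja) ?hij // => /(_ isT isT isT isT) h1.
move=> /(_ isT isT isT isT) h2; rewrite /three_term_at ?sortU !nuj ?notin //.
by rewrite !nuNj ?notin // !maxDl !maxDr; apply: max_lin;
  move: h1 h2; rewrite /three_term_at ?sortU.
Qed.

Lemma three_term_ajb : (a < i)%N -> (j < b)%N -> three_term_at nu U a j b.
Proof.
move=> lai ljb; have := @t3' U a j b; have := @t3' U a i b.
rewrite !notin lai ljb (ltn_trans _ ljb) ?hij // (ltn_trans lai) //=.
move=> /(_ isT isT isT isT) h1 /(_ isT isT isT isT) h2.
rewrite /three_term_at ?sortU !nuj ?notin //.
by rewrite !nuNj ?notin // !maxDl !maxDr; apply: max_lin;
  move: h1 h2; rewrite /three_term_at ?sortU.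
Qed.

Lemma three_term_abj : (b < i)%N -> three_term_at nu U a b j.
Proof.
move=> lbi; have := @t3' U a b j; have := @t3' U a b i.
rewrite !notin lab lbi hij (ltn_trans lbi) //=.
move=> /(_ isT isT isT isT) h1 /(_ isT isT isT isT) h2.
rewrite /three_term_at ?sortU !nuj ?notin //.
by rewrite !nuNj ?notin // !maxDl !maxDr; apply: max_lin;
  move: h1 h2; rewrite /three_term_at ?sortU.
Qed.

Lemma three_term_iab : (j < a)%N -> three_term_at nu (j |: U) i a b.
Proof.
move=> lja; have := @t3' (j |: U) i a b; have := @t3' (i |: U) j a b.
rewrite !notin lja lab (ltn_trans _ lja) ?hij //.
move=> /(_ isT isT isT isT) h1 /(_ isT isT isT isT) h2.
rewrite /three_term_at ?sortU !nuiU !nuj ?notin // !maxDl !maxDr.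
by apply: max_lin; move: h1 h2; rewrite /three_term_at ?sortU.
Qed.

Lemma three_term_aib : (a < i)%N -> (j < b)%N -> three_term_at nu (j |: U) a i b.
Proof.
move=> lai ljb; have := @t3' (j |: U) a i b; have := @t3' (i |: U) a j b.
rewrite !notin lai ljb (ltn_trans _ ljb) ?hij // (ltn_trans lai) //=.
move=> /(_ isT isT isT isT) h1 /(_ isT isT isT isT) h2.
rewrite /three_term_at ?sortU !nuiU !nuj ?notin // !maxDl !maxDr.
by apply: max_lin; move: h1 h2; rewrite /three_term_at ?sortU.
Qed.

Lemma three_term_abi : (b < i)%N -> three_term_at nu (j |: U) a b i.
Proof.
move=> lbi; have := @t3' (j |: U) a b i; have := @t3' (i |: U) a b j.
rewrite !notin lab lbi hij (ltn_trans lbi) //=.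
move=> /(_ isT isT isT isT) h1 /(_ isT isT isT isT) h2.
rewrite /three_term_at ?sortU !nuiU !nuj ?notin // !maxDl !maxDr.
by apply: max_lin; move: h1 h2; rewrite /three_term_at ?sortU.
Qed.

End ThreeTermCases.

Section ThreeTermPair.
Variables (U : {set 'I_n}) (a : 'I_n).
Hypotheses (iU : i \notin U) (jU : j \notin U) (aU : a \notin U)
  (ai : a != i) (aj : a != j).

Let ji : j != i. Proof. by rewrite eq_sym. Qed.
Let ia : i != a. Proof. by rewrite eq_sym. Qed.
Let ja : j != a. Proof. by rewrite eq_sym. Qed.
Let notin := (in_setU1, negb_or, iU, jU, aU, ai, aj, ji, ia, ja, ij).
Let sortU A := (setUCA [set a] [set j] A, setUCA [set a] [set i] A,
  setUCA [set j] [set i] A).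

(** Here the left side and one term of the right side acquire the same shifted term, so the relation
    of [mu] for the same three elements suffices. *)
Lemma three_term_ija : (j < a)%N -> three_term_at nu U i j a.
Proof.
move=> lja; have := @t3' U i j a; rewrite !notin hij leqnn -hij lja.
move=> /(_ isT isT isT isT); rewrite /three_term_at ?sortU !nuiU !nuj ?notin //.
by rewrite !nuNj ?notin // !maxDl !maxDr => ->; rewrite maxAC.
Qed.

Lemma three_term_aij : (a < i)%N -> three_term_at nu U a i j.
Proof.
move=> lai; have := @t3' U a i j; rewrite !notin hij leqnn lai.
move=> /(_ isT isT isT isT); rewrite /three_term_at ?sortU !nuiU !nuj ?notin //.
by rewrite !nuNj ?notin // !maxDl !maxDr => ->; rewrite maxA.
Qed.

End ThreeTermPair.

Let three_term_noj U (a b d : 'I_n) : j \notin U -> i \notin U -> (a < b < d)%N ->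
  a \notin U -> b \notin U -> d \notin U -> three_term_at nu U a b d.
Proof.
move=> jU iU /andP[lab lbd] aU bU dU.
have ltij : (i < j)%N by rewrite hij.
have ni (k : 'I_n) : (k < i)%N -> k != i by move=> h; rewrite -val_eqE ltn_eqF.
have nj (k : 'I_n) : (j < k)%N -> k != j by move=> h; rewrite -val_eqE gtn_eqF.
have ni' (k : 'I_n) : (j < k)%N -> k != i.
  by move=> h; rewrite -val_eqE gtn_eqF // (ltn_trans ltij).
have nj' (k : 'I_n) : (k < i)%N -> k != j.
  by move=> h; rewrite -val_eqE ltn_eqF // (ltn_trans h).
have lti (k : 'I_n) : (k < j)%N -> k != i -> (k < i)%N.
  by rewrite hij ltnS leq_eqVlt => /predU1P[/val_inj->|//]; rewrite eqxx.
have [ja|ja] := eqVneq a j.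
  move: lab lbd; rewrite ja => lab lbd; have ljd := ltn_trans lab lbd.
  by apply: three_term_jab; rewrite // ?ni' ?nj.
have [jb|jb] := eqVneq b j.
  move: lab lbd; rewrite jb => lab lbd; have [iaE|iaN] := eqVneq a i.
    by rewrite iaE; apply: three_term_ija; rewrite // ?ni' ?nj.
  have lai := lti a lab iaN.
  by apply: three_term_ajb; rewrite // ?(ni a) ?(nj' a) ?(ni' d) ?(nj d) ?(ltn_trans lab).
have [jd|jd] := eqVneq d j.
  move: lab lbd; rewrite jd => lab lbd; have [ibE|ibN] := eqVneq b i.
    by move: lab; rewrite ibE => lab; apply: three_term_aij; rewrite // ?ni ?nj'.
  have lbi := lti b lbd ibN; have lai := ltn_trans lab lbi.
  by apply: three_term_abj; rewrite // ?ni ?nj'.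
have nin := (in_setU1, negb_or, jU, ja, jb, jd, eq_sym j).
rewrite /three_term_at !nuNj ?nin //.
by apply: t3'; rewrite // lab.
Qed.

(** The hard case has [j] in [S] and [i] neither in [S] nor among the three elements: both terms of
    every sum are then affected and termwise maxima fail. The relation is deduced on the four
    elements formed by [j] and the three others over [S :\ j]; the position of [j] selects which of
    [three_term_at1] to [three_term_at4] applies. *)
Lemma raise_three_term : three_term nu.
Proof.
apply/three_termP => S a b d /andP[lab lbd] aS bS dS.
have lad := ltn_trans lab lbd.
have [iS|iS] := boolP (i \in S).
  rewrite /three_term_at !nui ?in_setU1 ?iS ?orbT //; apply: t3' => //.
  by rewrite lab.
have [jS|jS] := boolP (j \in S); last by apply: three_term_noj; rewrite // lab.
rewrite -(setD1K jS) in iS aS bS dS *; set U := S :\ j in iS aS bS dS *.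
have jU : j \notin U by rewrite !inE eqxx.
rewrite in_setU1 negb_or in iS; case/andP: iS => _ iU.
rewrite in_setU1 negb_or in aS; case/andP: aS => aj aU.
rewrite in_setU1 negb_or in bS; case/andP: bS => bj bU.
rewrite in_setU1 negb_or in dS; case/andP: dS => dj dU.
have ltij : (i < j)%N by rewrite hij.
have gtj (k : 'I_n) : k != j -> (i < k)%N -> (j < k)%N.
  by rewrite -val_eqE /= hij => kj ik; rewrite ltn_neqAle eq_sym kj.
have lij (k : 'I_n) : (k < i)%N -> (k < j)%N by move=> h; apply: ltn_trans ltij.
have neq (x y : 'I_n) : (x < y)%N -> (x != y) && (y != x).
  by move=> h; rewrite -!val_eqE /= ltn_eqF // gtn_eqF.
have /andP[nab nba] := neq _ _ lab.
have /andP[nbd ndb] := neq _ _ lbd.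
have /andP[nad nda] := neq _ _ lad.
have [ai|ai] := eqVneq a i.
  move: lab lad nba nda; rewrite ai => lab lad nba nda.
  by apply: three_term_iab; rewrite // gtj.
have [bi|bi] := eqVneq b i.
  move: lab lbd nbd ndb; rewrite bi => lab lbd nbd ndb.
  by apply: three_term_aib; rewrite // gtj.
have [di|di] := eqVneq d i.
  move: lbd lad; rewrite di => lbd lad.
  by apply: three_term_abi.
have noj := three_term_noj.
have nin := (in_setU1, negb_or, iU, jU, aU, bU, dU, ((ai, aj, bi, bj, di, dj),
  (nab, nba, nbd, ndb, nad, nda)), (eq_sym j, eq_sym i)).
have hnoj (V : {set 'I_n}) (x y z : 'I_n) : (x < y < z)%N -> [&& i \notin V, j \notin V,
    x \notin V, y \notin V & z \notin V] -> three_term_at nu V x y z.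
  by move=> xyz /and5P[*]; apply: noj.
have [aI|aJ] := cases ai aj; last first.
  have lja : (j < a < b)%N by rewrite aJ.
  have ljd : (j < a < d)%N by rewrite aJ.
  have ljb : (j < b < d)%N by rewrite (ltn_trans aJ).
  have labd : (a < b < d)%N by rewrite lab.
  by apply: three_term_at1; apply: hnoj; rewrite // ?nin //= ltn_trans // aJ.
have [bI|bJ] := cases bi bj; last first.
  by apply: three_term_at2; apply: hnoj; rewrite ?nin ?lab ?lbd ?lij ?bJ
    ?(ltn_trans bJ lbd).
have [dI|dJ] := cases di dj; last first.
  by apply: three_term_at3; apply: hnoj; rewrite ?nin ?lab ?lbd ?lij ?dJ.
by apply: three_term_at4; apply: hnoj; rewrite ?nin ?lab ?lbd ?lad ?lij.
Qed.

End Raise.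

Lemma raise_MV_function (i j : 'I_n) (mu : {set 'I_n} -> R) :
  nat_of_ord j = (nat_of_ord i).+1 -> MV_function mu ->
  MV_function (raise_submod i j mu).
Proof.
move=> hij [mu0 sm mui t3]; split.
- by rewrite /raise_submod !inE andbF.
- exact: raise_submodular.
- move=> S; rewrite /raise_submod; case: ifP => // _.
  case: leP => _; rewrite ?mui // /raise_const.
  by rewrite !rpredB ?mui ?rpred1.
- exact: raise_three_term.
Qed.

End Raising.

(** * Support functions of Schubert matroid polytopes *)

Section Schubert.
Variables (R : realType) (n : nat).
Implicit Types (w v u : 'rV[R]_n) (S T : {set 'I_n}) (D : diagram n).
Implicit Types (phi : {ffun 'I_n -> 'I_n}).

(* The image of such a phi is a set below S in Gale order, and conversely.    *)
Definition lowering S phi : bool :=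
  [forall x in S, forall y in S, (phi x == phi y) ==> (x == y)] &&
  [forall x in S, (phi x <= x)%N].

Lemma loweringP S phi : reflect
  ({in S &, injective phi} /\ forall x, x \in S -> (phi x <= x)%N) (lowering S phi).
Proof.
apply: (iffP andP) => -[h1 h2]; split.
- move=> x y xS yS e; apply/eqP.
  by move/forall_inP/(_ x xS)/forall_inP/(_ y yS)/implyP: h1; apply; rewrite e.
- exact/forall_inP.
- apply/forall_inP => x xS; apply/forall_inP => y yS; apply/implyP => /eqP e.
  by rewrite (h1 x y).
- exact/forall_inP.
Qed.

Lemma lowering_id S : lowering S [ffun x => x].
Proof.
by apply/loweringP; split=> [x y _ _|x _]; rewrite !ffunE.
Qed.

Definition weight w S phi : R := \sum_(x in S) w 0 (phi x).

Definition top_lowering w S :=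
  [arg max_(phi > [ffun x => x] | lowering S phi) weight w S phi]%O.

(** The support function of the Schubert matroid polytope of [S], whose bases are the images of the
    lowerings. *)
Definition schubert w S : R := weight w S (top_lowering w S).

Lemma top_loweringP w S : lowering S (top_lowering w S).
Proof. by rewrite /top_lowering; case: arg_maxP => //; apply: lowering_id. Qed.

Lemma schubert_ge w S phi : lowering S phi -> weight w S phi <= schubert w S.
Proof.
rewrite /schubert /top_lowering; case: arg_maxP => [|psi _ h]; last exact: h.
exact: lowering_id.
Qed.

Lemma schubert_le w S c : (forall phi, lowering S phi -> weight w S phi <= c) ->
  schubert w S <= c.
Proof. by apply; apply: top_loweringP. Qed.

Definition schubitope w D : R := \sum_S (D S)%:R * schubert w S.

Section Swap.
Variables (i j : 'I_n) (hij : nat_of_ord j = (nat_of_ord i).+1).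

Let t := tperm i j.
Definition swapv w : 'rV[R]_n := \row_k w 0 (t k).

Lemma swapvK : involutive swapv.
Proof. by move=> w; apply/rowP => k; rewrite !mxE tpermK. Qed.

Lemma swap_setK : involutive (swap_set i j).
Proof.
by move=> S; rewrite /swap_set -imset_comp (eq_imset _ (tpermK i j)) imset_id.
Qed.

Lemma sum_swap_set S (F : 'I_n -> R) :
  \sum_(x in swap_set i j S) F x = \sum_(x in S) F (t x).
Proof. by rewrite big_imset //= => x y _ _; apply: perm_inj. Qed.

Lemma mem_swap_set S x : (x \in swap_set i j S) = (t x \in S).
Proof. by rewrite -{1}(tpermK i j x) mem_imset //; apply: perm_inj. Qed.

Let ij : i != j. Proof. by rewrite -val_eqE /= hij neq_ltn leqnn. Qed.
Let ti : t i = j. Proof. exact: tpermL. Qed.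
Let tj : t j = i. Proof. exact: tpermR. Qed.
Let tN x : x != i -> x != j -> t x = x.
Proof. by move=> xi xj; rewrite /t tpermD // eq_sym. Qed.

Let lt_ij (x : 'I_n) : (x <= j)%N -> x != j -> (x <= i)%N.
Proof. by rewrite -val_eqE /= hij; lia. Qed.

Let lt_ji (x : 'I_n) : (i <= x)%N -> x != i -> (j <= x)%N.
Proof. by rewrite -val_eqE /= hij; lia. Qed.

Let ltij : (i <= j)%N. Proof. by rewrite hij. Qed.

(* A lowering phi of S stays one after composing with t on the left, except   *)
(* when phi fixes i.                                                          *)
Let lowering_swap S phi : lowering S phi -> ~~ ((i \in S) && (phi i == i)) ->
  lowering S [ffun x => t (phi x)].
Proof.
case/loweringP => inj le fi; apply/loweringP; split=> [x y xS yS|x xS].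
  by rewrite !ffunE => /perm_inj; apply: inj.
rewrite ffunE; have := le x xS; case: (tpermP i j (phi x)) => [e|-> jx|//].
  rewrite e => ix; apply: lt_ji => //; apply: contraNneq fi => xi.
  by rewrite -xi xS e xi eqxx.
exact: leq_trans ltij jx.
Qed.

(** Composing a lowering with the transposition on the left works unless it fixes [i] in [S]. In
    that case [j] is in [S] too, [S] is stable under the swap, and conjugating by the transposition
    works. *)
Lemma schubert_swapv w S : ~~ ((i \in S) && (j \notin S)) ->
  schubert (swapv w) S = schubert w S.
Proof.
move=> SP; suff le v : schubert (swapv v) S <= schubert v S.
  by apply/eqP; rewrite eq_le le -{1}(swapvK w) le.
apply: schubert_le => phi lphi.
have wE psi : weight (swapv v) S psi = \sum_(x in S) v 0 (t (psi x)).
  by apply: eq_bigr => x _; rewrite mxE.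
have [/andP[iS /eqP phii]|fi] := boolP ((i \in S) && (phi i == i)); last first.
  apply: le_trans (schubert_ge v (lowering_swap lphi fi)); rewrite wE.
  by apply: ler_sum => x _; rewrite ffunE.
have jS : j \in S by move: SP; rewrite iS negbK.
have [inj le] := loweringP _ _ lphi.
have SS : swap_set i j S = S.
  apply/setP => x; rewrite mem_swap_set.
  by case: (tpermP i j x) => [->|->|]; rewrite ?iS ?jS.
have tS x : x \in S -> t x \in S by rewrite -mem_swap_set SS.
have lpsi : lowering S [ffun x => t (phi (t x))].
  apply/loweringP; split=> [x y xS yS|x xS].
    rewrite !ffunE => /perm_inj/inj; rewrite !tS // => /(_ isT isT).
    exact: perm_inj.
  have [->|xi] := eqVneq x i; rewrite !ffunE.
    rewrite ti; have := le j jS; case: (tpermP i j (phi j)) => [e|//|_ pj].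
      have /inj : phi j = phi i by rewrite e phii.
      by move=> /(_ jS iS) e'; move: ij; rewrite e' eqxx.
    by move=> pj'; apply: lt_ij => //; apply/eqP.
  have [->|xj] := eqVneq x j; first by rewrite tj phii ti.
  rewrite (tN xi xj); have := le x xS; case: (tpermP i j (phi x)) => [e|-> jx|//].
    have /inj : phi x = phi i by rewrite e phii.
    by move=> /(_ xS iS) e'; rewrite e' eqxx in xi.
  exact: leq_trans ltij jx.
apply: le_trans (schubert_ge v lpsi); rewrite wE /weight -{1}SS sum_swap_set.
by apply: ler_sum => x _; rewrite ffunE.
Qed.

Lemma schubert_swap_ge w S : i \in S -> j \notin S ->
  schubert w S <= schubert w (swap_set i j S).
Proof.
move=> iS jS; apply: schubert_le => phi /loweringP[inj le].
have lpsi : lowering (swap_set i j S) [ffun x => phi (t x)].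
  apply/loweringP; split=> [x y|x]; rewrite ?ffunE !mem_swap_set.
    by move=> xS yS /inj => /(_ xS yS); apply: perm_inj.
  move=> xS; have := le _ xS; case: (tpermP i j x) xS => [->|->|//].
    by rewrite (negPf jS).
  by move=> _ h; apply: leq_trans h ltij.
apply: le_trans (schubert_ge w lpsi); rewrite /weight sum_swap_set.
by apply: ler_sum => x _; rewrite ffunE tpermK.
Qed.

(** If a lowering of the swapped set moves [j], it sends [j] to at most [i], so it lowers [S] after
    relabelling. If it fixes [j], conjugate by the transposition: the image then changes only by
    trading [j] for [i], which does not decrease the weight. *)
Lemma schubert_swap_le w S : i \in S -> j \notin S -> w 0 j <= w 0 i ->
  schubert w (swap_set i j S) <= schubert w S.
Proof.
move=> iS jS wij; apply: schubert_le => phi /loweringP[inj le].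
have tS x : x \in S -> t x \in swap_set i j S by rewrite mem_swap_set tpermK.
have jS' : j \in swap_set i j S by rewrite mem_swap_set tj.
have inj' x y : x \in S -> y \in S -> phi (t x) = phi (t y) -> x = y.
  by move=> xS yS /inj; rewrite !tS // => /(_ isT isT)/perm_inj.
have Sj x : x \in S -> x != j by apply: contraTneq => ->.
have [pj|pj] := eqVneq (phi j) j; last first.
  have lpsi : lowering S [ffun x => phi (t x)].
    apply/loweringP; split=> [x y xS yS|x xS]; rewrite !ffunE; first exact: inj'.
    have [->|xi] := eqVneq x i; first by rewrite ti lt_ij // le.
    by have := le _ (tS x xS); rewrite tN // Sj.
  apply: le_trans (schubert_ge w lpsi); rewrite /weight sum_swap_set.
  by apply: ler_sum => x _; rewrite ffunE.
have lpsi : lowering S [ffun x => t (phi (t x))].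
  apply/loweringP; split=> [x y xS yS|x xS]; rewrite !ffunE.
    by move/perm_inj; apply: inj'.
  have [->|xi] := eqVneq x i; first by rewrite ti pj tj.
  have xj := Sj x xS; have := le _ (tS x xS); rewrite (tN xi xj).
  case: (tpermP i j (phi x)) => [->|-> jx|//]; first by move=> ix; apply: lt_ji.
  exact: leq_trans ltij jx.
apply: le_trans (schubert_ge w lpsi).
have -> : weight w S [ffun x => t (phi (t x))] =
    \sum_(x in swap_set i j S) w 0 (t (phi x)).
  by rewrite sum_swap_set; apply: eq_bigr => x _; rewrite ffunE.
set S' := swap_set i j S in inj jS' *; rewrite /weight.
rewrite -(big_imset (fun y => w 0 y) inj) -(big_imset (fun y => w 0 (t y)) inj) /=.
set T := phi @: S'; have jT : j \in T by rewrite -pj imset_f.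
have [iT|iT] := boolP (i \in T).
  rewrite le_eqVlt; apply/orP; left; rewrite -sum_swap_set; apply/eqP/eq_bigl => x.
  by rewrite mem_swap_set; case: (tpermP i j x) => [->|->|]; rewrite ?iT ?jT.
rewrite (big_setD1 j jT) [leRHS](big_setD1 j jT) /= tj lerD //.
apply: ler_sum => x; rewrite !inE => /andP[xj xT]; rewrite tN //.
by apply: contraNneq iT => <-.
Qed.

Lemma ascent_set S : S :&: [set i; j] <> [set j] ->
  swap_set i j S = S \/ (i \in S /\ j \notin S).
Proof.
move=> asc; have [iS|iS] := boolP (i \in S); have [jS|jS] := boolP (j \in S).
- left; apply/setP => x; rewrite mem_swap_set.
  by case: (tpermP i j x) => [->|->|]; rewrite ?iS ?jS.
- by right.
- case: asc; apply/setP => x; rewrite !inE.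
  have [->|xi] := eqVneq x i; first by rewrite (negPf iS) (negPf ij).
  by have [->|xj] := eqVneq x j; rewrite ?jS ?andbF.
- left; apply/setP => x; rewrite mem_swap_set.
  by case: (tpermP i j x) => [->|->|]; rewrite ?(negPf iS) ?(negPf jS).
Qed.

Lemma schubert_swap w S : S :&: [set i; j] <> [set j] -> w 0 j <= w 0 i ->
  schubert w (swap_set i j S) = schubert w S.
Proof.
move=> /ascent_set[->//|[iS jS]] wij.
by apply/eqP; rewrite eq_le schubert_swap_ge // schubert_swap_le.
Qed.

Lemma schubitope_swap_diagram w D : schubitope w (swap_diagram i j D) =
  \sum_S (D S)%:R * schubert w (swap_set i j S).
Proof.
rewrite /schubitope (reindex_inj (inv_inj swap_setK)) /=.
by apply: eq_bigr => S _; rewrite ffunE swap_setK.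
Qed.

(** After the swap, no set of the diagram contains [i] without [j], so [schubert_swapv] applies to
    each of them. *)
Lemma schubitope_swapv w D : has_ascent D i j ->
  schubitope (swapv w) (swap_diagram i j D) = schubitope w (swap_diagram i j D).
Proof.
move=> asc; rewrite !schubitope_swap_diagram; apply: eq_bigr => S _.
have [->|/asc DS] := eqVneq (D S) 0%N; first by rewrite !mul0r.
rewrite schubert_swapv // !mem_swap_set ti tj negb_and negbK.
case: (ascent_set DS) => [E|[-> ->]]; last by [].
by rewrite -{1}E mem_swap_set tj orNb.
Qed.

Lemma schubitope_swap w D : has_ascent D i j -> w 0 j <= w 0 i ->
  schubitope w (swap_diagram i j D) = schubitope w D.
Proof.
move=> asc wij; rewrite schubitope_swap_diagram; apply: eq_bigr => S _.
have [->|/asc DS] := eqVneq (D S) 0%N; first by rewrite !mul0r.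
by rewrite schubert_swap.
Qed.

Lemma schubitope_swapv_le w D : has_ascent D i j -> w 0 j <= w 0 i ->
  schubitope (swapv w) D <= schubitope w D.
Proof.
move=> asc wij; rewrite -[leRHS]schubitope_swap // -[leRHS]schubitope_swapv //.
rewrite schubitope_swap_diagram; apply: ler_sum => S _.
have [->|/asc/ascent_set[->//|[iS jS]]] := eqVneq (D S) 0%N.
  by rewrite !mul0r.
by rewrite ler_wpM2l // schubert_swap_ge.
Qed.

End Swap.
End Schubert.

(** * The polytope of a diagram and its iterated raising *)

Section SchubitopePolytope.
Variables (R : realType) (n : nat).
Implicit Types (w v u : 'rV[R]_n) (S T U : {set 'I_n}) (D : diagram n).

Definition choice_of_lowerings := {ffun {set 'I_n} -> {ffun 'I_n -> 'I_n}}.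
Implicit Types Phi : choice_of_lowerings.

Definition lowered_point D Phi : 'rV[R]_n :=
  \sum_S (D S)%:R *: \sum_(x in S) delta_mx 0 (Phi S x).

Definition lowered_points D : seq 'rV[R]_n :=
  [seq lowered_point D Phi |
    Phi <- enum [pred Phi : choice_of_lowerings | [forall S, lowering S (Phi S)]]].

Lemma dot_lowered_point w D Phi :
  dot w (lowered_point D Phi) = \sum_S (D S)%:R * weight w S (Phi S).
Proof.
rewrite dot_sumr; apply: eq_bigr => S _; rewrite dotZr dot_sumr; congr (_ * _).
by apply: eq_bigr => x _; rewrite dotC dot_delta.
Qed.

Lemma lowered_points_le w D a : a \in lowered_points D -> dot w a <= schubitope w D.
Proof.
case/mapP => Phi; rewrite mem_enum inE => /forallP l ->; rewrite dot_lowered_point.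
by apply: ler_sum => S _; rewrite ler_wpM2l // schubert_ge.
Qed.

Lemma lowered_points_max w D :
  exists2 a, a \in lowered_points D & dot w a = schubitope w D.
Proof.
exists (lowered_point D [ffun S => top_lowering w S]).
  apply: map_f; rewrite mem_enum inE; apply/forallP => S; rewrite ffunE.
  exact: top_loweringP.
by rewrite dot_lowered_point; apply: eq_bigr => S _; rewrite ffunE.
Qed.

Lemma hull_lowered_points_le w D x :
  hull (lowered_points D) x -> dot w x <= schubitope w D.
Proof. by apply: hull_dot_le => a; apply: lowered_points_le. Qed.

Lemma submod_lowered_points D S :
  submod (hull (lowered_points D)) S = schubitope (ind R S) D.
Proof.
apply: submodE; first by move=> x; apply: hull_lowered_points_le.
by have [a ap aE] := lowered_points_max (ind R S) D; exists a => //; apply: mem_hull.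
Qed.

(** A strict separation of a point from finitely many others persists under small changes of the
    functional, so functionals may be restricted to a dense set: below, rational ones, or those with
    [w_i] different from [w_j]. *)
Lemma hull_dense (s1 s2 : seq 'rV[R]_n) :
  (forall w (e : R), 0 < e ->
     exists2 w' : 'rV[R]_n, (forall k, `|w' 0 k - w 0 k| <= e)
     & forall a, a \in s1 -> exists2 b, b \in s2 & dot w' a <= dot w' b) ->
  forall a, a \in s1 -> hull s2 a.
Proof.
move=> H a as1; apply/hullP => w.
have [//|N] := pselect (exists2 b, b \in s2 & dot w a <= dot w b).
(* The factor 2 leaves half of the separating gap after the perturbation. *)
pose g (b : 'rV[R]_n) := 2 * \sum_k `|b 0 k - a 0 k|.
have [e e0 he] := @small_eps _ _ s2 (fun b => dot w a - dot w b) g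
  ltac:(by move=> b bs; rewrite subr_gt0 ltNge; apply/negP => ab; apply: N; exists b).
have [w' w'w /(_ a as1)[b bs ab]] := H w e e0.
have lt : 0 < dot w a - dot w b.
  by rewrite subr_gt0 ltNge; apply/negP => ab'; apply: N; exists b.
have := he b bs; rewrite /g.
have : dot (w' - w) (b - a) <= e * \sum_k `|b 0 k - a 0 k|.
  rewrite mulr_sumr; apply: ler_sum => k _; rewrite !mxE.
  rewrite (le_trans (ler_norm _)) // normrM ler_wpM2r //.
rewrite dotBl !dotBr; lra.
Qed.

Section Raise.
Variables (i j : 'I_n) (hij : nat_of_ord j = (nat_of_ord i).+1).
Variables (D : diagram n) (asc : has_ascent D i j).
Let D' := swap_diagram i j D.
Let ell := num_raises D i j.
Let ij : i != j. Proof. by rewrite -val_eqE /= hij neq_ltn leqnn. Qed.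

Lemma swapv_ind S : swapv i j (ind R S) = ind R (swap_set i j S).
Proof. by apply/rowP => k; rewrite !mxE mem_swap_set. Qed.

Lemma swap_setU1 U : i \notin U -> j \notin U -> swap_set i j (i |: U) = j |: U.
Proof.
move=> iU jU; apply/setP => x; rewrite mem_swap_set !inE.
case: (tpermP i j x) => [->|->|/eqP xi /eqP xj].
- by rewrite (negPf iU) (negPf jU) eq_sym (negPf ij).
- by rewrite !eqxx.
- by rewrite (negPf xi) (negPf xj).
Qed.

Lemma num_raisesE : ell%:R = \sum_S (D S)%:R * ((i \in S) && (j \notin S))%:R :> R.
Proof.
rewrite /ell /num_raises natr_sum big_mkcond; apply: eq_bigr => S _.
by case: ifP; rewrite ?mulr1 ?mulr0.
Qed.

Lemma schubert_indU U S : i \notin U -> j \notin U ->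
  ~~ ((i \in S) && (j \notin S)) ->
  schubert (ind R (i |: U)) S = schubert (ind R (j |: U)) S.
Proof.
by move=> iU jU N; rewrite -(schubert_swapv hij) // swapv_ind swap_setU1.
Qed.

(** A set containing [i] but not [j] contributes at most 1, since a lowering hits [i] at most once;
    for every other set the two values agree by symmetry. *)
Lemma schubitope_indU_le U : i \notin U -> j \notin U ->
  schubitope (ind R (i |: U)) D <= schubitope (ind R (j |: U)) D + ell%:R.
Proof.
move=> iU jU; rewrite num_raisesE -big_split; apply: ler_sum => S _ /=.
rewrite -mulrDr; have [->|DS] := eqVneq (D S) 0%N; first by rewrite !mul0r.
rewrite ler_wpM2l //; have [iS|N] := boolP ((i \in S) && (j \notin S)); last first.
  by rewrite schubert_indU // addr0.
apply: schubert_le => phi lphi; rewrite -lerBlDr.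
apply: le_trans (schubert_ge _ lphi); rewrite lerBlDr.
have [inj _] := loweringP _ _ lphi; rewrite /weight.
rewrite -(big_imset (fun y => ind R (i |: U) 0 y) inj).
rewrite -(big_imset (fun y => ind R (j |: U) 0 y) inj) /=; set T := phi @: S.
apply: (@le_trans _ _ (\sum_(y in T) (ind R (j |: U) 0 y + (y == i)%:R))).
  apply: ler_sum => y _; rewrite !mxE !inE.
  by case: eqVneq => [->|_] /=; case: (_ \in U) => //=;
    rewrite ?orbT ?orbF ?lerDr ?lerDl ?addr0 ?ler0n.
rewrite big_split lerD2l; have [iT|iT] := boolP (i \in T).
  rewrite (big_setD1 i iT) /= eqxx big1 ?addr0 // => y; rewrite !inE.
  by case/andP => /negPf->.
by rewrite big1 // => y yT; case: eqVneq yT => // ->; rewrite (negPf iT).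
Qed.

(** This gives [raise_const] its initial value [ell - 1]. On the final segment starting at [j]
    lowering never helps, so the identity is optimal; trading [j] for [i] in the indicator gains
    exactly 1 on every set with [i] and without [j]. *)
Lemma schubitope_ind_final :
  schubitope (ind R (~: swap_set i j (initial i))) D =
  schubitope (ind R (~: initial i)) D + ell%:R.
Proof.
pose U : {set 'I_n} := [set k : 'I_n | (j < k)%N].
have iU : i \notin U by rewrite inE hij ltnNge leqnSn.
have jU : j \notin U by rewrite inE ltnn.
have fE : ~: initial i = j |: U.
  apply/setP => k; rewrite !inE -ltnNge -val_eqE /= hij.
  by rewrite [(i < k)%N]leq_eqVlt eq_sym.
have fE' : ~: swap_set i j (initial i) = i |: U.
  rewrite -[RHS](swap_setK i j) swap_setU1 // -fE.
  by apply/setP => k; rewrite mem_swap_set !in_setC mem_swap_set.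
clearbody U; apply/eqP; rewrite eq_le fE' fE schubitope_indU_le //=.
rewrite num_raisesE -big_split; apply: ler_sum => S _ /=.
rewrite -mulrDr; have [->|DS] := eqVneq (D S) 0%N; first by rewrite !mul0r.
rewrite ler_wpM2l //; have [iS|N] := boolP ((i \in S) && (j \notin S)); last first.
  by rewrite schubert_indU // addr0.
case/andP: iS => iS jS; rewrite -lerBrDr; apply: schubert_le => phi.
case/loweringP => inj le; rewrite lerBrDr.
apply: le_trans (schubert_ge _ (lowering_id S)).
apply: (@le_trans _ _ (\sum_(x in S) ind R (j |: U) 0 x + 1)).
  rewrite lerD2r; apply: ler_sum => x xS; rewrite -fE !mxE !inE -!ltnNge ler_nat.
  by case: (ltnP i (phi x)) => // ix; rewrite (leq_trans ix (le x xS)).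
rewrite /weight (big_setD1 i iS) [leRHS](big_setD1 i iS) /= !ffunE !mxE !inE.
rewrite eqxx (negPf ij) (negPf iU) /= add0r [leRHS]addrC lerD2r.
apply: ler_sum => x; rewrite !inE => /andP[xi xS]; rewrite ffunE !mxE !inE.
by rewrite (negPf xi) /=; case: eqVneq xS => // ->; rewrite (negPf jS).
Qed.

Let mu0 := fun S => schubitope (ind R S) D.

Lemma iter_raise_submod k S : iter k (raise_submod i j) mu0 S =
  if (i \notin S) && (j \in S)
  then Num.max (mu0 S) (mu0 (i |: (S :\ j)) - ell%:R + k%:R) else mu0 S.
Proof.
elim: k S => [|k IH] S.
  rewrite /=; case: ifP => // /andP[iS jS]; rewrite addr0; apply/esym/max_idPl.
  have iS' : i \notin S :\ j by rewrite !inE (negPf iS) andbF.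
  have jS' : j \notin S :\ j by rewrite !inE eqxx.
  by rewrite lerBlDr -{2}(setD1K jS) schubitope_indU_le.
rewrite iterS {1}/raise_submod; case: ifP => [/andP[iS jS]|N]; last by rewrite IH N.
have fE : i \in ~: swap_set i j (initial i).
  by rewrite inE mem_swap_set tpermL inE hij -ltnNge.
have fE' : i \notin ~: initial i by rewrite !inE leqnn.
have jf : j \in ~: initial i by rewrite !inE hij -ltnNge.
have gE : i |: ((~: initial i) :\ j) = ~: swap_set i j (initial i).
  apply/setP => k'; rewrite !inE mem_swap_set inE.
  case: (tpermP i j k') => [->|->|/eqP ki /eqP kj].
  - by rewrite eqxx hij ltnn.
  - by rewrite eqxx leqnn (eq_sym j) (negPf ij).
  - by rewrite (negPf ki) kj.
(* The first set in the constant contains [i] and keeps its value, while that of the second has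
   grown by [k]; hence the constant drops by one at each step. *)
have cE : raise_const i j (iter k (raise_submod i j) mu0) = ell%:R - k%:R - 1.
  rewrite /raise_const !IH fE fE' jf /= gE /mu0 schubitope_ind_final.
  rewrite max_r; first by ring.
  by rewrite addrK lerDl.
rewrite cE !IH iS jS setU11 /= -maxA; congr Num.max.
rewrite max_r; first by rewrite -natr1; ring.
lra.
Qed.

End Raise.

End SchubitopePolytope.

(** * Raising the polytope to that of the swapped diagram *)

Section RaiseSchubitope.
Variables (R : realType) (n : nat) (i j : 'I_n).
Hypothesis hij : nat_of_ord j = (nat_of_ord i).+1.
Implicit Types (w : 'rV[R]_n) (S : {set 'I_n}) (nu : {set 'I_n} -> R).

(** The default of [xget] is avoided because the greedy hull of the raised function is a witness,
    and uniqueness is [gen_perm_greedy_hull]. *)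
Lemma raise_greedy_hull nu : MV_function nu ->
  raise i j (greedy_hull nu) = greedy_hull (raise_submod i j nu).
Proof.
move=> hnu; have hr := raise_MV_function hij hnu.
have subE : submod (greedy_hull nu) = nu.
  by apply/funext => S; apply: submod_MV_function.
have ex : exists Q, [set Q | is_MV Q /\
    forall S, submod Q S = raise_submod i j (submod (greedy_hull nu)) S]%classic Q.
  exists (greedy_hull (raise_submod i j nu)); split; first exact: is_MV_greedy_hull.
  by move=> S; rewrite subE; apply: submod_MV_function.
have [MVQ Qsub] := xgetPex classical_sets.set0 ex.
have [gQ _ _] := MVQ; rewrite /raise (gen_perm_greedy_hull gQ); congr greedy_hull.
by apply/funext => S; rewrite Qsub subE.
Qed.

Lemma iter_raise_greedy_hull k nu : MV_function nu ->
  iter k (raise i j) (greedy_hull nu) = greedy_hull (iter k (raise_submod i j) nu).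
Proof.
move=> hnu; suff [] : MV_function (iter k (raise_submod i j) nu) /\
    iter k (raise i j) (greedy_hull nu) = greedy_hull (iter k (raise_submod i j) nu).
  by [].
elim: k => [//|k [hk E]]; split; first exact: raise_MV_function.
by rewrite iterS E raise_greedy_hull.
Qed.

(** Ties are broken by the natural order, so every prefix containing [j] contains [i]. *)
Lemma exists_desc_before w : w 0 j <= w 0 i ->
  exists s, [/\ enumerates s, sorted (desc w) s & (index i s < index j s)%N].
Proof.
move=> wij; pose r := [rel a b : 'I_n | (w 0 b < w 0 a) ||
  (w 0 b == w 0 a) && (a <= b)%N].
have rtot : total r by move=> a b /=; case: ltgtP => //= _; exact: leq_total.
have rtrans : transitive r.
  move=> b a c /= /orP[ba|/andP[/eqP-> ab]] /orP[cb|/andP[/eqP-> bc]].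
  - by rewrite (lt_trans cb ba).
  - by rewrite ba.
  - by rewrite cb.
  - by rewrite eqxx (leq_trans ab bc) orbT.
have es : enumerates (sort r (enum 'I_n)) by rewrite /enumerates perm_sort.
have ss := sort_sorted rtot (enum 'I_n).
exists (sort r (enum 'I_n)); split=> //.
  by apply: sub_sorted ss => a b /= /orP[/ltW//|/andP[/eqP-> _]].
have [//|ji|ijE] := ltngtP.
  have := sorted_ltn_index rtrans ss; move=> /(_ j i).
  rewrite !mem_enumerates // => /(_ isT isT ji) /=.
  by rewrite ltNge wij /= hij ltnn andbF.
have := congr1 (nth i (sort r (enum 'I_n))) ijE.
by rewrite !nth_index ?mem_enumerates // => e; move: hij; rewrite -e; lia.
Qed.

Lemma greedy_map (t : {perm 'I_n}) nu s a : enumerates s ->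
  greedy nu (map t s) 0 (t a) = greedy (fun S => nu (t @: S)) s 0 a.
Proof.
move=> es; have psE k : prefix_set (map t s) k = t @: prefix_set s k.
  apply/setP => b; rewrite inE -map_take; apply/mapP/imsetP => -[c cs ->];
    by exists c; rewrite // inE in cs *.
by rewrite !mxE !psE index_map //; apply: perm_inj.
Qed.

Lemma hull_greedy_eq (pts : seq 'rV[R]_n) nu h : nu set0 = 0 -> submodular nu ->
  (forall w a, a \in pts -> dot w a <= h w) ->
  (forall w, exists2 a, a \in pts & dot w a = h w) ->
  (forall w, exists s, [/\ enumerates s, sorted (desc w) s
     & h w = dot w (greedy nu s)]) ->
  hull pts = greedy_hull nu.
Proof.
move=> nu0 sm hle hex hs; apply/seteqP; split.
  apply: sub_hull => a ap; apply/hullP => w; have [s [es _ hE]] := hs w.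
  exists (greedy nu s); last by rewrite -hE hle.
  by apply: map_f; rewrite mem_permutations.
apply: sub_hull => a /mapP[s0]; rewrite mem_permutations => es0 ->.
apply/hullP => w; have [s [es ss hE]] := hs w; have [a' ap' aE] := hex w.
by exists a' => //; rewrite aE hE dot_greedy_max //; apply: greedy_in_hull.
Qed.

Theorem raise_lowered_points (D : diagram n) : has_ascent D i j ->
  is_MV (hull (lowered_points R D)) ->
  iter (num_raises D i j) (raise i j) (hull (lowered_points R D)) =
  hull (lowered_points R (swap_diagram i j D)).
Proof.
move=> asc hMV; set P := hull _; set D' := swap_diagram i j D.
pose mu := fun S => schubitope (ind R S) D.
have muE : submod P = mu by apply/funext => S; apply: submod_lowered_points.
have hmu : MV_function mu by rewrite -muE; apply: is_MV_submod.
have [gP _ _] := hMV; have PE : P = greedy_hull mu.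
  by rewrite -muE; apply: gen_perm_greedy_hull.
rewrite PE iter_raise_greedy_hull //; set nu := iter _ _ _.
have hnu : MV_function nu.
  by rewrite /nu; elim: (num_raises _ _ _) => // k; apply: raise_MV_function.
have nuE0 S : (j \in S -> i \in S) -> nu S = mu S.
  rewrite /nu iter_raise_submod // => h.
  by case: ifP => // /andP[iS jS]; rewrite h in iS.
have nuE S : nu S = schubitope (ind R S) D'.
  have [/andP[iS jS]|N] := boolP ((i \notin S) && (j \in S)); last first.
    have h : j \in S -> i \in S by move=> jS; move: N; rewrite jS andbT negbK.
    rewrite nuE0 // schubitope_swap // !mxE ler_nat.
    by case: (j \in S) h => // /(_ isT)->.
  (* At [k = ell] the shift vanishes, and the maximum is the value at the swapped set by
     [schubitope_swapv_le]. *)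
  rewrite /nu iter_raise_submod // iS jS subrK.
  have iS' : i \notin S :\ j by rewrite !inE (negPf iS) andbF.
  have jS' : j \notin S :\ j by rewrite !inE eqxx.
  have wE : ind R S = swapv i j (ind R (i |: S :\ j)).
    by rewrite swapv_ind (swap_setU1 hij) // setD1K.
  have le1 : ind R (i |: S :\ j) 0 j <= ind R (i |: S :\ j) 0 i.
    by rewrite !mxE setU11 ler_nat; case: (j \in _).
  rewrite wE schubitope_swapv // schubitope_swap // max_r //.
  exact: schubitope_swapv_le.
have [mu0 musm _ _] := hmu; have [nu0 nusm _ _] := hnu; symmetry.
have key w : w 0 j <= w 0 i -> exists s, [/\ enumerates s, sorted (desc w) s
    & schubitope w D' = dot w (greedy nu s)].
  move=> wij; have [s [es ss sij]] := exists_desc_before wij; exists s; split=> //.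
  have -> : greedy nu s = greedy mu s.
    have psE k : nu (prefix_set s k) = mu (prefix_set s k).
      apply: nuE0; rewrite !inE !in_take ?mem_enumerates //.
      exact: (ltn_trans sij).
    by apply/rowP => a; rewrite !mxE !psE.
  rewrite schubitope_swap //; apply/eqP; rewrite eq_le; apply/andP; split.
    have [a ap <-] := lowered_points_max w D.
    by apply: dot_greedy_max; rewrite // -PE; apply: mem_hull.
  by apply: hull_lowered_points_le; rewrite -/P PE; apply: greedy_in_hull.
apply: (hull_greedy_eq (h := fun w => schubitope w D')) => // [w a|w|w].
- exact: lowered_points_le.
- exact: lowered_points_max.
(* Otherwise exchange the two coordinates of [w]: [nu] and the support function of [D'] are both
   invariant. *)
have [wij|/ltW wji] := leP (w 0 j) (w 0 i); first exact: key.
have [|s [es ss sE]] := key (swapv i j w); first by rewrite !mxE tpermL tpermR.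
have tsE : enumerates (map (tperm i j) s).
  apply: enumeratesP => [|a]; first by rewrite map_inj_uniq ?enumerates_uniq //; apply: perm_inj.
  by rewrite -(tpermK i j a) map_f // mem_enumerates.
exists (map (tperm i j) s); split=> //.
  rewrite sorted_map; apply: sub_sorted ss => a b /=.
  by rewrite !mxE.
rewrite -(schubitope_swapv hij) // sE /dot (reindex_inj (@perm_inj _ (tperm i j))) /=.
apply: eq_bigr => a _; rewrite mxE tpermK; congr (_ * _).
rewrite -[in RHS](tpermK i j a) greedy_map //.
congr (greedy _ _ _ _); apply/funext => S.
by rewrite !nuE -[tperm i j @: S]/(swap_set i j S) -swapv_ind schubitope_swapv.
Qed.

End RaiseSchubitope.

(** * Characters of a torus *)

Section TorusCharacters.

(** In the factorisation of [P] into [col_base] and [row_base], idempotency cancels to the identity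
    for the product in the opposite order. *)
Lemma trace_idempotent (F : fieldType) d (P : 'M[F]_d) :
  P *m P = P -> \tr P = (\rank P)%:R.
Proof.
move=> PP; rewrite -{1}(mulmx_base P) mxtrace_mulC.
have E : col_base P *m row_base P *m (col_base P *m row_base P) =
    col_base P *m row_base P by rewrite mulmx_base.
suff -> : row_base P *m col_base P = 1%:M by rewrite mxtrace1.
apply: (row_full_inj (col_base_full P)); apply: (row_free_inj (row_base_free P)).
by rewrite /= mulmx1 -[RHS]E !mulmxA.
Qed.

Lemma primitive_root_exists (C : numClosedFieldType) N : (0 < N)%N ->
  exists z : C, N.-primitive_root z.
Proof.
move=> N0; have [r rE] := closed_field_poly_normal ('X^N - 1 : {poly C}).
rewrite (monicP (monicXnsubC _ N0)) scale1r in rE.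
have un : uniq r.
  by rewrite -separable_prod_XsubC -rE separable_Xn_sub_1 // pnatr_eq0 -lt0n.
have ur : all N.-unity_root r.
  by apply/allP => z zr; rewrite /root_of_unity rE root_prod_XsubC.
have sr : (N <= size r)%N.
  by rewrite -ltnS -(size_prod_XsubC r id) -rE size_XnsubC.
by have /hasP[z _ hz] := cyclic.has_prim_root N0 ur un sr; exists z.
Qed.

Lemma sum_digits_lt n b (f : 'I_n -> nat) : (forall k, f k < b)%N ->
  (\sum_k f k * b ^ k < b ^ n)%N.
Proof.
elim: n f => [|n IH] f hf; first by rewrite big_ord0 expn0.
rewrite big_ord_recr /= expnS.
have := IH (fun k => f (widen_ord (leqnSn n) k)) (fun k => hf _).
have := hf ord_max; move: (\sum_(_ < _) _)%N (f _) (b ^ n)%N => s x B; nia.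
Qed.

Lemma sum_digits_inj n b (f g : 'I_n -> nat) :
  (forall k, f k < b)%N -> (forall k, g k < b)%N ->
  (\sum_k f k * b ^ k = \sum_k g k * b ^ k)%N -> f =1 g.
Proof.
elim: n f g => [|n IH] f g hf hg; first by move=> _ [].
rewrite !big_ord_recr /=.
have hf' := sum_digits_lt (f := fun k => f (widen_ord (leqnSn n) k)) (fun k => hf _).
have hg' := sum_digits_lt (f := fun k => g (widen_ord (leqnSn n) k)) (fun k => hg _).
move=> E; have Emax : f ord_max = g ord_max.
  by move: hf' hg' E; move: (\sum_(_ < _) _)%N (\sum_(_ < _) _)%N (f _) (g _) (b ^ n)%N
    => s s' x y B; nia.
move: E; rewrite Emax => /addIn /IH h k; have [l ->|->//] := unliftP ord_max k.
have -> : lift ord_max l = widen_ord (leqnSn n) l by apply/val_inj/lift_max.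
exact: h.
Qed.

Section Projector.
Variables (C : numClosedFieldType) (n : nat) (chi : {mpoly C[n]}) (d : nat).
Variable A : 'rV[C]_n -> 'M[C]_d.
Hypotheses (trA : forall x : 'rV[C]_n, (forall k, x 0 k != 0) ->
    chi.@[fun k => x 0 k] = \tr (A x))
  (A1 : A (const_mx 1) = 1%:M)
  (AM : forall x y : 'rV[C]_n, (forall k, x 0 k != 0) -> (forall k, y 0 k != 0) ->
    A (\row_k (x 0 k * y 0 k)) = A x *m A y).

(* With w_k = b^k and N = b^n every exponent vector has its own residue, so    *)
(* averaging over the N-th roots of unity isolates one coefficient of chi.     *)
Lemma weight_projector (m0 : 'X_{1..n}) : exists P : 'M[C]_d,
  [/\ P *m P = P, chi@_m0 = \tr P
    & forall c : 'rV[C]_d,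
       (forall x : 'rV[C]_n, (forall k, x 0 k != 0) ->
          c *m A x = (\prod_k x 0 k ^+ m0 k) *: c) -> c *m P = c].
Proof.
pose b := (\max_(m <- m0 :: msupp chi) \max_k m k).+1.
have mb m k : m \in m0 :: msupp chi -> (m k < b)%N.
  move=> ms; rewrite ltnS (leq_trans _ (leq_bigmax_seq (F := fun m : 'X_{1..n} => \max_k m k) m ms isT)) //.
  exact: (leq_bigmax (F := fun k => m k)).
pose N := (b ^ n)%N; have N0 : (0 < N)%N by rewrite expn_gt0.
have [z zN] := primitive_root_exists C N0.
have z0 : z != 0 by rewrite (prim_root_eq0 zN) -lt0n.
pose dig (m : 'X_{1..n}) := (\sum_k m k * b ^ k)%N.
pose x l : 'rV[C]_n := \row_k z ^+ (b ^ k * l).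
have x0 l k : x l 0 k != 0 by rewrite mxE expf_neq0.
have AX l : A (x 1%N) ^+ l = A (x l).
  elim: l => [|l IH].
    rewrite expr0 (_ : x 0%N = const_mx 1) ?A1 //.
    by apply/rowP => k; rewrite !mxE muln0.
  rewrite exprS IH -[_ * _]/(_ *m _) -AM //; congr A; apply/rowP => k.
  by rewrite !mxE -exprD -mulnDr add1n.
have mx l (m : 'X_{1..n}) : \prod_k x l 0 k ^+ m k = z ^+ (l * dig m).
  rewrite (eq_bigr (fun k : 'I_n => z ^+ (b ^ k * l * m k))) => [|k _].
    by rewrite prodrXr; congr (_ ^+ _); rewrite big_distrr; apply: eq_bigr => k _ /=; rewrite mulnAC mulnC [(_ * b ^ k)%N]mulnC.
  by rewrite mxE -exprM.
pose r := z ^+ dig m0; have r0 : r != 0 by rewrite expf_neq0.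
pose Y := r^-1 *: A (x 1%N).
have YX l : Y ^+ l = (r^-1 ^+ l) *: A (x l).
  rewrite -AX; elim: l => [|l IH]; first by rewrite !expr0 scale1r.
  rewrite exprS IH -[_ * _]/(_ *m _) /Y -scalemxAl -scalemxAr scalerA -exprS.
  by congr (_ *: _); rewrite exprS.
have YN : Y ^+ N = 1.
  rewrite YX exprVn /r -exprM mulnC exprM (prim_expr_order zN) expr1n invr1 scale1r.
  rewrite (_ : x N = const_mx 1) ?A1 //; apply/rowP => k; rewrite !mxE.
  by rewrite mulnC exprM (prim_expr_order zN) expr1n.
pose P := N%:R^-1 *: \sum_(l < N) Y ^+ l.
have NR : N%:R != 0 :> C by rewrite pnatr_eq0 -lt0n.
have YP : Y *m P = P.
  rewrite /P -scalemxAr; congr (_ *: _); rewrite mulmx_sumr.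
  move: YN N0; case: (N) => // M YM _.
  rewrite big_ord_recr [RHS]big_ord_recl /= -[Y *m Y ^+ M]/(Y * Y ^+ M) -exprS YM.
  by rewrite expr0 addrC; congr (_ + _); apply: eq_bigr => l _; rewrite exprS.
have YlP l : Y ^+ l *m P = P.
  elim: l => [|l IH]; first by rewrite expr0 mul1mx.
  by rewrite exprS -[_ * _]/(_ *m _) -mulmxA IH YP.
exists P; split.
- rewrite {1}/P -scalemxAl mulmx_suml (eq_bigr (fun=> P)) => [|l _]; last exact: YlP.
  by rewrite sumr_const card_ord -scaler_nat scalerA mulVf // scale1r.
- have trE l : \tr (Y ^+ l) = \sum_(m <- msupp chi) chi@_m * (z ^+ dig m / r) ^+ l.
    rewrite YX mxtraceZ -trA // mevalE mulr_sumr; apply: eq_bigr => m _.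
    by rewrite mx mulrCA exprMn mulnC exprM [r^-1 ^+ l * _]mulrC.
  rewrite /P mxtraceZ raddf_sum /= (eq_bigr _ (fun (l : 'I_N) _ => trE l)) exchange_big /=.
  rewrite {1}[chi]mpolyE raddf_sum /= mulr_sumr [LHS]big_seq [RHS]big_seq.
  apply: eq_bigr => m ms; rewrite mcoeffZ mcoeffX -mulr_sumr mulrCA; congr (_ * _).
  have [->|mm0] := eqVneq m m0.
    rewrite (eq_bigr (fun=> 1)) => [|l _]; last by rewrite divff // expr1n.
    by rewrite sumr_const card_ord mulVf.
  set xi := z ^+ dig m / r.
  have xi1 : xi != 1.
    apply: contra_neq mm0 => xi1; have : z ^+ dig m == z ^+ dig m0.
      by rewrite -[z ^+ dig m](divfK r0) -/xi xi1 mul1r.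
    rewrite (eq_prim_root_expr zN) !modn_small ?sum_digits_lt // => [/eqP E|k|k].
    - apply/mnmP; apply: (@sum_digits_inj n b) E => k; apply: mb;
        by rewrite ?mem_head // inE ms orbT.
    - by apply: mb; rewrite mem_head.
    - by apply: mb; rewrite inE ms orbT.
  have xiN : xi ^+ N = 1.
    rewrite exprMn exprVn -!exprM ![(_ * N)%N]mulnC !exprM (prim_expr_order zN).
    by rewrite !expr1n invr1 mulr1.
  apply/esym/eqP; rewrite mulf_eq0; apply/orP; right.
  have := subrX1 xi N; rewrite xiN subrr => /esym/eqP.
  by rewrite mulf_eq0 subr_eq0 (negPf xi1).
- move=> c hc; have cY : c *m Y = c.
    rewrite /Y -scalemxAr hc // mx mul1n scalerA mulVf // scale1r //.
  have cYl l : c *m Y ^+ l = c.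
    elim: l => [|l IH]; first by rewrite expr0 mulmx1.
    by rewrite exprS -[_ * _]/(_ *m _) mulmxA cY IH.
  rewrite /P -scalemxAr mulmx_sumr (eq_bigr (fun=> c)) => [|l _]; last exact: cYl.
  by rewrite sumr_const card_ord -scaler_nat scalerA mulVf // scale1r.
Qed.

Lemma weight_multiplicity_ge0 m0 : 0 <= chi@_m0.
Proof.
by have [P [/trace_idempotent tP -> _]] := weight_projector m0; rewrite tP ler0n.
Qed.

Lemma weight_vector_msupp (m0 : 'X_{1..n}) (c : 'rV[C]_d) : c != 0 ->
  (forall x : 'rV[C]_n, (forall k, x 0 k != 0) ->
     c *m A x = (\prod_k x 0 k ^+ m0 k) *: c) -> m0 \in msupp chi.
Proof.
move=> c0 hc; have [P [/trace_idempotent tP E /(_ c hc) cP]] := weight_projector m0.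
rewrite mcoeff_msupp E tP pnatr_eq0 mxrank_eq0; apply: contra_neq c0 => P0.
by rewrite -cP P0 mulmx0.
Qed.

End Projector.

(** * Rational functions of one variable without pole at zero *)

Section RegularAtZero.
Variable C : numClosedFieldType.
Implicit Types (p q : {poly C}) (f g : C -> C).

Lemma poly_nonroot p : p != 0 -> exists2 u, u != 0 & p.[u] != 0.
Proof.
move=> p0; have [//|N] := pselect (exists2 u, u != 0 & p.[u] != 0).
have rt u : u != 0 -> root p u.
  by move=> u0; apply/negPn/negP => pu; apply: N; exists u.
have := @max_poly_roots _ p [seq k.+1%:R | k <- iota 0 (size p)] p0.
rewrite size_map size_iota ltnn => h; suff : false by []; apply: h.
  by apply/allP => _ /mapP[k _ ->]; apply: rt; rewrite pnatr_eq0.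
rewrite map_inj_uniq ?iota_uniq // => k l /eqP.
by rewrite eqr_nat eqSS => /eqP.
Qed.

Lemma poly_eq0_punctured p : (forall u, u != 0 -> p.[u] = 0) -> p = 0.
Proof.
move=> h; apply/eqP/negPn/negP => /poly_nonroot[u /h ->].
by rewrite eqxx.
Qed.

(** The value of [f] at 0 is left free: only the rational function that it represents matters. *)
Definition regular_at0 f := exists p q, q.[0] != 0 /\
  forall u, u != 0 -> q.[u] != 0 -> f u = p.[u] / q.[u].

Lemma regular_at0_poly p : regular_at0 (horner p).
Proof.
exists p, 1; rewrite hornerC oner_eq0; split=> // u _ _.
by rewrite hornerC divr1.
Qed.

Lemma regular_at0D f g : regular_at0 f -> regular_at0 g ->
  regular_at0 (fun u => f u + g u).
Proof.
move=> [p [q [q0 h]]] [p' [q' [q'0 h']]].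
exists (p * q' + p' * q), (q * q'); rewrite hornerM mulf_neq0 //; split=> // u u0.
rewrite hornerM mulf_eq0 negb_or => /andP[qu q'u].
by rewrite h // h' // hornerD !hornerM addf_div.
Qed.

Lemma regular_at0M f g : regular_at0 f -> regular_at0 g ->
  regular_at0 (fun u => f u * g u).
Proof.
move=> [p [q [q0 h]]] [p' [q' [q'0 h']]].
exists (p * p'), (q * q'); rewrite hornerM mulf_neq0 //; split=> // u u0.
rewrite hornerM mulf_eq0 negb_or => /andP[qu q'u].
by rewrite h // h' // hornerM mulf_div.
Qed.

Lemma eq_regular_at0 f g : (forall u, u != 0 -> f u = g u) ->
  regular_at0 f -> regular_at0 g.
Proof.
move=> fg [p [q [q0 h]]]; exists p, q; split=> // u u0 qu.
by rewrite -fg // h.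
Qed.

Lemma regular_at0_sum (I : Type) (r : seq I) (f : I -> C -> C) :
  (forall k, regular_at0 (f k)) -> regular_at0 (fun u => \sum_(k <- r) f k u).
Proof.
move=> hf; elim: r => [|k r IH].
  apply: (eq_regular_at0 _ (regular_at0_poly 0)) => u _.
  by rewrite big_nil horner0.
apply: (eq_regular_at0 _ (regular_at0D (hf k) IH)) => u _.
by rewrite big_cons.
Qed.

(** If [K] is the largest weight, [u^K] times the evaluation is a polynomial whose constant term
    sums the coefficients of weight [K]. Nonnegativity makes this sum nonzero, so [K > H] would
    leave a pole at 0. *)
Lemma regular_at0_weight_le n (chi : {mpoly C[n]}) (w : 'I_n -> nat) (H : nat) :
  (forall m, 0 <= chi@_m) ->
  regular_at0 (fun u => u ^+ H * chi.@[fun k => u ^- w k]) ->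
  forall m, m \in msupp chi -> (\sum_k w k * m k <= H)%N.
Proof.
move=> chi0 [p [q [q0 h]]].
pose wt (m : 'X_{1..n}) := (\sum_k w k * m k)%N.
pose K := (\max_(m <- msupp chi) wt m)%N.
have leK m : m \in msupp chi -> (wt m <= K)%N.
  by move=> ms; apply: (leq_bigmax_seq (F := wt) m ms isT).
move=> m ms; apply: leq_trans (leK m ms) _; rewrite leqNgt; apply/negP => HK.
pose r : {poly C} := \sum_(m <- msupp chi) chi@_m *: 'X^(K - wt m).
have rE u : u != 0 -> r.[u] = u ^+ K * chi.@[fun k => u ^- w k].
  move=> u0; rewrite mevalE mulr_sumr horner_sum [LHS]big_seq [RHS]big_seq.
  apply: eq_bigr => l ls; rewrite hornerZ hornerXn mulrCA; congr (_ * _).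
  rewrite (eq_bigr (fun k : 'I_n => u^-1 ^+ (w k * l k))) => [|k _].
    by rewrite prodrXr -/(wt l) exprB ?leK ?unitfE // exprVn.
  by rewrite -exprVn exprM.
have E : r * q - 'X^(K - H) * p = 0.
  have : q * (r * q - 'X^(K - H) * p) = 0.
    apply: poly_eq0_punctured => u u0; rewrite !(hornerM, hornerD, hornerN) hornerXn.
    have [->|qu] := eqVneq q.[u] 0; first by rewrite mul0r.
    rewrite rE // -(subnK (ltnW HK)) exprD -mulrA h // subnK ?(ltnW HK) //.
    by rewrite -mulrA divfK // subrr mulr0.
  move/eqP; rewrite mulf_eq0 => /orP[/eqP q_0|/eqP//].
  by move: q0; rewrite q_0 horner0 eqxx.
have : (r * q - 'X^(K - H) * p).[0] = 0 by rewrite E horner0.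
rewrite !(hornerM, hornerD, hornerN) hornerXn expr0n subn_eq0 leqNgt HK /=.
rewrite mul0r subr0 => /eqP; rewrite mulf_eq0 (negPf q0) orbF horner_sum.
have [m1 m1s m1K] : exists2 m, m \in msupp chi & wt m = K.
  have [/hasP[m1 ? /eqP ?]|/hasPn N] := boolP (has (fun m => wt m == K) (msupp chi)).
    by exists m1.
  have K0 : (0 < K)%N := leq_ltn_trans (leq0n H) HK.
  suff : (K <= K.-1)%N by rewrite leqNgt prednK ?leqnn.
  apply/bigmax_leqP_seq => l ls _; rewrite -ltnS prednK // ltn_neqAle leK //.
  by rewrite N.
rewrite psumr_eq0 => [/allP/(_ m1 m1s)|l _]; last first.
  by rewrite hornerZ hornerXn expr0n mulr_ge0 ?chi0 ?ler0n.
rewrite /= hornerZ hornerXn m1K subnn expr0 mulr1; apply/negP.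
by rewrite -mcoeff_msupp.
Qed.

End RegularAtZero.

End TorusCharacters.

(** * Sections over the flagged variety *)

Section FunctionAlgebra.
Variables (K : comNzRingType) (X : Type) (Q : (X -> K) -> Prop).

(** Common to polynomial functions of a parameter and polynomial functions of the matrix entries, so
    that determinants and evaluations are treated once. *)
Definition function_algebra :=
  [/\ forall c, Q (fun=> c),
      forall f g, Q f -> Q g -> Q (fun x => f x + g x)
    & forall f g, Q f -> Q g -> Q (fun x => f x * g x)].

Hypothesis hQ : function_algebra.

Lemma function_algebra_sum I (r : seq I) (f : I -> X -> K) :
  (forall k, Q (f k)) -> Q (fun x => \sum_(k <- r) f k x).
Proof.
have [Qc QD _] := hQ => hf; elim: r => [|k r IH].
  by rewrite (_ : (fun x => _) = fun=> 0) //; apply/funext => x; rewrite big_nil.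
rewrite (_ : (fun x => _) = fun x => f k x + \sum_(k <- r) f k x); first exact: QD.
by apply/funext => x; rewrite big_cons.
Qed.

Lemma function_algebra_prod I (r : seq I) (f : I -> X -> K) :
  (forall k, Q (f k)) -> Q (fun x => \prod_(k <- r) f k x).
Proof.
have [Qc _ QM] := hQ => hf; elim: r => [|k r IH].
  by rewrite (_ : (fun x => _) = fun=> 1) //; apply/funext => x; rewrite big_nil.
rewrite (_ : (fun x => _) = fun x => f k x * \prod_(k <- r) f k x); first exact: QM.
by apply/funext => x; rewrite big_cons.
Qed.

Lemma function_algebraX (f : X -> K) l : Q f -> Q (fun x => f x ^+ l).
Proof.
move=> Qf; rewrite (_ : (fun x => _) = fun x => \prod_(k <- iota 0 l) f x).
  exact: function_algebra_prod.
by apply/funext => x; rewrite big_const_seq count_predT size_iota iter_mulr mulr1.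
Qed.

Lemma function_algebra_det m (f : X -> 'M[K]_m) :
  (forall r c, Q (fun x => f x r c)) -> Q (fun x => \det (f x)).
Proof.
have [Qc _ QM] := hQ => hf; apply: function_algebra_sum => s; apply: QM => //.
exact: function_algebra_prod.
Qed.

Lemma function_algebra_meval m (v : X -> 'I_m -> K) (p : {mpoly K[m]}) :
  (forall k, Q (fun x => v x k)) -> Q (fun x => p.@[v x]).
Proof.
have [Qc _ QM] := hQ => hv.
rewrite (_ : (fun x => _) = fun x => \sum_(l <- msupp p) p@_l * \prod_k v x k ^+ l k).
  apply: function_algebra_sum => l; apply: QM => //.
  by apply: function_algebra_prod => k; apply: function_algebraX.
by apply/funext => x; rewrite mevalE.
Qed.

End FunctionAlgebra.

Definition poly_function (K : comNzRingType) (f : K -> K) :=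
  exists p : {poly K}, forall u, p.[u] = f u.

Lemma poly_function_algebra (K : comNzRingType) :
  function_algebra (@poly_function K).
Proof.
split=> [c|f g [p hp] [q hq]|f g [p hp] [q hq]].
- by exists c%:P => u; rewrite hornerC.
- by exists (p + q) => u; rewrite hornerD hp hq.
- by exists (p * q) => u; rewrite hornerM hp hq.
Qed.

(* A line through a point where finitely many functions do not vanish stays   *)
(* generic; this replaces the irreducibility of the affine space V.           *)
Lemma common_nonzero (C : numClosedFieldType) m (V : 'M[C]_m -> Prop)
    (G : seq ('M[C]_m -> C)) :
  (forall A B (t : C), V A -> V B -> V (A + t *: B)) -> V 0 ->
  (forall i, (i < size G)%N -> forall A B,
     poly_function (fun t : C => nth (fun=> 0) G i (A + t *: B))) ->
  (forall i, (i < size G)%N -> exists2 A, V A & nth (fun=> 0) G i A != 0) ->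
  exists2 A, V A & forall i, (i < size G)%N -> nth (fun=> 0) G i A != 0.
Proof.
move=> VD V0; elim: G => [|g G IH] hp hn; first by exists 0.
have [A VA hA] := IH (fun i => hp i.+1) (fun i => hn i.+1).
have [/= B VB gB] := hn 0%N isT.
have VBA : V (B - A) by rewrite -scaleN1r; apply: VD.
have /= [p gp] := hp 0%N isT A (B - A).
have p0 : p != 0.
  apply: contraNneq gB => p0; have := gp 1.
  by rewrite p0 horner0 scale1r addrC subrK => <-.
have [q q0 qP] : exists2 q : {poly C}, q != 0 & forall t, q.[t] != 0 ->
    forall i, (i < size G)%N -> nth (fun=> 0) G i (A + t *: (B - A)) != 0.
  elim: G hp hA {IH hn gp p0 p} => [|h G IH] hp hA.
    by exists 1; rewrite ?oner_eq0.
  have [||q q0 qP] := IH.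
  - case=> [|i] iG; first exact: (hp 0%N).
    exact: (hp i.+2).
  - by move=> i iG; apply: (hA i.+1).
  have [r hr] := hp 1%N isT A (B - A).
  exists (r * q).
    rewrite mulf_neq0 //; apply: contraTneq (hA 0%N isT) => r0.
    by have := hr 0; rewrite r0 horner0 scale0r addr0 /= => <-; rewrite eqxx.
  move=> t; rewrite hornerM mulf_eq0 negb_or hr => /andP[rt qt] [|i] //= iG.
  exact: qP.
have [t _ ht] := poly_nonroot (mulf_neq0 p0 q0).
move: ht; rewrite hornerM mulf_eq0 negb_or gp => /andP[gt qt].
by exists (A + t *: (B - A)) => [|[|i] iG] //=; [apply: VD|apply: qP].
Qed.

Section FlaggedVariety.
Variables (R : realType) (n : nat) (D : diagram n).
Let C : numClosedFieldType := complex R.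
Local Notation family := (mxfamily R D).
Implicit Types (M : family) (S : dsupp D).

Lemma family_eq M1 M2 : (forall S, M1 S = M2 S) -> M1 = M2.
Proof. by move=> h; apply: (@functional_extensionality_dep _ _ M1 M2 h). Qed.

Definition regular_function (F : family -> C) :=
  exists p : entry_poly R D, forall M, evalp p M = F M.

Lemma regular_function_algebra : function_algebra regular_function.
Proof.
split=> [c|f g [p hp] [q hq]|f g [p hp] [q hq]].
- by exists c%:MP => M; rewrite /evalp mevalC.
- by exists (p + q) => M; rewrite -hp -hq /evalp mevalD.
- by exists (p * q) => M; rewrite -hp -hq /evalp mevalM.
Qed.

Lemma regular_function_entry S r c : regular_function (fun M => M S r c).
Proof.
pose e : entry D := existT _ S (r, c).
by exists ('X_(enum_rank e)) => M; rewrite /evalp mevalXU /entry_val enum_rankK.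
Qed.

Lemma function_algebra_evalp X (Q : (X -> C) -> Prop) (T : X -> family) p :
  function_algebra Q -> (forall S r c, Q (fun x => T x S r c)) ->
  Q (fun x => evalp p (T x)).
Proof. by move=> hQ hT; apply: function_algebra_meval => // k; apply: hT. Qed.

Lemma regular_function_comp (T : family -> family) F :
  (forall S r c, regular_function (fun M => T M S r c)) ->
  regular_function F -> regular_function (fun M => F (T M)).
Proof.
move=> hT [p hp].
have := function_algebra_evalp p regular_function_algebra hT.
by rewrite (_ : (fun M => _) = fun M => F (T M)) //; apply/funext => M; rewrite hp.
Qed.

Lemma FDB_vanish M F : FDB M -> regular_function F ->
  (forall M', borel_orbit M' -> F M' = 0) -> F M = 0.
Proof.
move=> [_ hM] [p hp] hF; rewrite -hp; apply: hM => M' /hF <-; exact: hp.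
Qed.

Lemma FDBI M : is_frame M ->
  (forall F, regular_function F -> (forall M', borel_orbit M' -> F M' = 0) -> F M = 0) ->
  FDB M.
Proof. by move=> fM h; split=> // p; apply: h; exists p. Qed.

Lemma row_full_mul m k (b : 'M[C]_m) (A : 'M[C]_(m, k)) (g : 'M[C]_k) :
  b \in unitmx -> g \in unitmx -> row_full A -> row_full (b *m A *m g).
Proof.
move=> bu gu /row_fullP[B BA]; apply/row_fullP; exists (invmx g *m B *m invmx b).
rewrite !mulmxA -[_ *m invmx b *m b]mulmxA mulVmx // mulmx1.
by rewrite -[invmx g *m B *m A]mulmxA BA mulmx1 mulVmx.
Qed.

Lemma is_frame_translate b M : b \in unitmx -> is_frame M -> is_frame (translate b M).
Proof.
by move=> bu fM S; have := row_full_mul bu (unitmx1 _ _) (fM S); rewrite mulmx1.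
Qed.

Lemma is_frame_reframe M g : (forall S, g S \in unitmx) -> is_frame M ->
  is_frame (reframe M g).
Proof.
by move=> gu fM S; have := row_full_mul (unitmx1 _ _) (gu S) (fM S); rewrite mul1mx.
Qed.

Lemma is_frame_coord : is_frame (@coord_frame R n D).
Proof.
move=> S; apply/row_fullP; exists (@coord_frame R n D S)^T; apply/matrixP => r c.
rewrite !mxE (bigD1 (enum_val c)) //= !mxE eqxx mulr1 big1 ?addr0 => [|k kc].
  by rewrite (inj_eq enum_val_inj) eq_sym.
by rewrite !mxE (negPf kc) mulr0.
Qed.

Lemma FDB_orbit M : borel_orbit M -> FDB M.
Proof.
move=> hM; apply: FDBI => [|F _ h]; last exact: h.
have [b [g [[_ bu] gu ->]]] := hM.
apply: is_frame_reframe => //; apply: is_frame_translate => //.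
exact: is_frame_coord.
Qed.

Lemma borel_diag (x : 'rV[C]_n) b : (forall k, x 0 k != 0) -> borel b ->
  borel (diag_mx x *m b).
Proof.
move=> x0 [/is_trig_mxP bt bu]; split.
  apply/is_trig_mxP => r c rc; rewrite mxE mul_diag_mx !mxE.
  by have := bt r c rc; rewrite mxE => ->; rewrite mulr0.
by rewrite unitmx_mul bu andbT unitmxE det_diag unitfE; apply/prodf_neq0 => k _; apply: x0.
Qed.

(** Membership in the closure is transported by pulling test functions back: translation is
    polynomial in the entries and preserves the orbit. *)
Lemma FDB_torus (x : 'rV[C]_n) M : (forall k, x 0 k != 0) -> FDB M ->
  FDB (translate (diag_mx x) M).
Proof.
move=> x0 hM; apply: FDBI => [|F rF hF].
  by apply: is_frame_translate hM.1; rewrite unitmxE det_diag unitfE; apply/prodf_neq0 => k _; apply: x0.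
apply: (FDB_vanish (F := fun M => F (translate (diag_mx x) M)) hM).
  apply: regular_function_comp rF => S r c; have [Qc _ QM] := regular_function_algebra.
  rewrite (_ : (fun M => _) = fun M => x 0 r * M S r c).
    by apply: QM => //; apply: regular_function_entry.
  by apply/funext => M'; rewrite /translate mul_diag_mx mxE.
move=> _ [b [g [hb gu ->]]]; apply: hF; exists (diag_mx x *m b), g.
split=> //; first exact: borel_diag.
by apply: family_eq => S; rewrite /reframe /translate !mulmxA.
Qed.

Lemma FDB_reframe M g : (forall S, g S \in unitmx) -> FDB M -> FDB (reframe M g).
Proof.
move=> gu hM; apply: FDBI => [|F rF hF]; first exact: is_frame_reframe hM.1.
apply: (FDB_vanish (F := fun M => F (reframe M g)) hM).
  apply: regular_function_comp rF => S r c; have [Qc _ QM] := regular_function_algebra.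
  rewrite (_ : (fun M => _) = fun M => \sum_k M S r k * g S k c).
    apply: function_algebra_sum => [|k]; first exact: regular_function_algebra.
    by apply: QM => //; apply: regular_function_entry.
  by apply/funext => M'; rewrite mxE.
move=> _ [b [h [hb hu ->]]]; apply: hF; exists b, (fun S => h S *m g S).
split=> // [S|]; first by rewrite unitmx_mul hu gu.
by apply: family_eq => S; rewrite /reframe !mulmxA.
Qed.

(* A curve that lies in the variety away from u = 0 has its limit there.      *)
Lemma FDB_limit (T : C -> family) : (forall S r c, poly_function (fun u => T u S r c)) ->
  (forall u, u != 0 -> FDB (T u)) -> is_frame (T 0) -> FDB (T 0).
Proof.
move=> hT hF f0; apply: FDBI => // F [p hp] hv.
have [q hq] := function_algebra_evalp p (@poly_function_algebra C) hT.
rewrite -hp -hq (_ : q = 0) ?horner0 //.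
apply: poly_eq0_punctured => u /hF/FDB_vanish h.
by rewrite hq hp; apply: h => //; exists p.
Qed.

End FlaggedVariety.

Section Sections.
Variables (R : realType) (n : nat) (D : diagram n).
Let C : numClosedFieldType := complex R.
Local Notation family := (mxfamily R D).
Implicit Types (M : family) (S : dsupp D).

Lemma sum_dsupp (V : nmodType) (F : {set 'I_n} -> V) :
  (forall S : {set 'I_n}, D S = 0%N -> F S = 0) -> \sum_S F S = \sum_(S : dsupp D) F (val S).
Proof.
move=> F0; rewrite (bigID (fun S : {set 'I_n} => D S != 0%N)) /= [X in _ + X]big1 ?addr0 => [|S].
  rewrite (reindex_omap (val : dsupp D -> _) insub) /= => [|S DS].
    by apply: eq_bigl => S; rewrite valK eqxx andbT; apply: (valP S).
  by rewrite insubT.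
by rewrite negbK => /eqP/F0.
Qed.

Section Plucker.
Variable phi : choice_of_lowerings n.

Definition lowered_rows S : 'I_#|val S| -> 'I_n := fun c => phi (val S) (enum_val c).
Arguments lowered_rows : clear implicits.

Definition plucker M : C :=
  \prod_(S : dsupp D) \det (rowsub (lowered_rows S) (M S)) ^+ D (val S).

Lemma regular_function_minor S k (f : 'I_k -> 'I_n) (g : 'I_k -> 'I_#|val S|) :
  regular_function (fun M => \det (mxsub f g (M S))).
Proof.
apply: function_algebra_det => [|r c]; first exact: regular_function_algebra.
rewrite (_ : (fun M => _) = fun M => M S (f r) (g c)).
  exact: regular_function_entry.
by apply/funext => M; rewrite mxE.
Qed.

Lemma plucker_is_section : is_section plucker.
Proof.
split=> [M _|M g _ _].
  have [p hp] : regular_function plucker.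
    apply: function_algebra_prod => [|S]; first exact: regular_function_algebra.
    apply: function_algebraX; first exact: regular_function_algebra.
    exact: regular_function_minor.
  exists p, 1; rewrite /evalp meval1 oner_eq0; split=> // M' _ _.
  by rewrite meval1 divr1 -hp.
rewrite /plucker -big_split; apply: eq_bigr => S _ /=.
by rewrite /reframe -mul_rowsub_mx det_mulmx mulrC exprMn.
Qed.

Lemma plucker_torus (x : 'rV[C]_n) M : plucker (translate (diag_mx x) M) =
  (\prod_(S : dsupp D) (\prod_(k in val S) x 0 (phi (val S) k)) ^+ D (val S))
    * plucker M.
Proof.
rewrite /plucker -big_split; apply: eq_bigr => S _ /=.
rewrite -exprMn; congr (_ ^+ _).
have -> : rowsub (lowered_rows S) (translate (diag_mx x) M S) =
    diag_mx (\row_c x 0 (lowered_rows S c)) *m rowsub (lowered_rows S) (M S).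
  by apply/matrixP => r c; rewrite /translate !mul_diag_mx !mxE.
rewrite det_mulmx det_diag; congr (_ * _); rewrite [RHS]big_enum_val.
by apply: eq_bigr => c _; rewrite mxE.
Qed.

Definition lowered_weight : 'X_{1..n} :=
  [multinom (\sum_(S : dsupp D) D (val S) * #|[set x in val S | phi (val S) x == k]|)%N
    | k < n].

Lemma prod_lowered_weight (x : 'rV[C]_n) :
  \prod_(S : dsupp D) (\prod_(k in val S) x 0 (phi (val S) k)) ^+ D (val S) =
  \prod_k x 0 k ^+ lowered_weight k.
Proof.
rewrite [RHS](eq_bigr (fun k => \prod_(S : dsupp D)
    (x 0 k ^+ #|[set y in val S | phi (val S) y == k]|) ^+ D (val S))); last first.
  move=> k _; rewrite mnmE -prodrXr; apply: eq_bigr => S _.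
  by rewrite -exprM mulnC.
rewrite exchange_big; apply: eq_bigr => S _ /=; rewrite [RHS]prodrXl; congr (_ ^+ _).
rewrite (partition_big (fun y => phi (val S) y) predT) //=; apply: eq_bigr => k _.
rewrite (eq_bigr (fun=> x 0 k)) => [|y /andP[_ /eqP->] //].
by rewrite prodr_const; congr (_ ^+ _); apply: eq_card => y; rewrite !inE.
Qed.

Lemma row_lowered_weight :
  \row_k (lowered_weight k)%:R = lowered_point R D phi.
Proof.
apply/rowP => k; rewrite mxE mnmE natr_sum summxE sum_dsupp.
  apply: eq_bigr => S _; rewrite mxE summxE natrM; congr (_ * _).
  rewrite -sum1_card natr_sum [LHS]big_mkcond [RHS]big_mkcond.
  apply: eq_bigr => y _; rewrite !inE; case: (y \in val S) => //=.
  by rewrite mxE eqxx /= eq_sym; case: eqP.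
by move=> S DS; rewrite DS scale0r mxE.
Qed.

Hypothesis lphi : forall S : {set 'I_n}, lowering S (phi S).

(** For one set, the matrix sending each basis vector of the set to its lowered one is upper
    triangular and has minor 1. A generic upper triangular matrix makes all these minors and the
    determinant nonzero at once. *)
Lemma plucker_neq0 : exists2 M, FDB M & plucker M != 0.
Proof.
pose V (A : 'M[C]_n) := is_trig_mx A^T.
pose minor S (A : 'M[C]_n) : C :=
  \det (rowsub (lowered_rows S) (A *m @coord_frame R n D S)).
pose G := (fun A : 'M[C]_n => \det A) :: [seq minor T | T <- enum {: dsupp D}].
have polyE (A B : 'M[C]_n) r c : poly_function (fun t : C => (A + t *: B) r c).
  by exists ((A r c)%:P + B r c *: 'X) => t; rewrite !mxE hornerD hornerZ hornerX
    hornerC mulrC.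
have [A VA hA] : exists2 A, V A & forall i, (i < size G)%N ->
    nth (fun=> 0) G i A != 0.
  apply: common_nonzero.
  - move=> A B t /is_trig_mxP VA /is_trig_mxP VB; apply/is_trig_mxP => r c rc.
    by have := VA r c rc; have := VB r c rc; rewrite !mxE => -> ->; rewrite mulr0 addr0.
  - by apply/is_trig_mxP => r c _; rewrite !mxE.
  - case=> [_|i iG] A B.
      exact: (function_algebra_det (@poly_function_algebra C)).
    rewrite /= ltnS size_map in iG.
    have [S0 _] : exists S0 : dsupp D, true.
      by case: (enum _) iG => [|S0 e] //= _; exists S0.
    rewrite /= (nth_map S0) //.
    set S := nth _ _ _.
    apply: (function_algebra_det (@poly_function_algebra C)) => r c.
    rewrite (_ : (fun t => _) =
        fun t => \sum_k (A + t *: B) (lowered_rows S r) k * coord_frame R S k c).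
      apply: (function_algebra_sum (@poly_function_algebra C)) => k.
      have [Qc _ QM] := @poly_function_algebra C; exact: QM.
    by apply/funext => t; rewrite 2!mxE.
  - case=> [_|i iG].
      exists 1%:M => /=; last by rewrite det1 oner_eq0.
      by rewrite /V trmx1 scalar_mx_is_trig.
    rewrite /= ltnS size_map in iG.
    have [S0 _] : exists S0 : dsupp D, true.
      by case: (enum _) iG => [|S0 e] //= _; exists S0.
    rewrite /= (nth_map S0) //.
    set S := nth _ _ _; have [inj le] := loweringP _ _ (lphi (val S)).
    exists (\matrix_(r, k) ((k \in val S) && (r == phi (val S) k))%:R).
      apply/is_trig_mxP => r c rc; rewrite !mxE.
      case: (boolP (r \in val S)) => //= rS; case: eqP => // e.
      by have := le r rS; rewrite -e leqNgt rc.
    suff E : rowsub (lowered_rows S) ((\matrix_(r, k)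
        ((k \in val S) && (r == phi (val S) k))%:R) *m coord_frame R S) = 1%:M :> 'M[C]__.
      by rewrite /minor E det1 oner_eq0.
    apply/matrixP => r c; rewrite !mxE (bigD1 (enum_val c)) //= !mxE eqxx mulr1.
    rewrite big1 ?addr0 => [|k kc]; last by rewrite !mxE (negPf kc) mulr0.
    have cS := enum_valP c; have rS := enum_valP r.
    rewrite cS /= /lowered_rows; have [->|rc] := eqVneq r c; first by rewrite eqxx.
    by case: eqP => // /inj => /(_ rS cS)/enum_val_inj e; rewrite e eqxx in rc.
have bA : borel A.
  by split=> //; have := hA 0%N isT; rewrite /= unitmxE unitfE.
exists (translate A (@coord_frame R n D)).
  apply: FDB_orbit; exists A, (fun=> 1%:M); split=> // [S|].
    exact: unitmx1.
  by apply: family_eq => S; rewrite /reframe mulmx1.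
apply/prodf_neq0 => S _; rewrite expf_neq0 //.
have Si : (index S (enum {: dsupp D}) < size (enum {: dsupp D}))%N.
  by rewrite index_mem mem_enum.
have := hA (index S (enum {: dsupp D})).+1; rewrite /= size_map ltnS Si => /(_ isT).
by rewrite (nth_map S) // nth_index // mem_enum.
Qed.

End Plucker.

End Sections.

(** * Degeneration along one-parameter subgroups *)

Section TorusLimit.
Variables (R : realType) (n : nat) (D : diagram n).
Let C : numClosedFieldType := complex R.
Local Notation family := (mxfamily R D).
Implicit Types (M N : family) (S : dsupp D) (w : 'I_n -> nat).

Lemma det_replaced_row (K : comUnitRingType) k (A : 'M[K]_k) c :
  (forall r l, r != c -> A r l = (r == l)%:R) -> \det A = A c c.
Proof.
move=> hA; have cofE l : cofactor A c l = (l == c)%:R.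
  have -> : cofactor A c l = cofactor (1%:M : 'M[K]_k) c l.
    rewrite /cofactor; congr (_ * \det _); apply/matrixP => x y.
    by rewrite !mxE hA // eq_sym neq_lift.
  by have := congr1 (fun B : 'M_k => B l c) (adj1 K k); rewrite /adjugate !mxE.
rewrite (expand_det_row A c) (bigD1 c) //= cofE eqxx mulr1 big1 ?addr0 // => l lc.
by rewrite cofE (negPf lc) mulr0.
Qed.

(* A minor of a point of the variety that does not vanish does not vanish on  *)
(* the whole orbit, and then some term of its Leibniz expansion survives.     *)
Lemma minor_lowering S (f : 'I_#|val S| -> 'I_n) M w : FDB M ->
  \det (rowsub f (M S)) != 0 ->
  exists2 phi : {ffun 'I_n -> 'I_n}, lowering (val S) phi
    & (\sum_(x in val S) w (phi x) = \sum_c w (f c))%N.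
Proof.
move=> hM dM.
have [M' hM' dM'] : exists2 M' : family, borel_orbit M' & \det (rowsub f (M' S)) != 0.
  have [//|N] := pselect (exists2 M' : family, borel_orbit M' & \det (rowsub f (M' S)) != 0).
  case/eqP: dM; apply: (FDB_vanish (F := fun M => \det (rowsub f (M S))) hM).
    exact: regular_function_minor.
  by move=> M' hM'; apply/eqP/negPn/negP => d; apply: N; exists M'.
have [b [g [[/is_trig_mxP bt _] _ ME]]] := hM'.
have {dM'} : \det (rowsub f (b *m coord_frame R S)) != 0.
  apply: contra_neq dM' => d0; rewrite ME /reframe /translate -mul_rowsub_mx.
  by rewrite det_mulmx d0 mul0r.
set A := rowsub f _ => dA.
have AE r c : A r c = b (f r) (enum_val c).
  rewrite !mxE (bigD1 (enum_val c)) //= !mxE eqxx mulr1 big1 ?addr0 // => k kc.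
  by rewrite !mxE (negPf kc) mulr0.
have finj : injective f.
  move=> r1 r2 e; apply/eqP/negPn/negP => r12.
  have Ar12 : A r1 =1 A r2 by move=> c; rewrite !AE e.
  by rewrite (determinant_alternate r12 Ar12) eqxx in dA.
have [s hs] : exists s : 'S_#|val S|, forall r, A r (s r) != 0.
  have [//|N] := pselect (exists s : 'S_#|val S|, forall r, A r (s r) != 0).
  case/eqP: dA; apply: big1 => s _.
  have [r /eqP r0] : exists r, A r (s r) = 0.
    have [//|N'] := pselect (exists r, A r (s r) = 0).
    by case: N; exists s => r; apply/eqP => r0; apply: N'; exists r.
  by rewrite (bigD1 r) //= (eqP r0) mul0r mulr0.
have fle r : (f r <= enum_val (s r))%N.
  rewrite leqNgt; apply/negP => lt; have := hs r; rewrite AE.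
  by have := bt _ _ lt; rewrite mxE => ->; rewrite eqxx.
pose phi : {ffun 'I_n -> 'I_n} := [ffun x =>
  if [pick r | enum_val (s r) == x] is Some r then f r else x].
have phiE r : phi (enum_val (s r)) = f r.
  rewrite ffunE; case: pickP => [r' /eqP/enum_val_inj/perm_inj-> //|/(_ r)].
  by rewrite eqxx.
have SE x : x \in val S -> exists r, x = enum_val (s r).
  move=> xS; exists ((s^-1)%g (enum_rank_in xS x)).
  by rewrite permKV enum_rankK_in.
exists phi.
  apply/loweringP; split=> [x y|x].
    by move=> /SE[r ->] /SE[r' ->]; rewrite !phiE => /finj ->.
  by move=> /SE[r ->]; rewrite phiE.
rewrite big_enum_val /= (reindex_inj (@perm_inj _ s)) /=.
by apply: eq_bigr => r _; rewrite phiE.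
Qed.

Definition lowered_degree w (Phi : choice_of_lowerings n) : nat :=
  (\sum_(S : {set 'I_n}) D S * \sum_(x in S) w (Phi S x))%N.

(** The value of [schubitope] at natural weights, as a natural number so that it can serve as an
    exponent of [u]. *)
Definition schubitope_degree w : nat :=
  \max_(Phi : choice_of_lowerings n | [forall S, lowering S (Phi S)])
    lowered_degree w Phi.

Lemma schubitope_degree_attained w :
  exists2 Phi : choice_of_lowerings n, forall S : {set 'I_n}, lowering S (Phi S)
    & schubitope_degree w = lowered_degree w Phi.
Proof.
have [|Phi hPhi E] := @eq_bigmax_cond _
  [pred Phi : choice_of_lowerings n | [forall S, lowering S (Phi S)]] (lowered_degree w).
  rewrite (cardD1 [ffun=> [ffun x => x]]) inE /=.
  by rewrite (_ : [forall S, _]) //; apply/forallP => S; rewrite ffunE lowering_id.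
by exists Phi; [apply/forallP|].
Qed.

Definition inv_weights w (u : C) : 'rV[C]_n := \row_k u ^- w k.

Lemma inv_weights_neq0 w u k : u != 0 -> inv_weights w u 0 k != 0.
Proof. by move=> u0; rewrite mxE invr_eq0 expf_neq0. Qed.

Section Limit.
Variables (w : 'I_n -> nat) (N : family) (f : forall S, 'I_#|val S| -> 'I_n).
Hypotheses (hN : FDB N) (fN : forall S, rowsub (@f S) (N S) = 1%:M)
  (wN : forall S r c, N S r c != 0 -> (w r <= w (@f S c))%N).

(* The reframed point diag(u^-w) N; exponents are natural by [wN] wherever the *)
(* entry of N is nonzero, so the curve extends to u = 0.                       *)
Definition normalized_curve (u : C) : family :=
  fun S => \matrix_(r, c) (u ^+ (w (@f S c) - w r) * N S r c).

Lemma normalized_curveE u : u != 0 -> normalized_curve u =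
  reframe (translate (diag_mx (inv_weights w u)) N)
    (fun S => diag_mx (\row_c u ^+ w (@f S c))).
Proof.
move=> u0; apply: family_eq => S; apply/matrixP => r c.
rewrite /reframe /translate mul_mx_diag mul_diag_mx !mxE.
have [->|N0] := eqVneq (N S r c) 0; first by rewrite !mulr0 mul0r.
have mulE (a b x : C) : a / b * x = b^-1 * x * a by rewrite -mulrA mulrC.
by rewrite exprB ?wN ?unitfE // mulE.
Qed.

Lemma FDB_normalized_curve u : FDB (normalized_curve u).
Proof.
have nz v : v != 0 -> FDB (normalized_curve v).
  move=> v0; rewrite normalized_curveE //; apply: FDB_reframe => [S|].
    by rewrite unitmxE det_diag unitfE; apply/prodf_neq0 => c _; rewrite mxE expf_neq0.
  by apply: FDB_torus => // k; apply: inv_weights_neq0.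
have [->|] := eqVneq u 0; last exact: nz.
apply: FDB_limit => [S r c||S].
- exists (N S r c *: 'X^(w (@f S c) - w r)) => v.
  by rewrite hornerZ hornerXn mxE mulrC.
- exact: nz.
apply/row_fullP; exists (rowsub (@f S) 1%:M); rewrite -rowsubE.
rewrite -(fN S); apply/matrixP => r c; rewrite !mxE.
have := congr1 (fun A : 'M_ _ => A r c) (fN S); rewrite !mxE => ->.
have [->|rc] := eqVneq r c; first by rewrite subnn expr0 mulr1.
by rewrite mulr0.
Qed.

Lemma section_limit s : is_section s ->
  regular_at0 (fun u => u ^+ (\sum_(S : dsupp D) D (val S) * \sum_c w (@f S c))%N
    * s (translate (diag_mx (inv_weights w u)) N)).
Proof.
move=> [rs es]; have [p [q [q0 hpq]]] := rs _ (FDB_normalized_curve 0).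
have cP S r c : poly_function (fun u => normalized_curve u S r c).
  exists (N S r c *: 'X^(w (@f S c) - w r)) => v.
  by rewrite hornerZ hornerXn mxE mulrC.
have [P PE] := function_algebra_evalp p (@poly_function_algebra C) cP.
have [Q QE] := function_algebra_evalp q (@poly_function_algebra C) cP.
exists P, Q; rewrite QE; split=> // u u0; rewrite QE PE => qu.
rewrite -hpq //; last exact: FDB_normalized_curve.
rewrite normalized_curveE // es; first last.
- by move=> S; rewrite unitmxE det_diag unitfE; apply/prodf_neq0 => c _; rewrite mxE expf_neq0.
- by apply: FDB_torus => // k; apply: inv_weights_neq0.
congr (_ * _); rewrite -prodrXr; apply: eq_bigr => S _.
rewrite det_diag mulnC exprM -prodrXr; congr (_ ^+ _).
by apply: eq_bigr => c _; rewrite mxE.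
Qed.

End Limit.

(** For each set take the nonvanishing minor of largest weight and normalise its block to the
    identity. Every other entry is then a minor with one row replaced, so maximality gives the
    exponents needed by [section_limit]. By [minor_lowering] the chosen minors weigh no more than
    [schubitope_degree]. *)
Lemma section_degree_le s M w : is_section s -> FDB M ->
  regular_at0 (fun u => u ^+ schubitope_degree w
    * s (translate (diag_mx (inv_weights w u)) M)).
Proof.
move=> hs hM.
have exf S : exists f : {ffun 'I_#|val S| -> 'I_n},
    \det (rowsub f (M S)) != 0 /\
    forall f' : 'I_#|val S| -> 'I_n, \det (rowsub f' (M S)) != 0 ->
      (\sum_c w (f' c) <= \sum_c w (f c))%N.
  pose f0 : {ffun 'I_#|val S| -> 'I_n} := fullrankfun (hM.1 S).
  have f0P : \det (rowsub f0 (M S)) != 0.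
    by rewrite -unitfE -unitmxE; apply: fullrowsub_unit.
  pose f := [arg max_(f > f0 | \det (rowsub (f : {ffun _ -> _}) (M S)) != 0)
    \sum_c w ((f : {ffun _ -> _}) c)].
  exists f; rewrite /f; case: arg_maxnP => // f1 f1P f1max; split=> // f' f'P.
  have fE c : [ffun c => f' c] c = f' c by rewrite ffunE.
  have := f1max [ffun c => f' c]; rewrite (eq_bigr _ (fun c _ => congr1 w (fE c))).
  apply; rewrite (_ : rowsub _ _ = rowsub f' (M S)) //.
  by apply/matrixP => r c; rewrite !mxE fE.
have [f hf] : exists f : forall S, {ffun 'I_#|val S| -> 'I_n}, forall S,
    \det (rowsub (f S) (M S)) != 0 /\
    forall f' : 'I_#|val S| -> 'I_n, \det (rowsub f' (M S)) != 0 ->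
      (\sum_c w (f' c) <= \sum_c w (f S c))%N.
  by exists (fun S => sval (cid (exf S))) => S; case: (cid (exf S)).
pose g S := invmx (rowsub (f S) (M S)).
have fu S : rowsub (f S) (M S) \in unitmx by rewrite unitmxE unitfE; have [] := hf S.
have gu S : g S \in unitmx by rewrite unitmx_inv.
pose N : family := reframe M g.
have NM : M = reframe N (fun S => rowsub (f S) (M S)).
  by apply: family_eq => S; rewrite /N /reframe -mulmxA mulVmx // mulmx1.
have hN : FDB N by apply: FDB_reframe.
have fN S : rowsub (f S) (N S) = 1%:M.
  by rewrite /N /reframe -mul_rowsub_mx mulmxV.
have wN S r c : N S r c != 0 -> (w r <= w (f S c))%N.
  move=> Nrc; pose f' l := if l == c then r else f S l.
  have dE : \det (rowsub f' (N S)) = N S r c.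
    rewrite (@det_replaced_row _ _ _ c) => [|k l kc]; first by rewrite mxE /f' eqxx.
    have := congr1 (fun A : 'M_ _ => A k l) (fN S).
    by rewrite !mxE /f' (negPf kc).
  have := (hf S).2 f'; rewrite NM /reframe -mul_rowsub_mx det_mulmx dE.
  rewrite mulf_neq0 //; last by have [] := hf S.
  move=> /(_ isT); rewrite (bigD1 c) //= [leqRHS](bigD1 c) //= /f' eqxx.
  rewrite (eq_bigr (fun l => w (f S l))) ?leq_add2r // => l /negPf->.
  by [].
have := section_limit hN fN wN hs; set K := (\sum_(S : dsupp D) _)%N => hK.
have KH : (K <= schubitope_degree w)%N.
  have ex S : exists2 phi : {ffun 'I_n -> 'I_n}, lowering (val S) phi
      & (\sum_(x in val S) w (phi x) = \sum_c w (f S c))%N.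
    by apply: (@minor_lowering S (f S) M w hM); have [] := hf S.
  have [phi hphi] : exists phi : dsupp D -> {ffun 'I_n -> 'I_n}, forall S,
      lowering (val S) (phi S) /\
      (\sum_(x in val S) w (phi S x) = \sum_c w (f S c))%N.
    by exists (fun S => s2val (cid2 (ex S))) => S; case: (cid2 (ex S)).
  pose Phi : choice_of_lowerings n :=
    [ffun S => if insub S is Some T then phi T else [ffun x => x]].
  have PhiE S : Phi (val S) = phi S by rewrite ffunE valK.
  have lPhi : [forall S, lowering S (Phi S)].
    apply/forallP => S; rewrite ffunE; case: insubP => [T _ <-|_].
      by have [] := hphi T.
    exact: lowering_id.
  rewrite /schubitope_degree (leq_trans _ (leq_bigmax_cond _ lPhi)) //.
  have -> : lowered_degree w Phi =
      (\sum_(S : dsupp D) D (val S) * \sum_(x in val S) w (Phi (val S) x))%N.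
    by apply: (@sum_dsupp _ D nat) => S ->.
  apply: leq_sum => S _; rewrite PhiE.
  by have [_ ->] := hphi S.
apply: (eq_regular_at0 _ (regular_at0M (regular_at0M
  (regular_at0_poly (\prod_(S : dsupp D) \det (rowsub (f S) (M S)) ^+ D (val S))%:P)
  (regular_at0_poly 'X^(schubitope_degree w - K))) hK)) => u u0.
rewrite hornerC hornerXn -mulrA [X in _ * X]mulrA -exprD subnK // mulrCA.
congr (_ * _); rewrite {2}NM.
have -> : translate (diag_mx (inv_weights w u)) (reframe N (fun S => rowsub (f S) (M S))) =
    reframe (translate (diag_mx (inv_weights w u)) N) (fun S => rowsub (f S) (M S)).
  by apply: family_eq => S; rewrite /translate /reframe mulmxA.
have [_ es] := hs; rewrite es //; apply: FDB_torus => // k.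
exact: inv_weights_neq0.
Qed.

End TorusLimit.

(** * Weights of the character *)

Section Character.
Variables (R : realType) (n : nat) (D : diagram n).
Let C : numClosedFieldType := complex R.
Local Notation family := (mxfamily R D).
Variables (d : nat) (e : 'I_d -> family -> C).
Hypothesis he : is_basis e.

Lemma basis_free (c c' : 'I_d -> C) :
  (forall M, FDB M -> \sum_k c k * e k M = \sum_k c' k * e k M) -> c =1 c'.
Proof.
move=> h k; apply/eqP; rewrite -subr_eq0; apply/eqP.
have [_ free _] := he; apply: (free (fun k => c k - c' k)) => M hM.
rewrite (eq_bigr (fun k => c k * e k M - c' k * e k M)) => [|l _]; last by rewrite mulrBl.
by rewrite sumrB h // subrr.
Qed.

(** A basis of sections is determined by its values at finitely many points; inverting the
    evaluation matrix expresses the trace of the torus action by values of sections. *)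
Lemma basis_points : exists pts : 'I_d -> family, (forall l, FDB (pts l)) /\
  \matrix_(k, l) e k (pts l) \in unitmx.
Proof.
suff [pts [hp fr]] : exists pts : 'I_d -> family, (forall l, FDB (pts l)) /\
    row_free (\matrix_(l, k) e k (pts l)).
  exists pts; split=> //; rewrite -unitmx_tr -row_free_unit.
  by rewrite (_ : _^T = \matrix_(l, k) e k (pts l)) //; apply/matrixP => x y; rewrite !mxE.
suff H r : (r <= d)%N -> exists pts : 'I_r -> family, (forall l, FDB (pts l)) /\
    row_free (\matrix_(l, k) e k (pts l)) by apply: H.
elim: r => [_|r IH rd].
  exists (fun=> @coord_frame R n D); split=> [[]//|].
  by rewrite /row_free eqn_leq rank_leq_row.
have [pts [hp fr]] := IH (ltnW rd); set E := \matrix_(_, _) _ in fr.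
(* [v] is a combination of sections vanishing at all the points chosen so far; a point where it does
   not vanish adds an independent row. *)
have [v v0 vE] : exists2 v : 'rV[C]_d, v != 0 & v *m E^T = 0.
  have K0 : kermx E^T != 0.
    rewrite -mxrank_eq0 mxrank_ker mxrank_tr (eqP fr) subn_eq0 -ltnNge.
    exact: rd.
  have /rowV0Pn[v /sub_kermxP vE v0] := K0.
  by exists v.
have [M hM vM] : exists2 M, FDB M & \sum_k v 0 k * e k M != 0.
  have [//|N] := pselect (exists2 M, FDB M & \sum_k v 0 k * e k M != 0).
  case/eqP: v0; apply/rowP => k; rewrite mxE; apply: (@basis_free (v 0) (fun=> 0)).
  move=> M hM; rewrite [RHS]big1 => [|l _]; last by rewrite mul0r.
  by apply/eqP/negPn/negP => vM; apply: N; exists M.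
have frF : row_free (col_mx (\row_k e k M) E).
  rewrite -kermx_eq0; apply/rowV0P => y /sub_kermxP; rewrite -(hsubmxK y) mul_row_col.
  move: (lsubmx y) (rsubmx y) => a b abE.
  have : (a *m (\row_k e k M) + b *m E) *m v^T = 0 by rewrite abE mul0mx.
  have EvT : E *m v^T = 0 by rewrite -[LHS]trmxK trmx_mul trmxK vE trmx0.
  rewrite mulmxDl -!mulmxA EvT mulmx0 addr0 {1}(mx11_scalar a) mul_scalar_mx => ae.
  have a0 : a = 0.
    rewrite (mx11_scalar a); move/matrixP/(_ 0 0): ae; rewrite !mxE.
    rewrite (eq_bigr (fun k => v 0 k * e k M)) => [/eqP|k _]; last by rewrite !mxE mulrC.
    by rewrite mulf_eq0 (negPf vM) orbF => /eqP ->; rewrite raddf0.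
  move: abE; rewrite a0 mul0mx add0r => bE.
  suff -> : b = 0 by rewrite row_mx0.
  by apply: (row_free_inj fr); rewrite /= bE mul0mx.
exists (fun l : 'I_(1 + r) => match split l with inl _ => M | inr l' => pts l' end).
split=> [l|]; first by case: split.
rewrite (_ : \matrix_(_, _) _ = col_mx (\row_k e k M) E) //.
apply/matrixP => l k; rewrite !mxE; case: splitP => l' _; rewrite ?mxE //.
Qed.

Variable chi : {mpoly C[n]}.
Hypothesis hchi : forall x : 'rV[C]_n, (forall k, x 0 k != 0) ->
  exists2 A : 'M[C]_d, dual_section_mx e (diag_mx x) A
                     & chi.@[fun k => x 0 k] = \tr A.

Lemma dual_section_diagE (x : 'rV[C]_n) A : dual_section_mx e (diag_mx x) A ->
  forall k M, FDB M -> e k (translate (diag_mx x) M) = \sum_l A k l * e l M.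
Proof.
move=> h k M hM; have := h k M hM; rewrite /act_section invmxK => ->.
by apply: eq_bigr => l _; rewrite mxE.
Qed.

Let nonzero (x : 'rV[C]_n) := forall k, x 0 k != 0.

Lemma torus_matrix : exists A : 'rV[C]_n -> 'M[C]_d, forall x, nonzero x ->
  chi.@[fun k => x 0 k] = \tr (A x) /\
  forall k M, FDB M -> e k (translate (diag_mx x) M) = \sum_l A x k l * e l M.
Proof.
exists (fun x => if pselect (nonzero x) is left h then s2val (cid2 (hchi h)) else 0).
move=> x hx; case: pselect => // h; case: (cid2 _) => A /= hA -> ; split=> //.
exact: dual_section_diagE.
Qed.

Section TorusMatrix.
Variable A : 'rV[C]_n -> 'M[C]_d.
Hypotheses (trA : forall x, nonzero x -> chi.@[fun k => x 0 k] = \tr (A x))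
  (actA : forall x, nonzero x -> forall k M, FDB M ->
     e k (translate (diag_mx x) M) = \sum_l A x k l * e l M).

Lemma torus_matrix1 : A (const_mx 1) = 1%:M.
Proof.
apply/matrixP => k l; apply: (basis_free (c := A (const_mx 1) k)) => M hM.
rewrite -actA // => [|i]; last by rewrite mxE oner_eq0.
rewrite diag_const_mx (_ : translate _ M = M); last first.
  by apply: family_eq => S; rewrite /translate mul1mx.
rewrite (bigD1 k) //= mxE eqxx mul1r big1 ?addr0 // => i ik.
by rewrite mxE eq_sym (negPf ik) mul0r.
Qed.

Lemma torus_matrixM x y : nonzero x -> nonzero y ->
  A (\row_k (x 0 k * y 0 k)) = A x *m A y.
Proof.
move=> hx hy; apply/matrixP => k l.
apply: (basis_free (c := A _ k)) => M hM.
rewrite -actA // => [|i]; last by rewrite mxE mulf_neq0.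
have -> : translate (diag_mx (\row_k (x 0 k * y 0 k))) M =
    translate (diag_mx x) (translate (diag_mx y) M).
  apply: family_eq => S; rewrite /translate mulmxA mulmx_diag.
  by congr (diag_mx _ *m _); apply/rowP => i; rewrite !mxE.
rewrite actA //; last exact: FDB_torus.
under eq_bigr do rewrite actA // mulr_sumr.
rewrite exchange_big; apply: eq_bigr => i _ /=; rewrite mxE mulr_suml.
by apply: eq_bigr => i' _; rewrite mulrA.
Qed.

Lemma character_coef_ge0 m : 0 <= chi@_m.
Proof. exact: (weight_multiplicity_ge0 trA torus_matrix1 torus_matrixM). Qed.

(** The coordinates of a nonzero [plucker] section in the basis form a weight vector. *)
Lemma lowered_weight_msupp (phi : choice_of_lowerings n) :
  (forall S : {set 'I_n}, lowering S (phi S)) -> lowered_weight D phi \in msupp chi.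
Proof.
move=> lphi; have [_ _ gen] := he.
have [c hc] := gen _ (plucker_is_section R D phi).
have [M hM pM] := plucker_neq0 R D lphi.
apply: (weight_vector_msupp trA torus_matrix1 torus_matrixM (c := \row_k c k)).
  apply: contra_neq pM => c0; rewrite hc // big1 // => k _.
  by have /rowP/(_ k) := c0; rewrite !mxE => ->; rewrite mul0r.
move=> x hx; apply/rowP => l; rewrite !mxE.
apply: (basis_free (c := fun l => \sum_k (\row_k c k) 0 k * A x k l)
  (c' := fun l => _ * c l)) => M' hM'.
transitivity (plucker phi (translate (diag_mx x) M')).
  rewrite hc; last exact: FDB_torus.
  under eq_bigr do rewrite mulr_suml.
  rewrite exchange_big; apply: eq_bigr => k _ /=; rewrite actA // mulr_sumr.
  by apply: eq_bigr => l' _; rewrite mxE mulrA.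
rewrite plucker_torus prod_lowered_weight hc // mulr_sumr.
by apply: eq_bigr => k _; rewrite mulrA.
Qed.

Lemma character_degree_le w m : m \in msupp chi ->
  (\sum_k w k * m k <= schubitope_degree D w)%N.
Proof.
apply: regular_at0_weight_le; first exact: character_coef_ge0.
have [pts [hp Eu]] := basis_points; set E := \matrix_(_, _) _ in Eu.
have [es _ _] := he.
have reg : regular_at0 (fun u : C => \sum_k \sum_l (u ^+ schubitope_degree D w *
    e k (translate (diag_mx (inv_weights w u)) (pts l))) * invmx E l k).
  apply: regular_at0_sum => k; apply: regular_at0_sum => l; apply: regular_at0M.
    exact: section_degree_le.
  apply: (eq_regular_at0 _ (regular_at0_poly (invmx E l k)%:P)) => u _.
  by rewrite hornerC.
apply: eq_regular_at0 reg => u u0.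
have nz : nonzero (inv_weights w u) by move=> k; apply: inv_weights_neq0.
have -> : chi.@[fun k => u ^- w k] = chi.@[fun k => inv_weights w u 0 k].
  by apply: meval_eq => k; rewrite mxE.
rewrite trA // -[A _](mulmxK Eu) /mxtrace mulr_sumr; apply: eq_bigr => k _.
rewrite mxE mulr_sumr; apply: eq_bigr => l _; rewrite mulrA; congr (_ * _ * _).
by rewrite actA // mxE; apply: eq_bigr => i _; rewrite mxE.
Qed.

Definition diagram_size : nat := (\sum_(S : dsupp D) D (val S) * #|val S|)%N.

Lemma torus_matrix_scalar (t : C) : t != 0 ->
  A (const_mx t) = (t ^+ diagram_size)%:M.
Proof.
move=> t0; apply/matrixP => k l; apply: (basis_free (c := A _ k)) => M hM.
rewrite -actA // => [|i]; last by rewrite mxE.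
have -> : translate (diag_mx (const_mx t)) M = reframe M (fun S => t%:M).
  by apply: family_eq => S; rewrite /translate /reframe diag_const_mx
    mul_scalar_mx mul_mx_scalar.
have [es _ _] := he; have [_ esk] := es k; rewrite esk // => [|S]; last first.
  by rewrite unitmxE det_scalar unitfE expf_neq0.
rewrite (bigD1 k) //= mxE eqxx mulr1n [X in _ + X]big1 ?addr0 => [|i ik]; last first.
  by rewrite mxE eq_sym (negPf ik) mulr0n mul0r.
congr (_ * _); rewrite -prodrXr; apply: eq_bigr => S _.
by rewrite det_scalar mulnC exprM.
Qed.

(** Scalar matrices act on frames as a change of basis, hence on sections by a fixed power of [t];
    nonnegative coefficients cannot cancel in other degrees. Homogeneity is what lets a real weight
    be shifted by a constant into natural weights. *)
Lemma character_mdeg m : m \in msupp chi -> mdeg m = diagram_size.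
Proof.
move=> ms.
pose p : {poly C} := \sum_(l <- msupp chi) chi@_l *: 'X^(mdeg l).
have pE : p = d%:R *: 'X^diagram_size.
  apply/eqP; rewrite -subr_eq0; apply/eqP/poly_eq0_punctured => t t0.
  have nz : nonzero (const_mx t) by move=> k; rewrite mxE.
  have := trA nz; rewrite torus_matrix_scalar // mxtrace_scalar => E.
  rewrite hornerD hornerN hornerZ hornerXn mulr_natl -E mevalE horner_sum.
  apply/eqP; rewrite subr_eq0; apply/eqP/eq_bigr => l _.
  rewrite hornerZ hornerXn mdegE -prodrXr; congr (_ * _).
  by apply: eq_bigr => k _; rewrite mxE.
apply/eqP/negPn/negP => md; have /eqP := congr1 (fun q : {poly C} => q`_(mdeg m)) pE.
rewrite coefZ coefXn (negPf md) mulr0 coef_sum psumr_eq0 => [/allP/(_ m ms)|l _].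
  rewrite /= coefZ coefXn eqxx mulr1; apply/negP.
  by rewrite -mcoeff_msupp.
by rewrite coefZ coefXn mulr_ge0 ?character_coef_ge0 ?ler0n.
Qed.

End TorusMatrix.

End Character.

Section CharacterNewton.
Variables (R : realType) (n : nat) (D : diagram n).
Let C : numClosedFieldType := complex R.

Theorem Newton_character (chi : {mpoly C[n]}) : is_character D chi ->
  Newton chi = hull (lowered_points R D).
Proof.
case=> d [e [he hchi]]; have [A hA] := torus_matrix hchi.
have trA x hx := (hA x hx).1; have actA x hx := (hA x hx).2.
rewrite /Newton; set s := map _ _; apply/seteqP; split; apply: sub_hull; last first.
  move=> a /mapP[phi]; rewrite mem_enum inE => /forallP lphi ->.
  rewrite -row_lowered_weight; apply: mem_hull; apply: map_f.
  exact: (lowered_weight_msupp he trA actA).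
apply: hull_dense => w eps eps0.
pose B : R := \sum_k `|w 0 k|.
have [N N0 eN] : exists2 N : nat, 0 < N%:R :> R & 1 <= eps * N%:R.
  exists (Num.truncn eps^-1).+1; first by rewrite ltr0n.
  have ei : 0 < eps^-1 by rewrite invr_gt0.
  have /andP[_ /ltW h] := truncn_itv (ltW ei).
  by rewrite -ler_pdivrMl // mulr1.
have NR : N%:R != 0 :> R by rewrite gt_eqF.
have wB k : 0 <= N%:R * (w 0 k + B).
  have : - w 0 k <= B.
    rewrite (le_trans (ler_norm _)) // normrN /B (bigD1 k) //= lerDl.
    exact: sumr_ge0.
  by move=> h; rewrite mulr_ge0 ?ler0n //; lra.
(* Shift [w] by [B] to make it nonnegative, then round to multiples of [1/N], which moves each
   coordinate by at most [eps]. *)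
pose u k := Num.truncn (N%:R * (w 0 k + B)).
pose w' : 'rV[R]_n := \row_k ((u k)%:R / N%:R - B).
exists w' => [k|a /mapP[m ms ->]].
  rewrite mxE /u; have := truncn_itv (wB k).
  move: (Num.truncn (N%:R * _)) => v; rewrite -natr1 => /andP[lo hi].
  set x := _ - w 0 k; have xE : N%:R * x = v%:R - N%:R * (w 0 k + B).
    by rewrite /x !mulrBr mulrCA mulfV // mulr1 mulrDr opprD addrAC addrA.
  rewrite ler_norml -(ler_pM2l N0 (- eps)) -(ler_pM2l N0 x) xE mulrN [_ * eps]mulrC.
  by move: (N%:R * (w 0 k + B)) lo hi => y lo hi; apply/andP; split; lra.
have [Phi lPhi E] := schubitope_degree_attained D u.
have ms' := lowered_weight_msupp he trA actA lPhi.
exists (lowered_point R D Phi).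
  by apply: map_f; rewrite mem_enum inE; apply/forallP.
have dE (l : 'X_{1..n}) : dot w' (\row_k (l k)%:R) =
    (\sum_k u k * l k)%N%:R / N%:R - B * (mdeg l)%:R.
  rewrite mdegE !natr_sum mulr_suml mulr_sumr -sumrB; apply: eq_bigr => k _.
  by rewrite !mxE natrM mulrBl mulrAC.
rewrite -row_lowered_weight !dE !(character_mdeg he trA actA) // lerD2r.
rewrite ler_pM2r ?invr_gt0 // ler_nat.
apply: leq_trans (character_degree_le he trA actA u ms) _; rewrite E.
rewrite -(ler_nat R) le_eqVlt; apply/orP; left; apply/eqP.
transitivity (dot (\row_k (u k)%:R) (lowered_point R D Phi)).
  rewrite dot_lowered_point natr_sum; apply: eq_bigr => S _; rewrite natrM natr_sum.
  by congr (_ * _); apply: eq_bigr => x _; rewrite mxE.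
rewrite -row_lowered_weight natr_sum; apply: eq_bigr => k _.
by rewrite !mxE natrM.
Qed.

End CharacterNewton.

(** * Demazure operators *)

Section DemazureNewton.
Variables (R : realType) (n : nat) (i j : 'I_n).
Hypothesis ij : i != j.
Variable K : fieldType.
Implicit Types (w : 'rV[R]_n) (p f : {mpoly K[n]}) (m : 'X_{1..n}).

Definition exponent m : 'rV[R]_n := \row_k (m k)%:R.

Lemma exponentD m1 m2 : exponent (m1 + m2) = exponent m1 + exponent m2.
Proof. by apply/rowP => k; rewrite !mxE mnmDE natrD. Qed.

Lemma exponentU k : exponent U_(k) = delta_mx 0 k.
Proof. by apply/rowP => l; rewrite !mxE mnm1E eqxx eq_sym. Qed.

Lemma dot_exponentU w k m : dot w (exponent (U_(k) + m)) = w 0 k + dot w (exponent m).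
Proof. by rewrite exponentD dotDr exponentU (dotC w) dot_delta. Qed.

Lemma mcoeff_mulX p k m : ('X_k * p)@_(U_(k) + m) = p@_m.
Proof. by rewrite mulrC mcoeffMX. Qed.

Lemma msupp_mulX p k m : m \in msupp ('X_k * p) ->
  exists2 m', m' \in msupp p & m = (U_(k) + m')%MM.
Proof.
rewrite mulrC (perm_mem (msuppMX _ _)) => /mapP[m' m'p ->].
by exists m'.
Qed.

Lemma msupp_neq0 p m : p@_m != 0 -> m \in msupp p.
Proof. by rewrite mcoeff_msupp. Qed.

Lemma dot_exponent_swapv w m : dot w (exponent [multinom m (tperm i j k) | k < n]) =
  dot (swapv i j w) (exponent m).
Proof.
rewrite /dot [RHS](reindex_inj (@perm_inj _ (tperm i j))) /=.
by apply: eq_bigr => k _; rewrite !mxE mnmE tpermK.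
Qed.

Lemma msupp_swap p m : (m \in msupp (msym (tperm i j) p)) =
  ([multinom m (tperm i j k) | k < n] \in msupp p).
Proof. by rewrite !mcoeff_msupp mcoeff_sym. Qed.

Lemma mulX_sub_neq0 : 'X_i - 'X_j != 0 :> {mpoly K[n]}.
Proof.
rewrite subr_eq0; apply/eqP => /(congr1 (mcoeff U_(i))).
rewrite !mcoeffX eqxx; case: eqP => [/mnmP/(_ i)|_ /eqP]; last by rewrite oner_eq0.
by rewrite !mnm1E eqxx eq_sym (negPf ij).
Qed.

(** Swapping the variables changes the sign of both sides of [demazureE]. The symmetry transfers the
    bounds from [w_j < w_i] to the opposite half-space. *)
Lemma msym_demazure f : msym (tperm i j) (demazure i j f) = demazure i j f.
Proof.
have symX k : msym (tperm i j) ('X_k : {mpoly K[n]}) = 'X_(tperm i j k).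
  rewrite msymX; congr 'X_[_]; apply/mnmP => l.
  by rewrite mnmE !mnm1E tpermV -(inj_eq (@perm_inj _ (tperm i j))) tpermK.
have symK : msym (tperm i j) (msym (tperm i j) f) = f.
  apply/mpolyP => m; rewrite !mcoeff_sym; congr (_@_ _).
  by apply/mnmP => k; rewrite !mnmE tpermK.
have E := demazureE i j f; have := congr1 (msym (tperm i j)) E.
rewrite msymM !msymB !msymM symK !symX tpermL tpermR => E'.
apply/eqP; rewrite -subr_eq0; have /eqP : ('X_i - 'X_j) *
    (msym (tperm i j) (demazure i j f) - demazure i j f) = 0.
  by rewrite mulrBr E -(opprB 'X_j) mulNr E' opprB subrr.
by rewrite mulf_eq0 (negPf mulX_sub_neq0).
Qed.

Section Dominant.
Variables (f : {mpoly K[n]}) (w : 'rV[R]_n) (h : R).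
Hypotheses (wij : w 0 j < w 0 i)
  (hle : forall m, m \in msupp f -> dot w (exponent m) <= h)
  (hswap : forall m, m \in msupp f -> dot (swapv i j w) (exponent m) <= h)
  (hex : exists2 m, m \in msupp f & dot w (exponent m) = h).
Let g := demazure i j f.

Let top : exists2 b, b \in msupp g & forall m, m \in msupp g ->
  dot w (exponent m) <= dot w (exponent b).
Proof.
apply: (@seq_argmax _ _ (fun m => dot w (exponent m))); rewrite msupp_eq0.
apply/eqP => g0; have := demazureE i j f; rewrite -/g g0 mulr0 => /eqP.
rewrite eq_sym subr_eq0 => /eqP E; have [m mf mE] := hex.
have : (U_(i) + m)%MM \in msupp ('X_j * msym (tperm i j) f).
  by apply: msupp_neq0; rewrite -E mcoeff_mulX -mcoeff_msupp.
case/msupp_mulX => m'; rewrite msupp_swap => /hswap; rewrite dot_exponent_swapv.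
rewrite swapvK => h1 /(congr1 (fun m => dot w (exponent m))).
by rewrite !dot_exponentU mE => h2; move: h1 h2 wij; lra.
Qed.

(** For a top exponent [b] of [g], the term of ['X_i * g] at [b] cannot be cancelled by ['X_j * g],
    as [w_j < w_i]. It therefore occurs on the right of [demazureE], where no weight exceeds
    [w_i + h]. *)
Lemma demazure_weight_le m : m \in msupp g -> dot w (exponent m) <= h.
Proof.
have [b bg hb] := top; move=> /hb hm; apply: le_trans hm _.
have : (U_(i) + b)%MM \in msupp (('X_i - 'X_j) * g).
  apply: msupp_neq0; rewrite mulrBl mcoeffB mcoeff_mulX.
  suff -> : ('X_j * g)@_(U_(i) + b) = 0 by rewrite subr0 -mcoeff_msupp.
  apply/eqP/negPn/negP => /msupp_neq0/msupp_mulX[c /hb hc].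
  by move=> /(congr1 (fun m => dot w (exponent m))); rewrite !dot_exponentU => h2; move: hc h2 wij; lra.
rewrite demazureE => /msuppB_le; rewrite mem_cat => /orP[] /msupp_mulX[c].
  by move=> /hle hc /addmI ->.
rewrite msupp_swap => /hswap; rewrite dot_exponent_swapv swapvK => hc.
by move=> /(congr1 (fun m => dot w (exponent m))); rewrite !dot_exponentU => h2; move: hc h2 wij; lra.
Qed.

(** A top term of [f] times [x_i] survives on the right of [demazureE]; on the left it can only come
    from ['X_i * g], since ['X_j * g] stays below that weight. *)
Lemma demazure_weight_attained : exists2 m, m \in msupp g & dot w (exponent m) = h.
Proof.
have [m mf mE] := hex.
have : (U_(i) + m)%MM \in msupp ('X_i * f - 'X_j * msym (tperm i j) f).
  apply: msupp_neq0; rewrite mcoeffB mcoeff_mulX.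
  suff -> : ('X_j * msym (tperm i j) f)@_(U_(i) + m) = 0 by rewrite subr0 -mcoeff_msupp.
  apply/eqP/negPn/negP => /msupp_neq0/msupp_mulX[c].
  rewrite msupp_swap => /hswap; rewrite dot_exponent_swapv swapvK => hc.
  by move=> /(congr1 (fun m => dot w (exponent m))); rewrite !dot_exponentU mE => h2; exfalso; move: hc h2 wij; lra.
rewrite -demazureE mulrBl => /msuppB_le; rewrite mem_cat => /orP[] /msupp_mulX[c].
  by move=> cg /addmI mc; exists m; rewrite // mc.
move=> /demazure_weight_le hc /(congr1 (fun m => dot w (exponent m))).
by rewrite !dot_exponentU mE => h2; exfalso; move: hc h2 wij; lra.
Qed.

End Dominant.

End DemazureNewton.

(** * The Newton polytope of the Demazure operator *)

Section NewtonDemazure.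
Variables (R : realType) (n : nat) (i j : 'I_n).
Hypothesis hij : nat_of_ord j = (nat_of_ord i).+1.
Let C : numClosedFieldType := complex R.
Variables (D : diagram n) (chi : {mpoly C[n]}).
Hypotheses (asc : has_ascent D i j) (chiE : Newton chi = hull (lowered_points R D)).
Let ij : i != j. Proof. by rewrite -val_eqE /= hij neq_ltn leqnn. Qed.
Let H (w : 'rV[R]_n) := schubitope w (swap_diagram i j D).
Let g := demazure i j chi.

Let chi_le (w : 'rV[R]_n) m : m \in msupp chi -> dot w (exponent R m) <= schubitope w D.
Proof.
move=> ms; apply: hull_lowered_points_le; rewrite -chiE.
by apply: mem_hull; apply: map_f.
Qed.

Let chi_attained (w : 'rV[R]_n) : exists2 m, m \in msupp chi & dot w (exponent R m) = schubitope w D.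
Proof.
have [a ap aE] := lowered_points_max w D.
have : Newton chi a by rewrite chiE; apply: mem_hull.
move=> /hullP/(_ w)[_ /mapP[m ms ->]] le; exists m => //.
by apply/eqP; rewrite eq_le chi_le //= -aE.
Qed.

Let dominant (w : 'rV[R]_n) : w 0 j < w 0 i ->
  (forall m, m \in msupp g -> dot w (exponent R m) <= H w) /\
  exists2 m, m \in msupp g & dot w (exponent R m) = H w.
Proof.
move=> wij; have HE : H w = schubitope w D by rewrite /H schubitope_swap // ltW.
have le m : m \in msupp chi -> dot w (exponent R m) <= H w by rewrite HE; apply: chi_le.
have swle m : m \in msupp chi -> dot (swapv i j w) (exponent R m) <= H w.
  move=> ms; rewrite HE; apply: le_trans (chi_le _ ms) _.
  by apply: schubitope_swapv_le => //; apply: ltW.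
have ex : exists2 m, m \in msupp chi & dot w (exponent R m) = H w.
  by rewrite HE; apply: chi_attained.
split=> [m|]; first exact: (demazure_weight_le wij le swle ex).
exact: (demazure_weight_attained wij le swle ex).
Qed.

Let generic (w : 'rV[R]_n) : w 0 i != w 0 j ->
  (forall m, m \in msupp g -> dot w (exponent R m) <= H w) /\
  exists2 m, m \in msupp g & dot w (exponent R m) = H w.
Proof.
rewrite neq_lt => /orP[wij|]; last exact: dominant.
have [] := @dominant (swapv i j w); first by rewrite !mxE tpermL tpermR.
rewrite /H schubitope_swapv // => le [m mg mE].
have swg (m' : 'X_{1..n}) : ([multinom m' (tperm i j k) | k < n] \in msupp g) = (m' \in msupp g).
  by rewrite -msupp_swap msym_demazure.
split=> [m' m'g|].
  have := le [multinom m' (tperm i j k) | k < n].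
  by rewrite swg dot_exponent_swapv swapvK; apply.
by exists [multinom m (tperm i j k) | k < n]; rewrite ?swg // dot_exponent_swapv.
Qed.

Lemma perturb (w : 'rV[R]_n) (eps : R) : 0 < eps -> exists2 w' : 'rV[R]_n,
  (forall k, `|w' 0 k - w 0 k| <= eps) & w' 0 i != w' 0 j.
Proof.
move=> eps0; have [wij|wij] := eqVneq (w 0 i) (w 0 j); last first.
  by exists w => // k; rewrite subrr normr0 ltW.
exists (w + eps *: delta_mx 0 i) => [k|].
  rewrite !mxE addrAC subrr add0r normrM ger0_norm ?(ltW eps0) // ler_piMr ?(ltW eps0) //.
  by rewrite eqxx; case: eqP => _ //=; rewrite ?normr1 ?normr0.
rewrite !mxE !eqxx wij (eq_sym j) (negPf ij) mulr1 mulr0 addr0.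
by rewrite -subr_eq0 addrAC subrr add0r gt_eqF.
Qed.

Theorem Newton_demazure : Newton g = hull (lowered_points R (swap_diagram i j D)).
Proof.
apply/seteqP; split; apply: sub_hull; apply: hull_dense => w eps eps0;
  have [w' w'w w'ij] := perturb w eps0; have [le ex] := generic w'ij; exists w' => // a.
  move=> /mapP[m mg ->]; have [b bp bE] := lowered_points_max w' (swap_diagram i j D).
  by exists b => //; rewrite bE; apply: le.
have [m mg mE] := ex => ap.
exists (exponent R m); first exact: map_f.
by rewrite mE; apply: lowered_points_le.
Qed.

End NewtonDemazure.

Theorem theorem6p8 (R : realType) (n : nat) (i j : 'I_n)
    (hij : nat_of_ord j = (nat_of_ord i).+1) (D : diagram n)
    (chi chi' : {mpoly (complex R)[n]})
    (hchi : is_character D chi)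
    (hchi' : is_character (swap_diagram i j D) chi')
    (hascent : has_ascent D i j)
    (hMV : is_MV (Newton chi)) :
  iter (num_raises D i j) (raise i j) (Newton chi) = Newton chi' /\
  Newton chi' = Newton (demazure i j chi).
Proof.
have chiE := Newton_character hchi; have chiE' := Newton_character hchi'.
split; last by rewrite chiE' (Newton_demazure hij hascent chiE).
by rewrite chiE' chiE raise_lowered_points // -chiE.
Qed.
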